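(* Let $q$ be the fixed cardinality of the finite field $\mathbb{F}_q$ and assume $q\equiv 1\pmod 4$. Then, as $g\to\infty$, with $|D|=q^{2g+1}$, $$\sum_{D\in\mathcal{H}_{2g+1,q}}P_{C_D}(q^{-1/2})=\frac{P(1)}{2\zeta_A(2)}|D|\left\{\log_q|D|+1+\frac{4}{\log q}\frac{P'}{P}(1)\right\}+O\left(|D|^{3/4+\frac{\log_q 2}{2}}\right),$$ where $$P(s)=\prod_{\substack{P\ \mathrm{monic}\\ \mathrm{irreducible}}}\left(1-\frac{1}{(|P|+1)|P|^{s}}\right),\qquad \zeta_A(s)=\frac{1}{1-q^{1-s}}.$$
   Context: $A=\mathbb{F}_q[x]$. For nonzero $f\in\mathbb{F}_q[x]$, $|f|=q^{\deg f}$. $\mathcal{H}_{2g+1,q}$ is the set of monic square-free polynomials $D\in\mathbb{F}_q[x]$ of degree $2g+1$ ($g\ge 1$); so $|D|=q^{2g+1}$ for every such $D$. For $D\in\mathcal{H}_{2g+1,q}$, $C_D$ is the hyperelliptic curve of genus $g$ with affine equation $y^2=D(x)$, and $P_{C_D}(u)$ is the numerator of its zeta function $Z_{C_D}(u)=\exp\left(\sum_{n\ge1}\#C_D(\mathbb{F}_{q^n})\,u^n/n\right)=\frac{P_{C_D}(u)}{(1-u)(1-qu)}$, a polynomial in $\mathbb{Z}[u]$ of degree $2g$ with $P_{C_D}(0)=1$. Equivalently, $P_{C_D}(u)=\mathcal{L}(u,\chi_D)=\sum_{n\ge 0}\Big(\sum_{f\text{ monic},\,\deg f=n}\chi_D(f)\Big)u^n$,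 which is a polynomial in $u$, where $\chi_D(f)=\left(\frac{D}{f}\right)$ is the Jacobi symbol in $\mathbb{F}_q[x]$ (equal to $0$ if $D,f$ are not coprime). The number $q$ is fixed; the implied constant may depend on $q$. *)

(* Defs.v *)
From HB Require Import structures.
From mathcomp Require Import all_boot all_order all_algebra all_field.
From mathcomp Require Import all_classical all_reals all_analysis.

Set Implicit Arguments.
Unset Strict Implicit.
Unset Printing Implicit Defensive.

Import Order.TTheory GRing.Theory Num.Theory.
Import numFieldNormedType.Exports.

Local Open Scope classical_set_scope.
Local Open Scope ring_scope.

Section Curve.
Variable F : finFieldType.

Implicit Types (f D : {poly F}).

Definition square_free f : Prop :=
  forall d, d ^+ 2 %| f -> size d = 1%N.

(* Recall that size f = deg f + 1 for f != 0. *)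
Definition hyper_ensemble (g : nat) : set {poly F} :=
  [set D | [/\ D \is monic, size D = (2 * g + 1).+1 & square_free D]].

Lemma ext_poly_neq0 (n : nat) : 'X^(#|F| ^ n.+1) - 'X != 0 :> {poly F}.
Proof.
have lt1 : (1 < #|F| ^ n.+1)%N by rewrite -(exp1n n.+1) ltn_exp2r ?finNzRing_gt1.
rewrite -size_poly_eq0 size_polyDl ?size_polyXn //.
by rewrite size_polyN size_polyX ltnS.
Qed.

(* The extension of F of degree n.+1 (not n), as the splitting field over F of *)
(* X^(q^(n+1)) - X. The index is shifted because this polynomial vanishes for  *)
(* the exponent q^0.                                                           *)
Definition ext_field (n : nat) : splittingFieldType F :=
  sval (FinSplittingFieldFor (ext_poly_neq0 n)).

Lemma card_ext_field (n : nat) :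
  #|finvect_type (ext_field n)| = (#|F| ^ n.+1)%N.
Proof.
rewrite /ext_field; set m := (#|F| ^ n.+1)%N.
have m_gt1 : (1 < m)%N by rewrite -(exp1n n.+1) ltn_exp2r ?finNzRing_gt1.
case: (FinSplittingFieldFor _) => L /= splitLq.
have Dq : 'X^m - 'X = ('X^(m.-1) - 1) * ('X - 0) :> {poly L}.
  by rewrite subr0 mulrBl mul1r -exprSr prednK // ltnW.
rewrite rmorphB /= map_polyXn map_polyX in splitLq.
have [a _ Da] := finField_galois_generator (sub1v {:L}%VS).
rewrite dimv1 expn1 in Da.
pose Em := fixedSpace (a ^+ n.+1)%g.
have [zs DqL defL] := splitLq.
have m0 : m%:R = 0 :> L.
  have q0 : #|F|%:R = 0 :> F.
    have /eqP : \sum_(x : F) x = \sum_(x : F) (x + 1) by exact: (reindex_inj (addIr 1)).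
    by rewrite big_split /= sumr_const -subr_eq0 opprD addNKr oppr_eq0 => /eqP.
  by rewrite /m natrX -(rmorph_nat (in_alg L)) q0 rmorph0 expr0n.
have Uzs : uniq zs.
  rewrite -separable_prod_XsubC -(eqp_separable DqL) Dq separable_root andbC.
  rewrite /root !hornerE subr_eq0 eq_sym expr0n gtn_eqF ?oner_eq0 //=; last first.
    by rewrite -ltnS prednK // ltnW.
  rewrite cyclotomic.separable_Xn_sub_1 // -subn1 natrB ?m0 1?ltnW //.
  by rewrite sub0r oppr_eq0 oner_eq0.
suffices /eq_card-> : finvect_type L =i zs.
  apply: succn_inj; rewrite (card_uniqP _) //= -(size_prod_XsubC _ id).
  by rewrite -(eqp_size DqL) size_polyDl size_polyXn // size_polyN size_polyX.
have in_zs : zs =i Em.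
  move=> z; rewrite -root_prod_XsubC -(eqp_root DqL) (sameP fixedSpaceP eqP).
  rewrite /root !hornerE subr_eq0 /= /m; congr (_ == z).
  elim: n.+1 => [|i IHi]; first by rewrite gal_id.
  by rewrite expgSr expnSr exprM IHi galM ?Da ?memvf.
suffices defEm : Em = {:L}%VS by move=> z; rewrite in_zs defEm memvf.
apply/eqP; rewrite eqEsubv subvf -defL -[Em]subfield_closed agenvS //.
by rewrite subv_add sub1v; apply/span_subvP=> z; rewrite in_zs.
Qed.

(* Number of points of C_D over the extension of F of degree n.+1: the affine  *)
(* solutions of y^2 = D(x), plus one, since the smooth projective model of the *)
(* curve has exactly one point at infinity when deg D is odd.                  *)
Definition card_curve D (n : nat) : nat :=
  let K : finFieldType := finvect_type (ext_field n) in
  #|[set p : K * K | p.2 ^+ 2 == (map_poly (in_alg (ext_field n)) D).[p.1]]%SET|.+1.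

(* A polynomial congruent modulo X^n to the power series                       *)
(* Z(u) = exp (\sum_(m >= 1) #C_D(F_(q^m)) u^m / m).                           *)
Definition zeta_trunc D (n : nat) : {poly rat} :=
  \sum_(k < n) k`!%:R^-1 *:
    (\sum_(m < n) ((card_curve D m)%:R / m.+1%:R) *: 'X^(m.+1)) ^+ k.

(* Z(u) (1 - u) (1 - q u) = p(u) as formal power series. *)
Definition zeta_numerator D (p : {poly int}) : Prop :=
  forall n : nat,
    'X^n %| zeta_trunc D n * (1 - 'X) * (1 - #|F|%:R *: 'X) - map_poly intr p.

(* P_(C_D); the default value 0 is irrelevant for D in hyper_ensemble g. *)
Definition curve_poly D : {poly int} := xget 0 [set p | zeta_numerator D p].

End Curve.

Arguments hyper_ensemble F g : clear implicits.

Section EulerProduct.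
Variables (R : realType) (F : finFieldType).

Definition poly_norm (f : {poly F}) : R := #|F|%:R ^+ (size f).-1.

Definition prime_polys (n : nat) : set {poly F} :=
  [set p | [/\ p \is monic, irreducible_poly p & (size p <= n.+1)%N]].

(* The infinite product is absolutely convergent for s > 0; it is taken over   *)
(* the primes of degree at most n, as n tends to infinity.                     *)
Definition euler_P (s : R) : R :=
  limn (fun n : nat => \big[*%R/1]_(p \in prime_polys n)
          (1 - 1 / ((poly_norm p + 1) * poly_norm p `^ s))).

Definition zeta_A (s : R) : R := 1 / (1 - #|F|%:R `^ (1 - s)).

Definition logq (x : R) : R := ln x / ln #|F|%:R.

End EulerProduct.

(* Main.v *)
Require Import Defs.
From HB Require Import structures.
From mathcomp Require Import all_boot all_order all_algebra all_field.
From mathcomp Require Import all_classical all_reals all_analysis.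
From mathcomp Require Import ring lra zify.

(* Write q = #|F|, N = 2 g + 1, and A_n(D) for the sum of the Jacobi symbols   *)
(* (D/f) over the monic f of degree n.  Counting points over the extensions of *)
(* F shows that P_(C_D)(u) = \sum_n A_n(D) u^n, and the functional equation    *)
(* A_(2g-n)(D) = q^(g-n) A_n(D) expresses P_(C_D)(q^(-1/2)) through the A_n(D) *)
(* with n <= g.                                                                *)
(* For a fixed f of degree m <= g, the sum of (D/f) over the squarefree D of   *)
(* degree N is a combination of the complete sums over all monic B of degree   *)
(* n = N - 2c.  For n >= m a complete sum vanishes if f is not a square, and   *)
(* is explicit if f is one; for n < m the trivial bound q^n suffices, since    *)
(* the total weight of these c is, by Rankin's trick with 2^(-c), at most 2^g  *)
(* times a factor which is bounded on average over f.  In particular no bound  *)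
(* of the strength of the Riemann hypothesis for curves is needed.             *)
(* The squares f = l^2 produce the main term: the averages over l are the      *)
(* coefficients of E(u) / (1 - q u), where E is the power series such that     *)
(* P(s) = E(q^(-s)).                                                           *)

Set Implicit Arguments.
Unset Strict Implicit.
Unset Printing Implicit Defensive.

Import Order.TTheory GRing.Theory Num.Theory.
Import numFieldNormedType.Exports.

Local Open Scope ring_scope.

(** * Monic and irreducible polynomials *)

(** Reduction to character sums. Grouping the points of C_D over an extension by minimal polynomials
    ([sum_qr_irr], [card_curveE]) shows that the logarithmic derivative of Z(u)(1 - u)(1 - q u) has
    the coefficients [psum]. Unique factorization gives the L-series the same recurrence
    ([Lcoef_newton]), so the two series agree ([curve_polyE]). As q = 1 mod 4, reciprocity reads
    (D/f) = (f/D) ([leg_recip], [chi_recip]). Hence A_n(D) is a sum of values of a character modulo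
    D: it vanishes for n > 2 g, and a Gauss sum with values in the integers gives the functional
    equation ([functional_equation]). At u = q^(-1/2) this folds P_(C_D) onto the terms n <= g
    ([Lpoly_central]).

    Error term. After exchanging the sums, [sqf_charsum_estimate] treats one f of degree n <= g:
    unless f is a square, the sum of (D/f) over D is at most 2^g q^n times constants and a weight
    [rankin_weight], whose average over f is bounded ([rankin_weight_avg]). There are q^n
    polynomials f, each with weight q^(-n/2), so the total error is of order 2^g q^(3g/2), which is
    |D|^(3/4 + log_q 2 / 2) up to a constant ([error_exponent]).

    Main term. A square f = l^2 contributes (1 - 1/q) |D| times the product of 1 - 1/(|p| + 1) over
    p dividing l. Summed with weight q^(-deg l) over deg l <= y this product gives (y + 1) E(1/q) -
    E'(1/q)/q + O((2/q)^y), because the coefficients of E grow at most like 2^k and q >= 5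
    ([ecoef_le], [msum_estimate]). The values y = floor(g/2) and y = floor((g-1)/2) both occur, and
    the two numbers y + 1 add up to g + 1 = (log_q |D| + 1)/2. The chain rule for P(s) = E(q^(-s))
    turns E'(1/q) into P'(1) ([euler_P_derive], [main_termE]). *)

Section MonicPolynomials.

Variable F : finFieldType.
Implicit Types (f g d p : {poly F}).

Definition mon n : seq {poly F} := [seq 'X^n + val h | h : {poly_n F}].

Lemma mem_mon n f : (f \in mon n) = (f \is monic) && (size f == n.+1).
Proof.
apply/mapP/andP => [[h _ ->]|[fm /eqP sf]].
  have sh : (size (val h) < size ('X^n : {poly F}))%N.
    by rewrite size_polyXn ltnS size_npoly.
  by rewrite monicE lead_coefDl // lead_coefXn size_polyDl // size_polyXn !eqxx.
have sh : (size (f - 'X^n)%R <= n)%N.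
  apply/leq_sizeP => j; rewrite leq_eqVlt => /orP[/eqP<-|nj].
    rewrite coefB coefXn eqxx; move: fm; rewrite monicE lead_coefE sf => /eqP->.
    by rewrite subrr.
  by rewrite coefB coefXn (gtn_eqF nj) nth_default ?subr0 // sf.
exists (NPoly sh); first by rewrite mem_enum.
by rewrite /= addrC subrK.
Qed.

Lemma mon_uniq n : uniq (mon n).
Proof. by rewrite map_inj_uniq ?enum_uniq // => x y /addrI /val_inj. Qed.

Lemma size_mon n : size (mon n) = (#|F| ^ n)%N.
Proof. by rewrite size_map -cardE card_npoly. Qed.

Lemma mon_monic n f : f \in mon n -> f \is monic.
Proof. by rewrite mem_mon => /andP[]. Qed.

Lemma mon_size n f : f \in mon n -> size f = n.+1.
Proof. by rewrite mem_mon => /andP[_ /eqP]. Qed.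

Lemma monic_in_mon f : f \is monic -> f \in mon (size f).-1.
Proof. by move=> fm; rewrite mem_mon fm polySpred ?monic_neq0 //=. Qed.

Lemma mon0 : mon 0 = [:: 1].
Proof.
apply: perm_small_eq => //; apply: uniq_perm; rewrite ?mon_uniq // => f.
rewrite mem_mon inE; apply/andP/eqP => [[fm /eqP sf]|->].
  have fE : f = (f`_0)%:P by apply: size1_polyC; rewrite sf.
  by move: fm; rewrite fE monicE lead_coefC => /eqP->.
by rewrite monic1 size_poly1.
Qed.

Lemma size_monM f g : f \is monic -> g \is monic ->
  (size (f * g)).-1 = ((size f).-1 + (size g).-1)%N.
Proof.
move=> fm gm; rewrite size_monicM ?monic_neq0 //.
by rewrite (polySpred (monic_neq0 fm)) (polySpred (monic_neq0 gm)) addSn addnS.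
Qed.

Lemma monM m n f g : f \in mon m -> g \in mon n -> f * g \in mon (m + n).
Proof.
rewrite !mem_mon => /andP[fm /eqP sf] /andP[gm /eqP sg].
by rewrite monicMl // gm size_monicM ?monic_neq0 // sf sg /= addnS.
Qed.

Lemma perm_mon_dvd n d : d \is monic -> ((size d).-1 <= n)%N ->
  perm_eq [seq f <- mon n | d %| f] [seq d * e | e <- mon (n - (size d).-1)].
Proof.
move=> dm dn; have d0 := monic_neq0 dm.
apply: uniq_perm; first by rewrite filter_uniq ?mon_uniq.
  by rewrite map_inj_uniq ?mon_uniq // => x y /(mulfI d0).
move=> f; rewrite mem_filter; apply/andP/mapP => [[df fm]|[e em ->]].
  have [e fE] := dvdpP _ _ df; rewrite mulrC in fE.
  exists e => //; move: fm; rewrite fE !mem_mon monicMl // => /andP[em].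
  rewrite em size_monicM ?monic_neq0 // (polySpred d0) addSn /=.
  by rewrite -{1}(subnKC dn) -addnS eqn_add2l.
split; first by rewrite dvdp_mulr.
by rewrite -(subnKC dn) monM // monic_in_mon.
Qed.

Lemma sum_mon_dvd (V : nmodType) n d (G : {poly F} -> V) : d \is monic ->
  \sum_(f <- mon n | d %| f) G f =
  if ((size d).-1 <= n)%N then \sum_(e <- mon (n - (size d).-1)) G (d * e)
  else 0.
Proof.
move=> dm; case: leqP => dn.
  by rewrite -big_filter (perm_big _ (perm_mon_dvd dm dn)) big_map.
rewrite big_seq_cond big_pred0 // => f; apply/andP => -[fm df].
have := dvdp_leq (monic_neq0 (mon_monic fm)) df.
by rewrite (mon_size fm) (polySpred (monic_neq0 dm)) ltnS leqNgt dn.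
Qed.

Definition irr n : seq {poly F} :=
  [seq p <- [seq val h | h : {poly_(n.+1) F}] | (p \is monic) && irreducibleb p].

Definition mirr p := (p \is monic) && irreducibleb p.

Lemma mem_irr n p : (p \in irr n) = mirr p && (size p <= n.+1)%N.
Proof.
rewrite mem_filter /mirr; congr andb; apply/mapP/idP => [[h _ ->]|sp].
  by rewrite size_npoly.
by exists (NPoly (sp : p \is a poly_of_size n.+1)); rewrite ?mem_enum.
Qed.

Lemma irr_uniq n : uniq (irr n).
Proof. by rewrite filter_uniq // map_inj_uniq ?enum_uniq //; exact: val_inj. Qed.

Lemma mirr_monic p : mirr p -> p \is monic.
Proof. by case/andP. Qed.

Lemma mirrP p : mirr p -> irreducible_poly p.
Proof. by case/andP => _ /irreducibleP. Qed.

Lemma mirr_size p : mirr p -> (1 < size p)%N.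
Proof. by case/mirrP. Qed.

Lemma mirr_neq0 p : mirr p -> p != 0.
Proof. by move/mirr_monic/monic_neq0. Qed.

Lemma mirr_dvdM p f g : mirr p -> (p %| f * g) = (p %| f) || (p %| g).
Proof.
move=> pi; apply/idP/orP => [pfg|[]]; last 2 first.
- exact: dvdp_mulr.
- exact: dvdp_mull.
have [pf|pf] := boolP (p %| f); first by left.
by right; rewrite -(Gauss_dvdpr _ (_ : coprimep p f)) // irreducible_poly_coprime //; exact: mirrP.
Qed.

Lemma mirr_dvdX p f n : mirr p -> (p %| f ^+ n) = (0 < n)%N && (p %| f).
Proof.
move=> pi; elim: n => [|n IHn].
  by rewrite expr0 dvdp1; have := mirr_size pi; case: (size p) => [|[]].
by rewrite exprS mirr_dvdM // IHn /=; case: (p %| f); rewrite ?andbF.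
Qed.

Lemma monic_eqp_eq f g : f \is monic -> g \is monic -> f %= g -> f = g.
Proof. by move=> fm gm fg; apply/eqP; rewrite -eqp_monic. Qed.

Lemma mirr_dvd_eq p p' : mirr p -> mirr p' -> p %| p' -> p = p'.
Proof.
move=> pi pi' pp'; apply: monic_eqp_eq; rewrite ?mirr_monic //.
case: (mirrP pi') => _; apply => //.
by have := mirr_size pi; case: (size p) => [|[]].
Qed.

Lemma mirr_dvd_exists f : (1 < size f)%N -> exists2 p, mirr p & p %| f.
Proof.
have [n] := ubnP (size f); elim: n f => // n IHn f; rewrite ltnS => sfn sf.
have f0 : f != 0 by rewrite -size_poly_gt0 ltnW.
have l0 : lead_coef f != 0 by rewrite lead_coef_eq0.
have [fi|] := boolP (irreducibleb f).
  exists ((lead_coef f)^-1 *: f); last by rewrite dvdpZl ?invr_eq0.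
  rewrite /mirr monicE lead_coefZ mulVf // eqxx /=.
  apply/irreducibleP; case/irreducibleP: fi => _ fi; split.
    by rewrite size_scale ?invr_eq0.
  move=> d sd; rewrite dvdpZr ?invr_eq0 // => /(fi _ sd) /eqp_trans; apply.
  by rewrite eqp_sym eqp_scale ?invr_eq0.
rewrite negb_and sf /= negb_forall => /existsP[d].
rewrite negb_imply -ltnNge => /andP[df sd].
have [|p pi prime_divs] := IHn (val d) _ sd.
  apply: leq_trans sfn; apply: leq_ltn_trans (size_npoly d) _.
  by case: (size f) sf.
by exists p => //; apply: dvdp_trans prime_divs _; rewrite dvdpE.
Qed.

Lemma monic_ind (Q : {poly F} -> Prop) : Q 1 ->
  (forall p f, mirr p -> f \is monic -> Q f -> Q (p * f)) ->
  forall f, f \is monic -> Q f.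
Proof.
move=> Q1 QM f; have [n] := ubnP (size f); elim: n f => // n IHn f.
rewrite ltnS => sfn fm.
case: (ltnP 1 (size f)) => [sf|sf]; last first.
  have /mon_size : f \in mon 0.
    rewrite mem_mon fm eqn_leq sf /=.
    by rewrite size_poly_gt0 monic_neq0.
  move=> s1; have : f \in mon 0 by rewrite mem_mon fm s1.
  by rewrite mon0 inE => /eqP->.
have [p pi /dvdpP[g fE]] := mirr_dvd_exists sf.
rewrite mulrC in fE; subst f.
have gm : g \is monic by move: fm; rewrite monicMl // mirr_monic.
apply: QM => //; apply: IHn => //; apply: leq_trans sfn.
rewrite size_monicM ?mirr_monic ?monic_neq0 //.
by have := mirr_size pi; case: (size p) => [|[|s]] //= _; rewrite addSn /= ltnS leq_addl.
Qed.

(* The bound on k is harmless, as p ^+ k %| f forces k < size f. *)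
Definition vP p f : nat := (\sum_(1 <= k < size f) (p ^+ k %| f)%R)%N.

Lemma mirr_decomp p f : mirr p -> f != 0 ->
  exists v g, f = p ^+ v * g /\ ~~ (p %| g).
Proof.
move=> pi; have [n] := ubnP (size f); elim: n f => // n IHn f.
rewrite ltnS => sfn f0; have [/dvdpP[g fE]|pf] := boolP (p %| f); last first.
  by exists 0%N, f; rewrite expr0 mul1r.
rewrite mulrC in fE; subst f; move: f0; rewrite mulf_eq0 negb_or => /andP[p0 g0].
have [|//|v [h [gE ph]]] := IHn g.
  apply: leq_trans sfn; rewrite size_monicM ?mirr_monic //.
  by have := mirr_size pi; case: (size p) => [|[|s]] //= _; rewrite addSn /= ltnS leq_addl.
by exists v.+1, h; rewrite exprS -mulrA -gE.
Qed.

Lemma mirr_dvd_pow p v g k : mirr p -> ~~ (p %| g) ->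
  (p ^+ k %| p ^+ v * g) = (k <= v)%N.
Proof.
move=> pi pg; case: leqP => kv.
  by rewrite dvdp_mulr // dvdp_exp2l.
apply/negP; rewrite -(subnKC kv) addSn -addnS exprD.
rewrite dvdp_mul2l ?expf_neq0 ?mirr_neq0 // exprS => /(dvdp_trans (dvdp_mulr _ (dvdpp p))).
by apply/negP.
Qed.

Lemma vP_eq p v g : mirr p -> g != 0 -> ~~ (p %| g) -> vP p (p ^+ v * g) = v.
Proof.
move=> pi g0 pg; rewrite /vP.
under eq_bigr do rewrite mirr_dvd_pow //.
have vs : (v.+1 <= size (p ^+ v * g)%R)%N.
  rewrite size_monicM ?monic_exp ?mirr_monic //.
  rewrite (polySpred g0) addnS /=; apply: leq_trans (leq_addr _ _).
  elim: v => [|v IHv]; first by rewrite size_poly1.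
  rewrite exprS size_monicM ?expf_neq0 ?mirr_neq0 ?mirr_monic //.
  have := mirr_size pi; move: IHv; move: (size p) (size _) => a b; lia.
rewrite (@big_cat_nat _ _ _ v.+1) //=.
under eq_big_nat => i /andP[_ iv] do rewrite -ltnS iv.
rewrite sum_nat_const_nat subSS subn0 muln1.
rewrite big_nat_cond big1 ?addn0 // => i; rewrite andbT => /andP[iv _].
by rewrite leqNgt iv.
Qed.

Lemma vPM p f g : mirr p -> f != 0 -> g != 0 -> vP p (f * g) = (vP p f + vP p g)%N.
Proof.
move=> pi f0 g0; have [v [f' [fE pf]]] := mirr_decomp pi f0.
have [w [g' [gE pg]]] := mirr_decomp pi g0.
move: f0 g0; rewrite fE gE !mulf_eq0 !negb_or => /andP[_ f0] /andP[_ g0].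
rewrite mulrACA -exprD !vP_eq //; first by rewrite mulf_neq0.
by rewrite mirr_dvdM // negb_or pf.
Qed.

Lemma vP0 p f : mirr p -> f != 0 -> ~~ (p %| f) -> vP p f = 0%N.
Proof. by move=> pi f0 pf; have := vP_eq 0 pi f0 pf; rewrite expr0 mul1r. Qed.

Lemma vP_irr p p' : mirr p -> mirr p' -> vP p p' = (p == p').
Proof.
move=> pi pi'; case: eqVneq => [<-|pp'].
  have /(vP_eq 1 pi) : (1 : {poly F}) != 0 by rewrite oner_eq0.
  rewrite expr1 mulr1; apply; rewrite dvdp1.
  by have := mirr_size pi; case: (size p) => [|[]].
apply: vP0 => //; first exact: mirr_neq0.
by apply: contra pp' => /(mirr_dvd_eq pi pi')->.
Qed.

Lemma dvd_vP p f k : mirr p -> f != 0 -> (p ^+ k %| f) = (k <= vP p f)%N.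
Proof.
move=> pi f0; have [v [g [fE pg]]] := mirr_decomp pi f0.
move: (f0); rewrite fE mulf_eq0 negb_or => /andP[_ g0].
by rewrite mirr_dvd_pow // vP_eq.
Qed.

Lemma prod_irr_vP f n : f \is monic -> (size f <= n.+1)%N ->
  f = \prod_(p <- irr n) p ^+ vP p f.
Proof.
move=> fm; move: f fm; apply: monic_ind => [_|p f pi fm IH sf].
  rewrite big_seq big1 // => p; rewrite mem_irr => /andP[pi _].
  rewrite vP0 ?oner_eq0 // dvdp1.
  by have := mirr_size pi; case: (size p) => [|[]].
have sM := size_monM (mirr_monic pi) fm.
have := mirr_size pi; have := monic_neq0 fm; rewrite -size_poly_gt0 => f0 p1.
rewrite [RHS](_ : _ = \prod_(p' <- irr n) (p' ^+ (p' == p) * p' ^+ vP p' f)); last first.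
  rewrite [LHS]big_seq [RHS]big_seq; apply: eq_bigr => p'.
  rewrite mem_irr => /andP[pi' _].
  rewrite vPM //; last 2 first. exact: mirr_neq0. exact: monic_neq0.
  by rewrite exprD vP_irr.
rewrite big_split /= -IH; last by lia.
congr (_ * _); rewrite (bigD1_seq p) ?irr_uniq //=; last first.
  by move: sf; rewrite mem_irr pi size_monicM ?mirr_monic ?monic_neq0 //; lia.
rewrite eqxx expr1 big1 ?mulr1 // => p' pp'.
by rewrite (negbTE pp') expr0.
Qed.

Lemma coprimep_mirr f g : f != 0 ->
  reflect (forall p, mirr p -> p %| f -> ~~ (p %| g)) (coprimep f g).
Proof.
move=> f0; apply: (iffP idP) => [fg p pi pf|H].
  apply/negP => pg; have := coprimepP _ _ fg p pf pg.
  by rewrite -size_poly_eq1; have := mirr_size pi; case: (size p) => [|[]].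
rewrite /coprimep eqn_leq [X in _ && X]lt0n size_poly_eq0 gcdp_eq0 negb_and f0 /= andbT.
rewrite leqNgt; apply/negP => /mirr_dvd_exists[p pi].
by rewrite dvdp_gcd => /andP[/(H _ pi) /negbTE->].
Qed.

End MonicPolynomials.

(** * The quadratic character of a finite field *)

Section QuadraticCharacter.

Variable k : finFieldType.
Hypothesis k_odd : odd #|k|.
Implicit Types w x y : k.

(* Euler's criterion, taken as a definition. *)
Definition qr w : int :=
  if w == 0 then 0 else if w ^+ (#|k|.-1)./2 == 1 then 1 else -1.

Lemma two_neq0 : 2%:R != 0 :> k.
Proof.
apply/negP => two0; have ch : 2%N \in [pchar k] by rewrite inE.
have := card_pprimeChar ch; set m := logn _ _ => cE.
move: k_odd; rewrite (_ : #|k| = 2 ^ m)%N //.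
by case: m cE => [/eqP|m _]; rewrite ?expnS ?oddM // expn0 eqn_leq leqNgt finNzRing_gt1.
Qed.

Lemma neq_opp1 : (1 : k) != -1.
Proof. by rewrite -subr_eq0 opprK -[1]/(1%:R) -natrD two_neq0. Qed.

Lemma half_double : ((#|k|.-1)./2 + (#|k|.-1)./2 = #|k|.-1)%N.
Proof.
have := k_odd; have := finNzRing_gt1 k; case: #|k| => //= n _.
by rewrite addnn => /negbTE on; have := odd_double_half n; rewrite on add0n.
Qed.

Lemma half_gt0 : (0 < (#|k|.-1)./2)%N.
Proof.
rewrite lt0n; apply/negP => /eqP h0; have := half_double; rewrite h0.
by have := finNzRing_gt1 k; case: #|_| => [|[]].
Qed.

Lemma expf_card1 x : x != 0 -> x ^+ #|k|.-1 = 1.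
Proof.
move=> x0; apply: (mulfI x0); rewrite -exprS mulr1 prednK ?expf_card //.
exact: ltnW (finNzRing_gt1 k).
Qed.

Lemma euler_pm x : x != 0 -> x ^+ (#|k|.-1)./2 = 1 \/ x ^+ (#|k|.-1)./2 = -1.
Proof.
move=> x0; have /eqP : x ^+ ((#|k|.-1)./2 + (#|k|.-1)./2) = 1.
  by rewrite half_double expf_card1.
by rewrite exprD -expr2 sqrf_eq1 => /orP[]/eqP; [left|right].
Qed.

Lemma qrE x : (qr x)%:~R = x ^+ (#|k|.-1)./2.
Proof.
rewrite /qr; case: eqVneq => [->|x0]; first by rewrite expr0n gtn_eqF ?half_gt0.
by case: (euler_pm x0) => ->; rewrite ?eqxx // [-1 == 1]eq_sym (negbTE neq_opp1) mulrN1z.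
Qed.

Definition pm1 (a : int) := [|| a == 0, a == 1 | a == -1].

Lemma qr_pm1 x : pm1 (qr x).
Proof. by rewrite /qr; case: ifP => // _; case: ifP. Qed.

Lemma pm1M a b : pm1 a -> pm1 b -> pm1 (a * b).
Proof. by case/or3P=> /eqP->; case/or3P=> /eqP->. Qed.

(** Symbols are integers, while Euler's criterion lives in a finite field. Identities between
    symbols are proved in the field and lifted back, since 0, 1 and -1 stay distinct in odd
    characteristic. *)
Lemma pm1_inj a b : pm1 a -> pm1 b -> a%:~R = b%:~R :> k -> a = b.
Proof.
have n11 := negbTE neq_opp1; have n11' := n11; rewrite eq_sym in n11'.
by case/or3P=> /eqP->; case/or3P=> /eqP-> //;
  rewrite ?mulr0z ?mulr1z ?mulrN1z => /eqP;
  rewrite ?oppr_eq0 ?[0 == _]eq_sym ?oppr_eq0 ?oner_eq0 ?n11 ?n11'.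
Qed.

Lemma qrM x y : qr (x * y) = qr x * qr y.
Proof.
apply: pm1_inj; rewrite ?pm1M ?qr_pm1 //.
by rewrite rmorphM /= !qrE exprMn.
Qed.

Lemma qr0 : qr 0 = 0.
Proof. by rewrite /qr eqxx. Qed.

Lemma qr1 : qr 1 = 1.
Proof. by rewrite /qr oner_eq0 expr1n eqxx. Qed.

Lemma qr_eq0 x : (qr x == 0) = (x == 0).
Proof. by rewrite /qr; case: ifP => // _; case: ifP. Qed.

Lemma qr_sqr x : x != 0 -> qr (x ^+ 2) = 1.
Proof.
by move=> x0; rewrite /qr expf_eq0 (negbTE x0) -exprM mulnC mulnC mul2n -addnn half_double
  expf_card1 ?eqxx.
Qed.

Lemma card_sqrt_le x : (#|[set y : k | y ^+ 2 == x]| <= 2)%N.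
Proof.
have p0 : 'X^2 - x%:P != 0 by rewrite -size_poly_eq0 size_XnsubC.
rewrite cardE -ltnS -(size_XnsubC x (isT : 0 < 2)%N).
apply: max_poly_roots; rewrite ?enum_uniq //.
by apply/allP => y; rewrite mem_enum inE => /eqP <-; rewrite rootE !hornerE subrr.
Qed.

(** The hard case is a nonsquare x with x^h = 1, where h = (|k| - 1)/2. Squaring is at most
    two-to-one, so the nonzero squares already supply h roots of X^h - 1, and x would be one root
    too many. *)
Lemma card_sqrt x : (#|[set y : k | y ^+ 2 == x]|)%:R = 1 + qr x :> int.
Proof.
case: (eqVneq x 0) => [->|x0].
  rewrite qr0 (_ : [set _ | _] = [set 0]) ?cards1 //.
  by apply/setP => y; rewrite !inE expf_eq0.
have [y0 y0x|] := pickP (fun y : k => y ^+ 2 == x).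
  have y00 : y0 != 0 by apply: contra x0 => /eqP y0E; rewrite -(eqP y0x) y0E expr0n.
  rewrite -(eqP y0x) qr_sqr // (_ : [set _ | _] = [set y0; -y0]); last first.
    by apply/setP => y; rewrite !inE -subr_eq0 subr_sqr mulf_eq0 subr_eq0 addr_eq0.
  rewrite cards2 (_ : (y0 == - y0) = false) //.
  by rewrite -subr_eq0 opprK -mulr2n -mulr_natl mulf_eq0 (negbTE two_neq0) (negbTE y00).
move=> nx; have -> : [set y : k | y ^+ 2 == x] = finset.set0.
  by apply/setP => y; rewrite !inE nx.
rewrite cards0 /qr (negbTE x0); case: eqP => // xh.
pose S := [set z : k | (z != 0) && [exists y, y ^+ 2 == z]].
have cS : (#|k|.-1 <= 2 * #|S|)%N.
  have -> : #|k|.-1 = #|[set~ (0 : k)]|.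
    by rewrite cardsC1.
  rewrite -sum1_card (partition_big (fun y : k => y ^+ 2) (mem S)) /=; last first.
    move=> y; rewrite !inE => y0; rewrite expf_eq0 y0 /=.
    by apply/existsP; exists y.
  apply: leq_trans (_ : \sum_(z in S) 2 <= _)%N; last by rewrite sum_nat_const mulnC.
  apply: leq_sum => z _; rewrite sum1_card; apply: leq_trans (card_sqrt_le z).
  by apply: subset_leq_card; apply/fintype.subsetP => y; rewrite !inE => /andP[].
have p0 : 'X^((#|k|.-1)./2) - 1 != 0 :> {poly k}.
  by rewrite -size_poly_eq0 size_XnsubC ?half_gt0.
have := max_poly_roots p0 (_ : all _ (x :: enum S)) _.
rewrite /= enum_uniq mem_enum inE x0 /= -cardE size_XnsubC ?half_gt0 //= => H.
have xS : ~~ [exists y, y ^+ 2 == x].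
  by apply/negP => /existsP[y]; rewrite nx.
have : ((#|S|.+1 < (#|k|.-1)./2.+1)%N).
  apply: H; last by rewrite xS.
  apply/andP; split; first by rewrite rootE !hornerE xh subrr.
  apply/allP => z; rewrite mem_enum inE => /andP[z0 /existsP[y /eqP yz]].
  have y0 : y != 0 by apply: contra z0 => /eqP yE; rewrite -yz yE expr0n.
  by rewrite rootE !hornerE -yz -exprM mul2n -addnn half_double expf_card1 // subrr.
rewrite ltnS => lt; have : (#|k|.-1 < #|k|.-1)%N.
  by apply: leq_ltn_trans cS _; rewrite -[X in (_ < X)%N]half_double addnn mul2n ltn_double.
by rewrite ltnn.
Qed.

Lemma sum_qr : \sum_x qr x = 0.
Proof.
have : \sum_x (1 + qr x) = \sum_(x : k) 1.
  under eq_bigr => x _ do rewrite -card_sqrt -sum1_card natr_sum big_mkcond /=.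
  rewrite exchange_big /=; apply: eq_bigr => y _.
  under eq_bigr do rewrite inE.
  by rewrite -big_mkcond /= (big_pred1 (y ^+ 2)) // => z; rewrite /= eq_sym.
by rewrite big_split /= => /(canRL (addKr _)); rewrite addNr.
Qed.

Lemma sum_qr_shift a : \sum_x qr (a + x) = 0.
Proof. by rewrite -[RHS]sum_qr [RHS](reindex_inj (addrI a)). Qed.

Lemma qr_nonres : exists x, qr x = -1.
Proof.
have [x /eqP|nx] := pickP (fun x => qr x == -1); first by exists x.
have : \sum_x qr x = #|k|.-1%:R.
  rewrite (bigD1 0) //= qr0 add0r (eq_bigr (fun=> 1)).
    by rewrite sumr_const cardC1.
  by move=> x x0; have := qr_pm1 x; rewrite /pm1 qr_eq0 nx (negbTE x0) orbF => /eqP.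
rewrite sum_qr => /eqP; rewrite eq_sym pnatr_eq0.
by have := finNzRing_gt1 k; case: #|k| => [|[]].
Qed.

Lemma pm1_sqr (a : int) : pm1 a -> a != 0 -> a * a = 1.
Proof. by case/or3P=> /eqP->. Qed.

End QuadraticCharacter.

(** * The Legendre symbol *)

Section Residue.

Variable F : finFieldType.
Hypothesis F_odd : odd #|F|.
Local Notation q := #|F|.
Implicit Types (f g p u : {poly F}).

(** Stated over any ring that receives F, because it is applied both in an extension field and in
    the polynomial ring itself. *)
Lemma frobD (S : comNzRingType) (io : {rmorphism F -> S}) e (a b : S) :
  (a + b) ^+ (q ^ e) = a ^+ (q ^ e) + b ^+ (q ^ e).
Proof.
have [r r_pr rF] := finPcharP F; apply: exprDn_pchar.
have geom_conv : q = (r ^ logn r q)%N by rewrite -(card_pprimeChar rF).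
rewrite geom_conv -expnM; apply/andP; split; first by rewrite expn_gt0 prime_gt0.
apply/allP => z; rewrite mem_primes => /and3P[z_pr _].
rewrite Euclid_dvdX // => /andP[zr _].
by move: zr; rewrite dvdn_prime2 // => /eqP->; exact: rmorph_pchar rF.
Qed.

Lemma expq_eq0 e : (q ^ e == 0)%N = false.
Proof. by rewrite expn_eq0 gtn_eqF // ltnW ?finNzRing_gt1. Qed.

Lemma frobC e (c : F) : c ^+ (q ^ e) = c.
Proof. by elim: e => [|e IHe]; rewrite ?expn0 ?expr1 // expnSr exprM IHe expf_card. Qed.

Lemma frob_horner (S : comNzRingType) (io : {rmorphism F -> S}) e f (a : S) :
  (map_poly io f).[a] ^+ (q ^ e) = (map_poly io f).[a ^+ (q ^ e)].
Proof.
elim/poly_ind: f => [|f c IH]; first by rewrite rmorph0 !horner0 expr0n expq_eq0.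
rewrite !rmorphD !rmorphM /= map_polyX map_polyC !hornerE (frobD io) exprMn IH.
by rewrite -rmorphXn /= frobC.
Qed.

Definition deg p := (size p).-1.

(* The Legendre symbol (f/p), again through Euler's criterion. *)
Definition leg f p : int :=
  if p %| f then 0 else if p %| f ^+ ((q ^ deg p).-1)./2 - 1 then 1 else -1.

(** * The residue field of one prime *)

Section OnePrime.
Variable p : {poly F}.
Hypothesis pi : mirr p.
Local Notation d := (deg p).

Lemma mirr_mip : monic_irreducible_poly p.
Proof. by split; [exact: mirrP|exact: mirr_monic]. Qed.

Local Notation k := {poly %/ p with mirr_mip}.

Definition red f : k := in_qpoly p f.

Fact red_monoid_morphism : monoid_morphism red.
Proof. by split=> [|f g]; [exact: in_qpoly1 | exact: in_qpolyM]. Qed.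

Fact red_zmod_morphism : zmod_morphism red.
Proof. by move=> f g; rewrite /red -[- g]scaleN1r in_qpolyD in_qpolyZ; congr (_ + _); exact: scaleN1r. Qed.

HB.instance Definition _ := GRing.isZmodMorphism.Build {poly F} k red red_zmod_morphism.
HB.instance Definition _ := GRing.isMonoidMorphism.Build {poly F} k red red_monoid_morphism.

Lemma red_eq0 f : (red f == 0) = (p %| f).
Proof.
apply/eqP/idP => [/val_eqP /= | hDp].
  by rewrite (mk_monicE mirr_mip) -Pdiv.IdomainMonic.modpE ?mirr_monic.
by apply/val_eqP; rewrite /= (mk_monicE mirr_mip) -Pdiv.IdomainMonic.modpE ?mirr_monic.
Qed.

Lemma card_k : #|k| = (q ^ d)%N.
Proof. exact: card_qfpoly. Qed.

Lemma k_odd : odd #|k|.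
Proof. by rewrite card_k oddX F_odd orbT. Qed.

Lemma deg_gt0 : (0 < d)%N.
Proof. by have := mirr_size pi; rewrite /deg; case: size => [|[]]. Qed.

Lemma red_surj (z : k) : red (val z) = z.
Proof. by apply: val_inj; rewrite /= Pdiv.CommonRing.rmodp_small // (@size_mk_monic _ p z). Qed.

Lemma dvd_frob f : p %| f ^+ (q ^ d) - f.
Proof. by rewrite -red_eq0 rmorphB rmorphXn -card_k expf_card subrr. Qed.

Lemma leg_qr f : leg f p = qr (red f).
Proof. by rewrite /leg /qr card_k -!red_eq0 rmorphB /= rmorphXn rmorph1 subr_eq0. Qed.

Lemma leg_pm1 f : pm1 (leg f p).
Proof. by rewrite leg_qr qr_pm1. Qed.

Lemma legM f g : leg (f * g) p = leg f p * leg g p.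
Proof. by rewrite !leg_qr rmorphM qrM // k_odd. Qed.

Lemma leg1 : leg 1 p = 1.
Proof. by rewrite leg_qr rmorph1 qr1. Qed.

Lemma leg_eq0 f : (leg f p == 0) = (p %| f).
Proof. by rewrite leg_qr qr_eq0 red_eq0. Qed.

Lemma leg_mod f g : p %| f - g -> leg f p = leg g p.
Proof. by rewrite -red_eq0 rmorphB subr_eq0 !leg_qr => /eqP->. Qed.

Lemma leg_nonres : exists u, leg u p = -1.
Proof.
have [z zE] := qr_nonres k_odd; exists (val z).
by rewrite leg_qr red_surj.
Qed.

Lemma leg_euler f : p %| f ^+ ((q ^ d).-1)./2 - (leg f p)%:~R.
Proof.
by rewrite -red_eq0 rmorphB rmorphXn -card_k rmorph_int leg_qr qrE ?k_odd // subrr.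
Qed.

(** If X is fixed by the e-th Frobenius power modulo p, then so is every residue class, and the q^d
    elements of the residue field are all roots of X^(q^e) - X. *)
Lemma frob_period e : p %| 'X^(q ^ e) - 'X -> (0 < e)%N -> (d <= e)%N.
Proof.
move=> pX e0.
have pf f : p %| f ^+ (q ^ e) - f.
  elim/poly_ind: f => [|f c IH].
    by rewrite expr0n expq_eq0 subrr dvdp0.
  rewrite (frobD (@polyC F : {rmorphism F -> {poly F}})) exprMn -polyC_exp frobC.
  rewrite [X in p %| X](_ : _ =
    (f ^+ (q ^ e) - f) * 'X^(q ^ e) + f * ('X^(q ^ e) - 'X)); last by ring.
  by apply: dvdp_add; [exact: dvdp_mulr | exact: dvdp_mull].
have fix_k (z : k) : z ^+ (q ^ e) = z.
  by apply/eqP; rewrite -{2}[z]red_surj -[in X in X ^+ _](red_surj z) -rmorphXn -subr_eq0 -rmorphB red_eq0.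
have qe1 : (1 < q ^ e)%N by rewrite -(exp1n e) ltn_exp2r ?finNzRing_gt1.
have sP : size ('X^(q ^ e) - 'X : {poly k}) = (q ^ e).+1.
  by rewrite size_polyDl ?size_polyXn // size_polyN size_polyX ltnS.
have p0 : 'X^(q ^ e) - 'X != 0 :> {poly k} by rewrite -size_poly_eq0 sP.
have := max_poly_roots p0 (_ : all _ (enum k)) (enum_uniq _).
rewrite sP ltnS -cardE card_k leq_exp2l ?finNzRing_gt1 //; apply.
by apply/allP => z _; rewrite rootE !hornerE fix_k subrr.
Qed.

End OnePrime.

(** * Roots of primes in an extension of degree j *)

Section Extension.
Variables (L : finFieldType) (io : {rmorphism F -> L}) (j : nat).
Hypothesis cL : #|L| = (q ^ j)%N.
Local Notation "f ^io" := (map_poly io f) (at level 2, format "f ^io").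

Lemma L_odd : odd #|L|.
Proof. by rewrite cL oddX F_odd orbT. Qed.

Lemma j_gt0 : (0 < j)%N.
Proof. by have := finNzRing_gt1 L; rewrite cL; case: j. Qed.

Lemma frob_L (x : L) : x ^+ (q ^ j) = x.
Proof. by rewrite -cL expf_card. Qed.

Lemma root_dvd f g (x : L) : f %| g -> root f^io x -> root g^io x.
Proof.
by move=> /dvdpP[h ->]; rewrite rmorphM /= rootM => ->; rewrite orbT.
Qed.

Section Root.
Variables (p : {poly F}) (x : L).
Hypotheses (pi : mirr p) (px : root p^io x).
Local Notation d := (deg p).

Lemma root_dvdE f : root f^io x = (p %| f).
Proof.
apply/idP/idP => [fx|/root_dvd->//].
apply/negPn/negP => pf.
have : coprimep p^io f^io.
  rewrite coprimep_map irreducible_poly_coprime //; exact: mirrP.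
by move=> /coprimep_root/(_ px); rewrite -rootE fx.
Qed.

Lemma root_frob e : root p^io (x ^+ (q ^ e)).
Proof. by rewrite rootE -frob_horner expf_eq0 -rootE px andbT expn_gt0 ltnW ?finNzRing_gt1. Qed.

Lemma root_frob_d : x ^+ (q ^ d) = x.
Proof.
have := root_dvdE ('X^(q ^ d) - 'X); rewrite dvd_frob // rmorphB /= map_polyXn map_polyX.
by rewrite rootE !hornerE subr_eq0 => /eqP.
Qed.

Lemma root_frob_period e : x ^+ (q ^ e) = x -> (0 < e)%N -> (d <= e)%N.
Proof.
move=> xe; apply: frob_period => //; rewrite -root_dvdE.
by rewrite rmorphB /= map_polyXn map_polyX rootE !hornerE xe subrr.
Qed.

Lemma frob_mul a b : x ^+ (q ^ a) = x -> x ^+ (q ^ (b * a)) = x.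
Proof.
by move=> xa; elim: b => [|b IHb]; rewrite ?expr1 // mulSn expnD exprM xa.
Qed.

Lemma deg_dvd : (d %| j)%N.
Proof.
rewrite /dvdn; case: posnP => // r0.
have := ltn_pmod j (deg_gt0 pi); rewrite ltnNge => /negP[].
apply: root_frob_period => //.
rewrite -{1}(frob_mul (j %/ d)%N root_frob_d) -exprM -expnD -divn_eq.
exact: frob_L.
Qed.

Definition frob_conj : seq L := [seq x ^+ (q ^ i) | i <- iota 0 d].

Lemma frob_conj_uniq : uniq frob_conj.
Proof.
rewrite map_inj_in_uniq ?iota_uniq // => a b; rewrite !mem_iota /= !add0n.
suff H s t : (s < t)%N -> (t < d)%N -> x ^+ (q ^ s) = x ^+ (q ^ t) -> False.
  move=> ad bd xab; case: (ltngtP a b) => // ab; first by case: (H a b).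
  by case: (H b a).
move=> st td xst.
have : x ^+ (q ^ (s + (d - t))) = x.
  by rewrite expnD exprM xst -exprM -expnD subnKC ?root_frob_d // ltnW.
move/root_frob_period => H; have /H : (0 < s + (d - t))%N by lia.
by lia.
Qed.

(** The d Frobenius conjugates of x are distinct by [root_frob_period], so they exhaust the roots of
    p. *)
Lemma frob_conj_prod : p^io = \prod_(i < d) ('X - (x ^+ (q ^ i))%:P).
Proof.
have -> : \prod_(i < d) ('X - (x ^+ (q ^ i))%:P) = \prod_(z <- frob_conj) ('X - z%:P).
  by rewrite big_map -[d in RHS]subn0 -/(index_iota 0 d) big_mkord.
rewrite [LHS](all_roots_prod_XsubC (rs := frob_conj)).
- by rewrite lead_coef_map (eqP (mirr_monic pi)) rmorph1 scale1r.
- by rewrite size_map_poly size_map size_iota /deg prednK // ltnW // mirr_size.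
- by apply/allP => _ /mapP[i _ ->]; exact: root_frob.
- by rewrite uniq_rootsE frob_conj_uniq.
Qed.

Lemma horner_frob_conj (y : L) : (p^io).[y] = \prod_(i < d) (y - x ^+ (q ^ i)).
Proof. by rewrite frob_conj_prod horner_prod; apply: eq_bigr => i _; rewrite !hornerE. Qed.

Lemma leg_root f : (f^io).[x] ^+ ((q ^ d).-1)./2 = (leg f p)%:~R.
Proof.
have := root_dvdE (f ^+ ((q ^ d).-1)./2 - (leg f p)%:~R).
rewrite leg_euler // rmorphB /= rmorphXn /= rmorph_int.
have hc : (leg f p)%:~R = ((leg f p)%:~R)%:P :> {poly L} by rewrite rmorph_int.
by rewrite rootE !hornerE hc hornerC subr_eq0 => /eqP.
Qed.

(** The geometric sum is the exponent of the norm from a field of Q^n elements to one of Q elements.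
    Euler's criterion in the large field is thus that of the small field applied to the norm. *)
Lemma half_geom Q n : odd Q ->
  (((Q ^ n).-1)./2 = (Q.-1)./2 * \sum_(i < n) Q ^ i)%N.
Proof.
move=> oQ; have Q0 : (0 < Q)%N by case: Q oQ.
rewrite predn_exp; have /even_halfK <- : ~~ odd Q.-1 by case: Q oQ Q0 => //= n' /negbTE ->.
by rewrite -doubleMl !doubleK.
Qed.

(** By [half_geom] the Euler exponent of L is that of the subfield generated by x times a sum of j/d
    odd numbers. A symbol depends only on the parity of a positive exponent, and this sum has the
    parity of j/d. *)
Lemma qr_root f : qr (f^io).[x] = leg f p ^+ (j %/ d).
Proof.
have pm_exp (a : int) n : pm1 a -> pm1 (a ^+ n).
  by move=> pa; elim: n => // n IHn; rewrite exprS pm1M.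
apply: (pm1_inj L_odd); rewrite ?qr_pm1 ?pm_exp ?leg_pm1 //.
have qd_odd : odd (q ^ d) by rewrite oddX F_odd orbT.
rewrite qrE ?L_odd // cL -{1}(divnK deg_dvd) mulnC expnM half_geom // exprM leg_root.
have : odd (\sum_(i < j %/ d) (q ^ d) ^ i) = odd (j %/ d).
  elim: (j %/ d)%N => [|n IHn]; first by rewrite big_ord0.
  by rewrite big_ord_recr oddD IHn oddX qd_odd orbT /= addbT.
have jd0 : (0 < j %/ d)%N by rewrite divn_gt0 ?deg_gt0 // dvdn_leq ?j_gt0 ?deg_dvd.
have : (0 < \sum_(i < j %/ d) (q ^ d) ^ i)%N.
  by case: (j %/ d)%N jd0 => // n _; rewrite big_ord_recl expn0.
set a := (\sum_(i < _) _)%N; set b := (j %/ d)%N in jd0 *; move=> a0 ab.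
case/or3P: (leg_pm1 pi f) => /eqP->.
- by rewrite !expr0n !gtn_eqF.
- by rewrite !expr1n.
by rewrite rmorphN1 -signr_odd ab signr_odd rmorphXn /= rmorphN1.
Qed.

End Root.

Lemma exists_min_root f (x : L) : f \is monic -> root f^io x ->
  exists2 p, mirr p & root p^io x.
Proof.
move=> fm; move: f fm; apply: monic_ind => [|p f pi fm IH].
  by rewrite rmorph1 rootE hornerE oner_eq0.
by rewrite rmorphM rootM => /orP[px|/IH//]; exists p.
Qed.

Lemma exists_min (x : L) : exists2 p, mirr p & root p^io x.
Proof.
have qj1 : (1 < q ^ j)%N by rewrite -cL finNzRing_gt1.
have sX : (size (- 'X : {poly F}) < size ('X^(q ^ j) : {poly F}))%N.
  by rewrite size_polyXn size_polyN size_polyX ltnS.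
apply: (@exists_min_root ('X^(q ^ j) - 'X)).
  by rewrite monicE lead_coefDl // lead_coefXn.
by rewrite rmorphB /= map_polyXn map_polyX rootE !hornerE frob_L subrr.
Qed.

Lemma prod_all_L : 'X^(q ^ j) - 'X = \prod_(x : L) ('X - x%:P).
Proof.
have qj1 : (1 < q ^ j)%N by rewrite -cL finNzRing_gt1.
have sX : (size (- 'X : {poly L}) < size ('X^(q ^ j) : {poly L}))%N.
  by rewrite size_polyXn size_polyN size_polyX ltnS.
rewrite -big_enum [LHS](all_roots_prod_XsubC (rs := enum L)).
- by rewrite lead_coefDl // lead_coefXn scale1r.
- by rewrite size_polyDl // size_polyXn -cardE cL.
- by apply/allP => z _; rewrite rootE !hornerE frob_L subrr.
- by rewrite uniq_rootsE enum_uniq.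
Qed.

Lemma has_root p : mirr p -> (deg p %| j)%N -> exists x, root p^io x.
Proof.
move=> pi /dvdnP[n jE].
have pX : p %| 'X^(q ^ j) - 'X.
  rewrite -(red_eq0 pi) rmorphB rmorphXn.
  suff -> : red pi 'X ^+ (q ^ j) = red pi 'X by rewrite subrr.
  rewrite jE; elim: n {jE} => [|n IHn]; first by rewrite expr1.
  by rewrite mulSn expnD exprM -card_k expf_card.
have [x /idP px|nx] := pickP (fun x => root p^io x); first by exists x.
have /coprimepP : coprimep p^io (\prod_(x : L) ('X - x%:P)).
  apply: (big_ind (fun r => coprimep p^io r)) => [|r r'|x _].
  - exact: coprimep1.
  - by rewrite coprimepMr => -> ->.
  - by rewrite coprimep_XsubC nx.
move=> /(_ p^io (dvdpp _)).
rewrite -prod_all_L -(map_polyXn io) -[X in _ - X](map_polyX io) -rmorphB dvdp_map pX.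
move=> /(_ isT); rewrite -size_poly_eq1 size_map_poly.
by have := mirr_size pi; case: size => [|[]].
Qed.

Lemma card_roots p : mirr p -> #|[set x : L | root p^io x]| = (if (deg p %| j)%N then deg p else 0)%N.
Proof.
move=> pi; case: ifP => [/(has_root pi)[x px]|nd]; last first.
  apply/eqP; rewrite cards_eq0; apply/eqP/setP => x; rewrite !inE.
  by apply: contraFF nd => /(deg_dvd pi).
transitivity (size (frob_conj p x)); last by rewrite size_map size_iota.
rewrite -(card_uniqP (frob_conj_uniq pi px)); apply: eq_card => y; rewrite inE.
rewrite rootE (horner_frob_conj pi px); apply/prodf_eq0/mapP => [[i _]|[i ii ->]].
  by rewrite subr_eq0 => /eqP->; exists (val i); rewrite // mem_iota /= ltn_ord.
rewrite mem_iota /= in ii; exists (Ordinal ii) => //=.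
by rewrite subrr.
Qed.

(** Each x in L is a root of exactly one prime p, whose degree divides j. Each such p has deg p
    roots, and the character takes the same value on all of them by [qr_root]. *)
Lemma sum_qr_irr f : \sum_(x : L) qr (f^io).[x] =
  \sum_(p <- irr F j | (deg p %| j)%N) (deg p)%:R * leg f p ^+ (j %/ deg p).
Proof.
transitivity (\sum_(x : L) \sum_(p <- irr F j | root p^io x) qr (f^io).[x]).
  apply: eq_bigr => x _; have [p pi px] := exists_min x.
  rewrite -big_filter (_ : seq.filter _ _ = [:: p]) ?big_seq1 //.
  apply: perm_small_eq => //; apply: uniq_perm => //.
    by rewrite filter_uniq // irr_uniq.
  move=> p'; rewrite mem_filter mem_irr inE.
  apply/and3P/eqP => [[p'x pi' _]|->].
    by apply/esym/mirr_dvd_eq => //; rewrite -(root_dvdE pi px).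
  split=> //; have := dvdn_leq j_gt0 (deg_dvd pi px).
  by rewrite /deg; case: size.
under eq_bigr do rewrite big_mkcond.
rewrite exchange_big /= [RHS]big_mkcond [LHS]big_seq [RHS]big_seq.
apply: eq_bigr => p; rewrite mem_irr => /andP[pi _]; rewrite -big_mkcond /=.
transitivity (\sum_(x in [set x : L | root p^io x]) leg f p ^+ (j %/ deg p)).
  by apply: eq_big => x; rewrite ?inE // => px; exact: qr_root.
rewrite sumr_const card_roots //; case: ifP => _; last by rewrite mulr0n.
by rewrite mulr_natl.
Qed.

End Extension.

(** L contains a root x of p and a root y of p'. Each symbol is the power (q - 1)/2 of a norm, which
    is the double product of the differences of conjugates of x and y. The two products differ by
    signs only. *)
Lemma leg_recip (L : finFieldType) (io : {rmorphism F -> L}) p p' :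
  #|F| = 1 %[mod 4] ->
  mirr p -> mirr p' -> #|L| = (q ^ (deg p * deg p'))%N -> leg p' p = leg p p'.
Proof.
move=> q4 pi pi' cL.
have [x px] := has_root io cL pi (dvdn_mulr _ (dvdnn _)).
have [y py] := has_root io cL pi' (dvdn_mull _ (dvdnn _)).
apply: (pm1_inj (L_odd cL)); rewrite ?leg_pm1 //.
rewrite -(leg_root pi px) -(leg_root pi' py) !half_geom // mulnC exprM [in RHS]mulnC exprM.
have norm f n (z : L) : (map_poly io f).[z] ^+ (\sum_(i < n) q ^ i) =
    \prod_(i < n) (map_poly io f).[z ^+ (q ^ i)].
  by rewrite -prodrXr; apply: eq_bigr => i _; exact: frob_horner.
rewrite !norm.
under eq_bigr do rewrite (horner_frob_conj cL pi' py).
under [in RHS]eq_bigr do rewrite (horner_frob_conj cL pi px).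
rewrite [in RHS]exchange_big /=.
(* Here q = 1 mod 4 enters: the exponent (q - 1)/2 is even, so the signs disappear. *)
have : ~~ odd (q.-1)./2.
  have := divn_eq q 4; rewrite q4 modn_small // => ->.
  by rewrite addn1 /= -[4%N]/(2 * 2)%N mulnA muln2 doubleK muln2 odd_double.
move=> /even_halfK <-; rewrite -mul2n ![_ ^+ (2 * _)]exprM; congr (_ ^+ _); rewrite -!prodrXl.
by apply: eq_bigr => i _; rewrite -!prodrXl; apply: eq_bigr => l _; rewrite -sqrrN opprB.
Qed.

End Residue.

(** * The Jacobi symbol *)

Section Jacobi.

Variable F : finFieldType.
Hypothesis F_odd : odd #|F|.
Local Notation q := #|F|.
Implicit Types (f g p u A B D : {poly F}).

(* The Jacobi symbol (B/f). *)
Definition chi B f : int := \prod_(p <- irr F (deg f)) leg B p ^+ vP p f.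

Lemma deg1 : deg (1 : {poly F}) = 0%N.
Proof. by rewrite /deg size_poly1. Qed.

Lemma degM f g : f \is monic -> g \is monic -> deg (f * g) = (deg f + deg g)%N.
Proof. exact: size_monM. Qed.

Lemma degX f n : f \is monic -> deg (f ^+ n) = (n * deg f)%N.
Proof.
move=> fm; elim: n => [|n IHn]; first by rewrite expr0 deg1.
by rewrite exprS degM ?monic_exp // IHn mulSn.
Qed.

Lemma size_deg f : f \is monic -> size f = (deg f).+1.
Proof. by move/monic_neq0/polySpred. Qed.

Lemma deg_mon n f : f \in mon F n -> deg f = n.
Proof. by move/mon_size; rewrite /deg => ->. Qed.

Lemma vP_deg0 p f : mirr p -> f \is monic -> (deg f < deg p)%N -> vP p f = 0%N.
Proof.
move=> pi fm fp; apply: (vP0 pi (monic_neq0 fm)).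
apply/negP => pf; have := dvdp_leq (monic_neq0 fm) pf.
by rewrite !size_deg ?(mirr_monic pi) // ltnS leqNgt fp.
Qed.

Lemma irr_widen (R : Type) (idx : R) (op : Monoid.com_law idx) (m n : nat) (G : {poly F} -> R) :
  (m <= n)%N -> (forall p, mirr p -> (m < deg p)%N -> G p = idx) ->
  \big[op/idx]_(p <- irr F n) G p = \big[op/idx]_(p <- irr F m) G p.
Proof.
move=> mn G1; rewrite (bigID (fun p => size p <= m.+1)%N) /= [X in op _ X]big1_seq ?Monoid.mulm1.
  rewrite -big_filter; apply: perm_big; apply: uniq_perm; first exact/filter_uniq/irr_uniq; first exact: irr_uniq.
  move=> p; rewrite mem_filter !mem_irr andbCA; congr (_ && _).
  by apply: andb_idr => /leq_trans; apply; rewrite ltnS.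
move=> p; rewrite mem_irr -ltnNge => /andP[pm /andP[pi _]]; apply: G1 => //.
by move: pm; rewrite size_deg ?mirr_monic.
Qed.

Lemma chiE n B f : f \is monic -> (deg f <= n)%N ->
  chi B f = \prod_(p <- irr F n) leg B p ^+ vP p f.
Proof.
move=> fm fn; rewrite /chi [RHS](irr_widen _ fn) // => p pi fp.
by rewrite (vP_deg0 pi fm fp) expr0.
Qed.

Lemma chiMl A B f : chi (A * B) f = chi A f * chi B f.
Proof.
rewrite /chi -big_split /= [LHS]big_seq [RHS]big_seq; apply: eq_bigr => p.
by rewrite mem_irr => /andP[pi _]; rewrite (legM F_odd pi) exprMn.
Qed.

Lemma chiMr B f g : f \is monic -> g \is monic -> chi B (f * g) = chi B f * chi B g.
Proof.
move=> fm gm; rewrite {1}/chi (chiE _ fm (leq_addr (deg g) _)).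
rewrite (chiE _ gm (leq_addl (deg f) _)) degM // -big_split /= [LHS]big_seq [RHS]big_seq.
apply: eq_bigr => p; rewrite mem_irr => /andP[pi _].
by rewrite (vPM pi) ?monic_neq0 // exprD.
Qed.

Lemma chi1r B : chi B 1 = 1.
Proof.
rewrite /chi big1_seq // => p; rewrite mem_irr => /andP[_ /andP[pi sp]].
by move: (mirr_size pi) sp; rewrite deg1 ltnNge => /negbTE->.
Qed.

Lemma chi_leg B p : mirr p -> chi B p = leg B p.
Proof.
move=> pi; rewrite /chi (bigD1_seq p) ?irr_uniq //=; last by rewrite mem_irr pi /deg leqSpred.
rewrite (vP_irr pi pi) eqxx expr1 big_seq_cond big1 ?mulr1 // => p'.
rewrite mem_irr => /andP[/andP[pi' _] pp']; rewrite (vP_irr pi' pi).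
by rewrite (negbTE pp') expr0.
Qed.

Lemma chiXr B f n : f \is monic -> chi B (f ^+ n) = chi B f ^+ n.
Proof.
move=> fm; elim: n => [|n IHn]; first by rewrite chi1r.
by rewrite !exprS chiMr ?monic_exp // IHn.
Qed.

Lemma chi1l f : chi 1 f = 1.
Proof.
rewrite /chi big1_seq // => p; rewrite mem_irr => /andP[_ /andP[pi _]].
by rewrite leg1 // expr1n.
Qed.

Lemma chi_mod A B f : f \is monic -> f %| A - B -> chi A f = chi B f.
Proof.
move=> fm fAB; rewrite /chi [LHS]big_seq [RHS]big_seq; apply: eq_bigr => p.
rewrite mem_irr => /andP[pi _]; have [pf|pf] := boolP (p %| f).
  by rewrite (@leg_mod _ p pi A B) //; exact: dvdp_trans fAB.
by rewrite (vP0 pi (monic_neq0 fm) pf) !expr0.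
Qed.

Lemma chi_modp A f : f \is monic -> chi (A %% f) f = chi A f.
Proof.
move=> fm; apply: chi_mod => //; rewrite {2}(divp_eq A f) opprD addrCA subrr addr0.
by rewrite dvdpNr dvdp_mull.
Qed.

Lemma chi_pm1 B f : pm1 (chi B f).
Proof.
rewrite /chi big_seq; apply: (big_ind pm1) => // [a b|p]; first exact: pm1M.
rewrite mem_irr => /andP[pi _]; elim: (vP p f) => // n IHn.
by rewrite exprS pm1M // leg_pm1.
Qed.

Lemma chi_eq0 B f : f \is monic -> (chi B f == 0) = ~~ coprimep f B.
Proof.
move=> fm; rewrite /chi; apply/idP/idP => [|fB].
  rewrite prodf_seq_eq0 => /hasP[p]; rewrite mem_irr /= expf_eq0 => /andP[pi _].
  rewrite (leg_eq0 pi) => /andP[v0 pB]; apply/negP => /(coprimep_mirr _ (monic_neq0 fm))/(_ _ pi).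
  rewrite pB => H; have /H : p %| f by rewrite -[p]expr1 dvd_vP ?monic_neq0.
  by [].
have [p /and3P[pi pf pB]] : exists p, [&& mirr p, p %| f & p %| B].
  have : (1 < size (gcdp f B))%N.
    rewrite ltn_neqAle eq_sym fB lt0n size_poly_eq0 gcdp_eq0 negb_and.
    by rewrite monic_neq0.
  by move=> /mirr_dvd_exists[p pi]; rewrite dvdp_gcd => pfB; exists p; rewrite pi.
rewrite prodf_seq_eq0; apply/hasP; exists p.
  by rewrite mem_irr pi -size_deg //= dvdp_leq ?monic_neq0.
by rewrite expf_eq0 leg_eq0 // pB andbT -dvd_vP ?monic_neq0 // expr1.
Qed.

Lemma chi_sqr B f : f \is monic -> chi B (f ^+ 2) = (coprimep f B)%:R.
Proof.
move=> fm; rewrite chiXr // expr2; have := chi_eq0 B fm.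
case: coprimep => [/negbT c0|/eqP->]; last by rewrite mulr0.
by rewrite pm1_sqr // chi_pm1.
Qed.

Lemma crt f g u v : coprimep f g -> exists w, (f %| w - u) && (g %| w - v).
Proof.
move=> /Bezout_eq1_coprimepP[[a b] /= ab]; exists (v * (a * f) + u * (b * g)).
apply/andP; split.
  rewrite [X in _ %| X](_ : _ = (v - u) * a * f + u * (a * f + b * g - 1)); last by ring.
  by rewrite ab subrr mulr0 addr0 dvdp_mull.
rewrite [X in _ %| X](_ : _ = (u - v) * b * g + v * (a * f + b * g - 1)); last by ring.
by rewrite ab subrr mulr0 addr0 dvdp_mull.
Qed.

(** By the Chinese remainder theorem u can be a nonresidue at p and 1 modulo g. The odd exponent of
    p preserves the sign -1. *)
Lemma chi_nonres_at p g v : mirr p -> g \is monic -> ~~ (p %| g) -> odd v ->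
  exists u, chi u (p ^+ v * g) = -1 /\ g %| u - 1.
Proof.
move=> pi gm pg ov; have [x xE] := leg_nonres F_odd pi.
have /(crt x 1)[u /andP[up ug]] : coprimep p g.
  by rewrite irreducible_poly_coprime //; exact: mirrP.
have pm := mirr_monic pi.
exists u; split=> //; rewrite chiMr ?monic_exp // chiXr //.
rewrite (chi_mod gm ug) chi1l chi_leg // (leg_mod pi up) xE mulr1.
by rewrite -signr_odd ov.
Qed.

Definition issq f := has (fun l => l ^+ 2 == f) (mon F (deg f)./2).

Lemma issqP f : f \is monic -> reflect (exists2 l, l \is monic & f = l ^+ 2) (issq f).
Proof.
move=> fm; apply: (iffP hasP) => [[l lm /eqP<-]|[l lm ->]].
  by exists l => //; exact: mon_monic lm.
exists l => //; rewrite mem_mon lm degX // mul2n doubleK size_deg //=.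
Qed.

Lemma chi_nonsq f : f \is monic -> ~~ issq f -> exists u, chi u f = -1.
Proof.
move=> fm nsq.
have [/hasP[p]|/hasPn H] := boolP (has (fun p => odd (vP p f)) (irr F (deg f))).
  rewrite mem_irr => /andP[pi _] ov.
  have [v [g [fE pg]]] := mirr_decomp pi (monic_neq0 fm).
  have gm : g \is monic by move: fm; rewrite fE monicMl // monic_exp // mirr_monic.
  have [|u [uE _]] := @chi_nonres_at p g v pi gm pg.
    by move: ov; rewrite fE (vP_eq v pi (monic_neq0 gm) pg).
  by exists u; rewrite fE.
case/negP: nsq; apply/issqP => //.
exists (\prod_(p <- irr F (deg f)) p ^+ (vP p f)./2).
  rewrite big_seq monic_prod // => p; rewrite mem_irr => /andP[pi _].
  by rewrite monic_exp // mirr_monic.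
rewrite [LHS](@prod_irr_vP _ f (deg f)) ?size_deg // expr2 -big_split /=.
rewrite [LHS]big_seq [RHS]big_seq; apply: eq_bigr => p pin.
by rewrite -exprD addnn even_halfK // H.
Qed.

Lemma sum_mon_div (V : nmodType) f n (G : {poly F} -> V) : f \is monic -> (deg f <= n)%N ->
  \sum_(B <- mon F n) G B =
  \sum_(Q <- mon F (n - deg f)) \sum_(v : {poly_(deg f) F}) G (Q * f + val v).
Proof.
move=> fm fn.
have f0 := monic_neq0 fm; have sf := size_deg fm.
have sv (v : {poly_(deg f) F}) : (size (val v) < size f)%N by rewrite sf ltnS size_npoly.
transitivity (\sum_(Q <- mon F (n - deg f)) \sum_(v <- enum {poly_(deg f) F}) G (Q * f + val v)).
  rewrite -(big_allpairs_dep (h := fun (Q : {poly F}) (v : {poly_(deg f) F}) => Q * f + val v) (r2 := fun=> enum {poly_(deg f) F})).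
  apply: perm_big; apply: uniq_perm; first exact: mon_uniq.
    apply: allpairs_uniq; rewrite ?mon_uniq ?enum_uniq //.
    move=> [Q v] [Q' v'] _ _ /= E.
    have /val_inj vv : val v = val v'.
      by have := modp_addl_mul_small Q (sv v); rewrite E modp_addl_mul_small; [move=> <- | exact: sv].
    have QQ : Q = Q' by have := divp_addl_mul_small Q (sv v); rewrite E divp_addl_mul_small; [move=> <- | exact: sv].
    by rewrite vv QQ.
  move=> B; apply/idP/allpairsPdep => [Bm|[Q [v [Qm _ ->]]]].
    have sBf : (size (B %% f)%R <= deg f)%N by rewrite -ltnS -sf ltn_modp.
    exists (B %/ f), (NPoly (sBf : B %% f \is a poly_of_size _)).
    rewrite mem_enum /=; split => //; last exact: divp_eq.
    have Q0 : B %/ f != 0 by rewrite divp_eq0 !negb_or f0 monic_neq0 ?(mon_monic Bm) // -leqNgt sf (mon_size Bm) ltnS.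
    have sQ : (size (B %% f)%R < size (B %/ f * f)%R)%N.
      by rewrite size_Mmonic // (polySpred Q0) addSn /=; apply: leq_trans (leq_addl _ _); rewrite ltn_modp.
    have BE := divp_eq B f; rewrite mem_mon.
    have := mon_monic Bm; rewrite {1}BE monicE lead_coefDl // lead_coef_Mmonic // -monicE => -> /=.
    have := mon_size Bm; rewrite {1}BE size_polyDl // size_Mmonic //.
    by rewrite (polySpred Q0) sf addSn /= addnS => -[<-]; rewrite addnK.
  rewrite mem_mon; have Qfm := monM Qm (monic_in_mon fm).
  have sQ : (size (val v) < size (Q * f)%R)%N.
    rewrite (mon_size Qfm) ltnS; apply: leq_trans (size_npoly v) _.
    by rewrite -/(deg f) leq_addl.
  rewrite monicE lead_coefDl // -monicE (mon_monic Qfm) size_polyDl // (mon_size Qfm).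
  by rewrite -/(deg f) subnK //=.
by apply: eq_bigr => Q _; rewrite big_enum.
Qed.

Lemma sum_mon_mod (V : zmodType) f n (G : {poly F} -> V) : f \is monic -> (deg f <= n)%N ->
  (forall B, G (B %% f) = G B) ->
  \sum_(B <- mon F n) G B = (\sum_(v : {poly_(deg f) F}) G (val v)) *+ (q ^ (n - deg f)).
Proof.
move=> fm fn Gm; rewrite (sum_mon_div G fm fn).
under eq_bigr => Q _ do under eq_bigr => v _ do
  rewrite -Gm modp_addl_mul_small ?(size_deg fm) ?ltnS ?size_npoly //.
by rewrite big_const_seq count_predT size_mon iter_addr_0.
Qed.

Lemma sum_npoly_mulr (V : nmodType) f u (G : {poly F} -> V) : f \is monic -> coprimep f u ->
  \sum_(v : {poly_(deg f) F}) G ((u * val v) %% f) = \sum_(v : {poly_(deg f) F}) G (val v).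
Proof.
move=> fm fu; have f0 := monic_neq0 fm; have sf := size_deg fm.
have szm (h : {poly F}) : (size (h %% f)%R <= deg f)%N by rewrite -ltnS -sf ltn_modp.
pose r (v : {poly_(deg f) F}) : {poly_(deg f) F} :=
  NPoly (szm (u * val v) : (u * val v) %% f \is a poly_of_size _).
have r_inj : injective r.
  move=> v w /(congr1 val) /= E; apply: val_inj; apply/eqP; rewrite -subr_eq0 /=.
  have : f %| u * (val v - val w) by rewrite mulrBr; apply/eqP; rewrite modpD modpN /= E subrr.
  rewrite Gauss_dvdpr // => /dvdp_leq; case: eqVneq => // d0 /(_ isT).
  rewrite sf leqNgt ltnS => /negP[]; apply: leq_trans (size_polyD _ _) _.
  by rewrite size_polyN geq_max !size_npoly.
by rewrite [RHS](reindex_inj r_inj).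
Qed.

(** Multiplication by u with (u/f) = -1 permutes the residues modulo f and negates the sum. *)
Lemma sum_chi_npoly f : f \is monic -> ~~ issq f ->
  \sum_(v : {poly_(deg f) F}) chi (val v) f = 0.
Proof.
move=> fm /(chi_nonsq fm)[u uE].
have : \sum_(v : {poly_(deg f) F}) chi ((u * val v) %% f) f = \sum_(v : {poly_(deg f) F}) chi (val v) f.
  apply: (sum_npoly_mulr (fun h => chi h f)) => //.
  by apply/negPn; rewrite -chi_eq0 // uE.
under eq_bigr do rewrite chi_modp // chiMl uE mulN1r.
rewrite sumrN; set s := \sum_(v : _) _; lia.
Qed.

Lemma sum_chi_nonsq n f : f \is monic -> ~~ issq f -> (deg f <= n)%N ->
  \sum_(B <- mon F n) chi B f = 0.
Proof.
move=> fm nsq fn; rewrite (sum_mon_mod fm fn) ?sum_chi_npoly ?mul0rn //.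
by move=> B; rewrite chi_modp.
Qed.

(* A_n(D) in the notation of the header. *)
Definition Lcoef D n : int := \sum_(f <- mon F n) chi D f.

Lemma deg_vP f n : f \is monic -> (deg f <= n)%N ->
  deg f = (\sum_(p <- irr F n) vP p f * deg p)%N.
Proof.
move=> fm fn; rewrite {1}(@prod_irr_vP _ f n) ?size_deg //.
have : {subset irr F n <= [pred p : {poly F} | p \is monic]}.
  by move=> p; rewrite mem_irr => /andP[/mirr_monic].
elim: (irr F n) => [|p s IHs] ps; first by rewrite !big_nil deg1.
have pm : p \is monic by apply: ps; rewrite mem_head.
rewrite !big_cons degM ?monic_exp //; last first.
  rewrite big_seq monic_prod // => p' p's; rewrite monic_exp //.
  by apply: ps; rewrite inE p's orbT.
rewrite degX // IHs // => p' p's; by apply: ps; rewrite inE p's orbT.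
Qed.

Lemma sum_multiples (V : nmodType) d n (G : nat -> V) : (0 < d)%N ->
  \sum_(1 <= j < n.+1 | (d %| j)%N) G (j %/ d)%N = \sum_(1 <= k < n.+1 | (k * d <= n)%N) G k.
Proof.
move=> d0; rewrite -big_filter -[RHS]big_filter.
rewrite (perm_big [seq (k * d)%N | k <- [seq k <- index_iota 1 n.+1 | (k * d <= n)%N]]).
  by rewrite big_map; apply: eq_bigr => k _; rewrite mulnK.
apply: uniq_perm; rewrite ?filter_uniq ?iota_uniq //.
  by rewrite map_inj_uniq ?filter_uniq ?iota_uniq // => a b /eqP; rewrite eqn_pmul2r // => /eqP.
move=> j; rewrite mem_filter mem_index_iota; apply/and3P/mapP => [[/dvdnP[k ->] j1 jn]|[k]].
  exists k => //; rewrite mem_filter mem_index_iota; rewrite ltnS in jn; rewrite jn /=.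
  move: j1; rewrite muln_gt0 => /andP[-> _] /=.
  by rewrite ltnS; apply: leq_trans jn; rewrite leq_pmulr.
rewrite mem_filter mem_index_iota => /and3P[kn k1 _] ->.
by rewrite dvdn_mull // muln_gt0 k1 d0 ltnS.
Qed.

(* These are the power sums of the inverse roots of P_(C_D), up to sign. *)
Definition psum D j : int :=
  \sum_(p <- irr F j | (deg p %| j)%N) (deg p)%:R * leg D p ^+ (j %/ deg p).

(* Newton's identities, obtained from deg f = \sum_(p ^+ k %| f) deg p. *)
Lemma Lcoef_newton D n :
  n%:R * Lcoef D n = \sum_(1 <= j < n.+1) psum D j * Lcoef D (n - j).
Proof.
transitivity (\sum_(p <- irr F n) \sum_(1 <= k < n.+1 | (k * deg p <= n)%N)
    (deg p)%:R * (leg D p ^+ k * Lcoef D (n - k * deg p))).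
  rewrite /Lcoef mulr_sumr.
  transitivity (\sum_(f <- mon F n) \sum_(p <- irr F n) \sum_(1 <= k < n.+1)
      if p ^+ k %| f then (deg p)%:R * chi D f else 0).
    rewrite [LHS]big_seq [RHS]big_seq; apply: eq_bigr => f fm.
    rewrite -{1}(deg_mon fm) (@deg_vP f n) ?(mon_monic fm) ?(deg_mon fm) //.
    rewrite natr_sum mulr_suml; apply: eq_bigr => p _.
    rewrite /vP (mon_size fm) natrM natr_sum !mulr_suml; apply: eq_bigr => k _.
    by case: ifP => _; rewrite ?mul1r // !mul0r.
  rewrite exchange_big /= [LHS]big_seq [RHS]big_seq; apply: eq_bigr => p.
  rewrite mem_irr => /andP[pi _].
  rewrite exchange_big /= [RHS]big_mkcond /=; apply: eq_bigr => k _.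
  rewrite -big_mkcond /= sum_mon_dvd ?monic_exp ?mirr_monic //.
  rewrite -/(deg _) degX ?mirr_monic //; case: ifP => // _.
  rewrite !mulr_sumr [LHS]big_seq [RHS]big_seq; apply: eq_bigr => e em.
  have pm := mirr_monic pi.
  by rewrite chiMr ?monic_exp ?(mon_monic em) // chiXr // chi_leg.
transitivity (\sum_(p <- irr F n) \sum_(1 <= j < n.+1 | (deg p %| j)%N)
    (deg p)%:R * (leg D p ^+ (j %/ deg p) * Lcoef D (n - j))).
  rewrite [LHS]big_seq [RHS]big_seq; apply: eq_bigr => p.
  rewrite mem_irr => /andP[pi _].
  rewrite -(sum_multiples n (fun k => (deg p)%:R * (leg D p ^+ k * Lcoef D (n - k * deg p)))) ?deg_gt0 //.
  by apply: eq_bigr => j dj; rewrite divnK.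
under eq_bigr do rewrite big_mkcond.
rewrite exchange_big /= big_nat_cond [RHS]big_nat_cond; apply: eq_bigr => j.
rewrite andbT ltnS => /andP[j1 jn]; rewrite /psum mulr_suml [RHS]big_mkcond /=.
rewrite (@irr_widen _ _ _ j n) //.
  by apply: eq_bigr => p _; case: ifP => // _; rewrite mulrA.
by move=> p pi jp; case: ifP => // /(dvdn_leq j1); rewrite leqNgt jp.
Qed.

Lemma Lcoef0 D : Lcoef D 0 = 1.
Proof. by rewrite /Lcoef mon0 big_seq1 chi1r. Qed.

(** * Reciprocity for the Jacobi symbol *)

Section Reciprocity.
Hypothesis q4 : #|F| = 1 %[mod 4].
Hypothesis exL : forall n, exists (L : finFieldType) (io : {rmorphism F -> L}), #|L| = (q ^ n.+1)%N.

Lemma leg_reciprocity p p' : mirr p -> mirr p' -> leg p' p = leg p p'.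
Proof.
move=> pi pi'; have d0 : (0 < deg p * deg p')%N by rewrite muln_gt0 !deg_gt0.
have [L [io cL]] := exL (deg p * deg p').-1; rewrite prednK // in cL.
exact: leg_recip io _ _ _ _ _ cL.
Qed.

Lemma chi_recip f g : f \is monic -> g \is monic -> chi f g = chi g f.
Proof.
move=> fm; move: f fm g; apply: monic_ind => [g gm|p f pi fm IH]; first by rewrite chi1l chi1r.
move=> g gm; rewrite chiMl IH // chiMr ?(mirr_monic pi) //; congr (_ * _).
rewrite (chi_leg g pi); move: g gm; apply: monic_ind => [|p' g pi' gm IH']; first by rewrite chi1r leg1.
by rewrite chiMr ?(mirr_monic pi') // IH' legM // (chi_leg p pi') leg_reciprocity.
Qed.

(** Reciprocity turns f |-> (D/f) into the nontrivial character f |-> (f/D) modulo D, whose complete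
    sums vanish. *)
Lemma Lcoef_vanish D n : D \is monic -> ~~ issq D -> (deg D <= n)%N -> Lcoef D n = 0.
Proof.
move=> Dm nsq Dn; rewrite -(sum_chi_nonsq Dm nsq Dn) /Lcoef [LHS]big_seq [RHS]big_seq.
by apply: eq_bigr => f /mon_monic fm; exact: chi_recip.
Qed.

End Reciprocity.

End Jacobi.

(** * The functional equation *)

Section PolySums.

Variable F : finFieldType.
Implicit Types (f g h : {poly F}).

Lemma npoly_val n (v : {poly_n F}) : (size (val v) <= n)%N.
Proof. exact: size_npoly. Qed.

Definition mk_small n h (sh : (size h <= n)%N) : {poly_n F} := NPoly (sh : h \is a poly_of_size n).

Lemma sum_npoly_le (V : nmodType) m n (G : {poly F} -> V) : (m <= n)%N ->
  \sum_(v : {poly_n F} | (size (val v) <= m)%N) G (val v) = \sum_(w : {poly_m F}) G (val w).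
Proof.
move=> mn.
have wide (w : {poly_m F}) : (size (val w) <= n)%N by apply: leq_trans (npoly_val w) mn.
rewrite (reindex_onto (fun w : {poly_m F} => mk_small (wide w)) (fun v => npolyp m (val v))) /=.
  apply: eq_bigl => w; rewrite npoly_val /=.
  by apply/eqP; apply: val_inj; rewrite /= npolypK ?npoly_val.
by move=> v vm; apply: val_inj; rewrite /= npolypK.
Qed.

Lemma sum_npoly_split (V : nmodType) m n (G : {poly F} -> V) :
  \sum_(v : {poly_(m + n) F}) G (val v) =
  \sum_(w : {poly_n F}) \sum_(a : {poly_m F}) G (val a + 'X^m * val w).
Proof.
have sz (u : {poly_n F} * {poly_m F}) : (size (val u.2 + 'X^m * val u.1)%R <= m + n)%N.
  apply: leq_trans (size_polyD _ _) _; rewrite geq_max.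
  rewrite (leq_trans (npoly_val _) (leq_addr _ _)) /=.
  have [->|u0] := eqVneq (val u.1) 0; first by rewrite mulr0 size_poly0.
  rewrite size_monicM ?monicXn // size_polyXn addSn /= leq_add2l; exact: npoly_val.
pose r u := mk_small (sz u).
have r_inj : injective r.
  move=> [w a] [w' a'] /(congr1 val) /= E.
  have sa (b : {poly_m F}) : (size (val b) < size ('X^m : {poly F}))%N.
    by rewrite size_polyXn ltnS npoly_val.
  have ww : val w = val w'.
    have := divp_addl_mul_small (val w) (sa a); rewrite addrC mulrC E addrC mulrC.
    by rewrite divp_addl_mul_small ?sa.
  have aa : val a = val a'.
    have := modp_addl_mul_small (val w) (sa a); rewrite addrC mulrC E addrC mulrC.
    by rewrite modp_addl_mul_small ?sa.
  by congr (_, _); apply: val_inj.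
have r_bij : bijective r.
  by apply: inj_card_bij => //; rewrite card_prod !card_npoly expnD mulnC.
rewrite pair_big /= (reindex r) /=; first by [].
by apply: onW_bij.
Qed.

Lemma sum_npoly1 (V : nmodType) (G : {poly F} -> V) :
  \sum_(w : {poly_1 F}) G (val w) = \sum_(c : F) G c%:P.
Proof.
have s1 (c : F) : (size c%:P <= 1)%N by rewrite size_polyC leq_b1.
rewrite (reindex_onto (fun c => mk_small (s1 c)) (fun w => (val w)`_0)) /=.
  by apply: eq_bigl => c; rewrite coefC eqxx.
by move=> w _; apply: val_inj; rewrite /= -size1_polyC // npoly_val.
Qed.

Lemma sum_npolyS (V : nmodType) k (G : {poly F} -> V) :
  \sum_(v : {poly_(k.+1) F}) G (val v) = \sum_(c : F) \sum_(w : {poly_k F}) G (val w + c *: 'X^k).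
Proof.
rewrite -addn1 sum_npoly_split (sum_npoly1 (fun h => \sum_(a : {poly_k F}) G (val a + 'X^k * h))).
by apply: eq_bigr => c _; apply: eq_bigr => w _; rewrite mulrC mul_polyC.
Qed.

Lemma sum_npoly_scale (V : nmodType) k (c : F) (G : {poly F} -> V) : c != 0 ->
  \sum_(w : {poly_k F}) G (c *: val w) = \sum_(w : {poly_k F}) G (val w).
Proof.
move=> c0; have s (w : {poly_k F}) : (size (c *: val w) <= k)%N by rewrite size_scale // npoly_val.
rewrite [RHS](reindex_inj (h := fun w => mk_small (s w))) //.
by move=> v w /(congr1 val) /= /(scalerI c0); exact: val_inj.
Qed.

Lemma sum_monE (V : nmodType) n (G : {poly F} -> V) :
  \sum_(f <- mon F n) G f = \sum_(w : {poly_n F}) G ('X^n + val w).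
Proof. by rewrite big_map big_enum. Qed.

Lemma sum_npoly_shift (V : nmodType) k h (G : {poly F} -> V) : (size h <= k)%N ->
  \sum_(w : {poly_k F}) G (val w + h) = \sum_(w : {poly_k F}) G (val w).
Proof. by move=> sh; rewrite [RHS](reindex_inj (addIr (mk_small sh))). Qed.

Lemma sum_crt (V : nmodType) f g (G : {poly F} -> {poly F} -> V) : f \is monic -> g \is monic ->
  coprimep f g ->
  \sum_(v : {poly_(deg f + deg g) F}) G (val v %% f) (val v %% g) =
  \sum_(a : {poly_(deg f) F}) \sum_(b : {poly_(deg g) F}) G (val a) (val b).
Proof.
move=> fm gm fg; have f0 := monic_neq0 fm; have g0 := monic_neq0 gm.
have szm (f' : {poly F}) h : f' \is monic -> (size (h %% f')%R <= deg f')%N.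
  by move=> fm'; rewrite -ltnS -size_deg // ltn_modp monic_neq0.
pose r (v : {poly_(deg f + deg g) F}) := (mk_small (szm f (val v) fm), mk_small (szm g (val v) gm)).
have r_inj : injective r.
  move=> v w [E1 E2].
  have dv (f' : {poly F}) : val v %% f' = val w %% f' -> f' %| val v - val w.
    by move=> E; apply/eqP; rewrite modpD modpN E subrr.
  have : f * g %| val v - val w by rewrite Gauss_dvdp // !dv.
  move=> dvw; apply: val_inj; apply/eqP; rewrite -subr_eq0 /=; apply/negPn/negP => n0.
  have := dvdp_leq n0 dvw; rewrite size_deg ?monicMl // degM //.
  rewrite leqNgt ltnS; apply/negP/negPn; apply: leq_trans (size_polyD _ _) _.
  by rewrite size_polyN geq_max !npoly_val.
have r_bij : bijective r.
  by apply: inj_card_bij => //; rewrite card_prod !card_npoly expnD.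
rewrite pair_big /= [RHS](reindex r) //=.
by apply: onW_bij.
Qed.

End PolySums.

(** * Symbols of constants and square roots modulo a polynomial *)

Section ConstantSymbol.
Variable F : finFieldType.
Hypothesis F_odd : odd #|F|.
Implicit Types (f g h p : {poly F}).

Lemma pm1_parity (a : int) m n : pm1 a -> (0 < m)%N -> (0 < n)%N -> odd m = odd n -> a ^+ m = a ^+ n.
Proof.
case/or3P => /eqP-> m0 n0 mn; first by rewrite !expr0n !gtn_eqF.
  by rewrite !expr1n.
by rewrite -signr_odd mn signr_odd.
Qed.

(** The Euler exponent (q^d - 1)/2 is (q - 1)/2 times a sum of d odd numbers, which has the parity
    of d. *)
Lemma leg_const (c : F) p : mirr p -> leg c%:P p = qr c ^+ deg p.
Proof.
move=> pi; have pm_exp (a : int) n : pm1 a -> pm1 (a ^+ n).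
  by move=> pa; elim: n => // n IHn; rewrite exprS pm1M.
apply: (pm1_inj (k_odd F_odd pi)); rewrite ?pm_exp ?leg_pm1 ?qr_pm1 //.
have := leg_euler F_odd pi c%:P; rewrite -(red_eq0 pi) rmorphB /= rmorph_int subr_eq0 => /eqP<-.
have <- : qr c ^+ (\sum_(i < deg p) #|F| ^ i) = qr c ^+ deg p.
  apply: pm1_parity (qr_pm1 c) _ (deg_gt0 pi) _.
    by case: (deg p) (deg_gt0 pi) => // n _; rewrite big_ord_recl expn0.
  elim: (deg p) => [|n IHn]; first by rewrite big_ord0.
  by rewrite big_ord_recr oddD IHn oddX F_odd orbT /= addbT.
have hc : ((qr c)%:~R)%:P = (qr c)%:~R :> {poly F} by rewrite rmorph_int.
by rewrite half_geom // exprM -polyC_exp -qrE // hc !rmorphXn /= rmorph_int.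
Qed.

Lemma chi_const (c : F) f : f \is monic -> chi c%:P f = qr c ^+ deg f.
Proof.
move=> fm; rewrite {1}(deg_vP fm (leqnn _)) -prodrXr /chi [LHS]big_seq [RHS]big_seq.
apply: eq_bigr => p; rewrite mem_irr => /andP[pi _].
by rewrite leg_const // -exprM mulnC.
Qed.

Lemma qr_sum_sqr : \sum_(c : F) qr (c ^+ 2) = #|F|.-1%:R.
Proof.
rewrite (bigD1 0) //= expr0n qr0 add0r (eq_bigr (fun=> 1)); last by move=> c c0; rewrite qr_sqr.
by rewrite sumr_const cardC1.
Qed.

Definition nsqrt f h : int := \sum_(v : {poly_(deg f) F}) (f %| val v ^+ 2 - h)%R%:R.

Lemma nsqrt_mirr p h : mirr p -> nsqrt p h = 1 + leg h p.
Proof.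
move=> pi; rewrite leg_qr -card_sqrt ?k_odd // -sum1_card natr_sum /nsqrt.
have sp : (size (mk_monic p)).-1 = deg p by rewrite mk_monicE //; exact: mirr_mip.
rewrite [RHS]big_mkcond [RHS](reindex (fun v : {poly_(deg p) F} => red pi (val v))) /=.
  apply: eq_bigr => v _; rewrite inE -rmorphXn -subr_eq0 -rmorphB red_eq0.
  by case: (p %| _).
have sv (z : {poly %/ p with mirr_mip pi}) : (size (val z) <= deg p)%N.
  by rewrite -[X in (_ <= X)%N]sp; exact: size_npoly.
have pm := size_deg (mirr_monic pi).
exists (fun z => mk_small (sv z)) => [v _|z _]; last exact: red_surj.
apply: val_inj; rewrite /= Pdiv.CommonRing.rmodp_small //.
by rewrite (mk_monicE (mirr_mip pi)) pm ltnS npoly_val.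
Qed.

Lemma nsqrtM f g h : f \is monic -> g \is monic -> coprimep f g ->
  nsqrt (f * g) h = nsqrt f h * nsqrt g h.
Proof.
move=> fm gm fg; rewrite /nsqrt degM //.
have dvE (f' : {poly F}) v : (f' %| (v %% f') ^+ 2 - h) = (f' %| v ^+ 2 - h).
  rewrite -[RHS](dvdp_addr _ (_ : f' %| (v %% f') ^+ 2 - v ^+ 2)) ?addrA ?subrK //.
  by rewrite subr_sqr dvdp_mulr // {2}(divp_eq v f') opprD addrCA subrr addr0 dvdpNr dvdp_mull.
under eq_bigr => v _ do rewrite Gauss_dvdp // -dvE -[X in _ && X]dvE -mulnb natrM.
rewrite (sum_crt (fun a b => (f %| a ^+ 2 - h)%R%:R * (g %| b ^+ 2 - h)%R%:R)) //.
rewrite mulr_suml; apply: eq_bigr => a _; by rewrite mulr_sumr.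
Qed.

(** Square roots modulo distinct primes are chosen independently. Expanding the product exposes the
    Jacobi symbol as its top term, which is how [gsum1_val] reaches the Gauss sum. *)
Lemma nsqrt_prod (s : seq {poly F}) h : uniq s -> all (@mirr F) s ->
  nsqrt (\prod_(p <- s) p) h = \prod_(p <- s) (1 + leg h p).
Proof.
elim: s => [|p s IHs] /=.
  move=> _ _; rewrite !big_nil /nsqrt deg1 (eq_bigr (fun=> 1)).
    by rewrite sumr_const card_npoly expn0.
  by move=> v _; rewrite dvd1p.
move=> /andP[ps us] /andP[pi si]; have sm : \prod_(p' <- s) p' \is monic.
  by rewrite big_seq monic_prod // => p' p's; apply/mirr_monic/(allP si).
rewrite !big_cons (nsqrtM _ (mirr_monic pi) sm) ?(nsqrt_mirr _ pi) ?IHs //.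
rewrite big_seq; apply: (big_ind (fun r => coprimep p r)) => [|r r'|p' p's].
- exact: coprimep1.
- by rewrite coprimepMr => -> ->.
have pi' := allP si _ p's.
rewrite irreducible_poly_coprime; last exact: mirrP.
by apply: contraNN ps => /(mirr_dvd_eq pi pi')->.
Qed.

End ConstantSymbol.

(** * Gauss sums and the functional equation for squarefree D of odd degree *)

Section FunctionalEquation.
Variable F : finFieldType.
Hypothesis F_odd : odd #|F|.
Local Notation q := #|F|.
Variables (D : {poly F}) (g : nat).
Hypotheses (Dm : D \is monic) (sD : deg D = (2 * g).+1).
Hypothesis Dsq : forall p, mirr p -> ~~ (p ^+ 2 %| D).
Implicit Types (f h u : {poly F}).

(* The coefficient of 1/X in the expansion of h / D at infinity. *)
Definition lam h : F := (h %% D)`_(2 * g).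

Lemma lamD h h' : lam (h + h') = lam h + lam h'.
Proof. by rewrite /lam modpD coefD. Qed.

Lemma lamZ c h : lam (c *: h) = c * lam h.
Proof. by rewrite /lam modpZl coefZ. Qed.

Lemma lam_small h : (size h <= (2 * g).+1)%N -> lam h = h`_(2 * g).
Proof. by move=> sh; rewrite /lam modp_small // (size_deg Dm) sD ltnS. Qed.

Lemma lam_modp h : lam (h %% D) = lam h.
Proof. by rewrite /lam modp_id. Qed.

Lemma lam_mulmod h h' : lam (h * (h' %% D)) = lam (h * h').
Proof. by rewrite /lam modp_mul. Qed.

(* A Gauss sum in which the quadratic character of F replaces the additive     *)
(* character, so that it is an integer; it works because deg D is odd.         *)
Definition gsum f : int := \sum_(v : {poly_(deg D) F}) chi (val v) D * qr (lam (f * val v)).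

(** For f prime to D, substitute v -> f v. Otherwise some prime p divides both D and f, and both
    sides vanish: [gsum f] equals its own negative. *)
Lemma gsum_chi f : gsum f = chi f D * gsum 1.
Proof.
have [Df|Df] := boolP (coprimep D f).
  have c2 : chi f D * chi f D = 1.
    by rewrite pm1_sqr ?chi_pm1 // chi_eq0 // Df.
  rewrite -[LHS]mul1r -c2 -mulrA; congr (_ * _).
  rewrite /gsum -(sum_npoly_mulr (fun h => chi h D * qr (lam (1 * h))) Dm Df) mulr_sumr.
  by apply: eq_bigr => v _; rewrite chi_modp // chiMl // mul1r lam_modp mulrA.
have := chi_eq0 f Dm; rewrite Df => /eqP->; rewrite mul0r.
have [p pi /andP[pD pf]] : exists2 p, mirr p & (p %| D) && (p %| f).
  have : (1 < size (gcdp D f))%N.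
    rewrite ltn_neqAle eq_sym Df lt0n size_poly_eq0 gcdp_eq0 negb_and.
    by rewrite monic_neq0.
  by move=> /mirr_dvd_exists[p pi]; rewrite dvdp_gcd => pfB; exists p.
have [E DE] := dvdpP _ _ pD; rewrite mulrC in DE.
have pE : ~~ (p %| E).
  by apply: contra (Dsq pi) => pE; rewrite DE expr2 dvdp_mul2l // mirr_neq0.
have Em : E \is monic by move: Dm; rewrite DE monicMl // mirr_monic.
(* As D is squarefree, D / p is prime to p. So there is u with (u/D) = -1 and u = 1 modulo D / p.
   Since p divides f, multiplying v by u leaves f v unchanged modulo D but flips the sign of the
   symbol. *)
have [u [uE uD]] := @chi_nonres_at _ F_odd p E 1 pi Em pE isT.
rewrite expr1 -DE in uE.
have Du : coprimep D u by apply/negPn; rewrite -chi_eq0 // uE.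
have : gsum f = - gsum f; last by lia.
rewrite {1}/gsum -(sum_npoly_mulr (fun h => chi h D * qr (lam (f * h))) Dm Du) -sumrN.
apply: eq_bigr => v _; rewrite chi_modp // chiMl // uE mulN1r mulNr lam_mulmod; congr (- (_ * qr _)).
have : D %| f * (u * val v) - f * val v.
  rewrite [X in _ %| X](_ : _ = f * (u - 1) * val v); last by ring.
  by rewrite dvdp_mulr // DE dvdp_mul.
by rewrite /dvdp -/(modp _ _) modpD modpN subr_eq0 /lam => /eqP->.
Qed.

(** Scaling a polynomial by c multiplies its summand by qr(c)^(1 + deg D), which is 1 for c != 0
    because deg D is odd. So each of the q - 1 nonzero leading coefficients contributes the monic
    sum. *)
Lemma sum_lead k : \sum_(v : {poly_(k.+1) F}) chi (val v) D * qr (val v)`_k =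
  (q.-1)%:R * \sum_(f <- mon F k) chi f D.
Proof.
rewrite (sum_npolyS _ (fun h => chi h D * qr h`_k)) (bigD1 0) //= big1 ?add0r; last first.
  by move=> w _; rewrite scale0r addr0 nth_default ?qr0 ?mulr0 ?npoly_val.
rewrite (eq_bigr (fun=> \sum_(f <- mon F k) chi f D)); last first.
  move=> c c0; rewrite sum_monE -(sum_npoly_scale _ (fun h => chi (h + c *: 'X^k) D * qr (h + c *: 'X^k)`_k) c0).
  apply: eq_bigr => w _; rewrite coefD !coefZ coefXn eqxx mulr1 [(val w)`_k]nth_default ?npoly_val // mulr0 add0r.
  rewrite -scalerDr -mul_polyC chiMl // chi_const // sD addrC mulrAC.
  rewrite (_ : _ * qr c = 1) ?mul1r // -exprSr.
  rewrite (pm1_parity (qr_pm1 c) _ _ (n := 2)) ?expr2 ?pm1_sqr ?qr_pm1 ?qr_eq0 //.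
  by rewrite /= mul2n odd_double.
by rewrite sumr_const cardC1 mulr_natl.
Qed.

Lemma sum_qr_affine (a b : F) : b != 0 -> \sum_(t : F) qr (a + t * b) = 0.
Proof.
by move=> b0; rewrite -[RHS](sum_qr_shift F_odd a) [RHS](reindex_inj (mulIf b0)).
Qed.

(** Serves the averaging argument used below: q copies of a sum are rewritten as the sum of its
    translates by t h, t in F, and for suitable h the sum over t vanishes by [sum_qr_affine]. *)
Lemma sum_zero_q (x : int) : x *+ q = 0 -> x = 0.
Proof.
rewrite -mulr_natr => /eqP; rewrite mulf_eq0 => /orP[/eqP//|].
by rewrite pnatr_eq0 gtn_eqF // ltnW ?finNzRing_gt1.
Qed.

(** The shift brings the degree to exactly 2 g, so that [lam] reads off the leading coefficient.
    This yields the direction of translation in the averaging arguments. *)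
Lemma coef_lead_shift h s : (size h = s.+1) -> (s <= 2 * g)%N ->
  lam ('X^(2 * g - s) * h) = lead_coef h /\ lead_coef h != 0.
Proof.
move=> sh sg; have h0 : h != 0 by rewrite -size_poly_eq0 sh.
rewrite lead_coef_eq0; split=> //.
rewrite lam_small; last by rewrite size_monicM ?monicXn // size_polyXn sh; lia.
by rewrite coefXnM ltnNge leq_subr /= subKn // lead_coefE sh.
Qed.

Lemma inner_small n (v : {poly F}) : (n <= 2 * g)%N -> (size v <= (2 * g - n).+1)%N ->
  \sum_(f <- mon F n) qr (lam (f * v)) = (q ^ n)%:R * qr v`_(2 * g - n).
Proof.
move=> ng sv; rewrite big_seq (eq_bigr (fun=> qr v`_(2 * g - n))); last first.
  move=> f fm; congr qr; have sf := mon_size fm; rewrite lam_small; last first.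
    have [->|v0] := eqVneq v 0; first by rewrite mulr0 size_poly0.
    rewrite size_monicM ?(mon_monic fm) // sf addSn /= -[X in (_ <= X.+1)%N](subnKC ng) -addnS.
    by rewrite leq_add2l.
  rewrite coefM (bigD1 (inord n)) //= inordK ?ltnS // big1 ?addr0.
    by have := mon_monic fm; rewrite monicE lead_coefE sf => /eqP->; rewrite mul1r.
  move=> i ni; have [lin|nli] := ltnP i n; last first.
    rewrite nth_default ?mul0r // sf ltn_neqAle nli andbT.
    by apply: contra ni => /eqP E; apply/eqP/val_inj; rewrite /= inordK ?ltnS.
  rewrite mulrC nth_default ?mul0r //; apply: leq_trans sv _; lia.
by rewrite -big_seq big_const_seq count_predT size_mon iter_addr_0 mulr_natl.
Qed.

Lemma inner_big n (v : {poly F}) : (n <= 2 * g)%N -> ((2 * g - n).+1 < size v <= (2 * g).+1)%N ->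
  \sum_(f <- mon F n) qr (lam (f * v)) = 0.
Proof.
move=> ng /andP[sv vg]; apply: sum_zero_q.
have [s vs] : exists s, size v = s.+1 by case: (size v) sv => // s _; exists s.
rewrite vs in sv vg.
have [E L0] := coef_lead_shift vs (vg : (s <= 2 * g)%N).
set i := (2 * g - s)%N in E.
have ci (t : F) : (size (t *: 'X^i) <= n)%N.
  by apply: leq_trans (size_scale_leq _ _) _; rewrite size_polyXn /i; lia.
transitivity (\sum_(t : F) \sum_(w : {poly_n F}) qr (lam (('X^n + (val w + t *: 'X^i)) * v))).
  rewrite [RHS](eq_bigr (fun=> \sum_(f <- mon F n) qr (lam (f * v)))) ?sumr_const //.
  by move=> t _; rewrite sum_monE (sum_npoly_shift (fun h => qr (lam (('X^n + h) * v))) (ci t)).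
rewrite exchange_big big1 // => w _ /=.
rewrite -[RHS](sum_qr_affine (lam (('X^n + val w) * v)) L0); apply: eq_bigr => t _.
by rewrite addrA mulrDl lamD -scalerAl lamZ E.
Qed.

(* For fixed v the sum over f vanishes as soon as some X^i with i < n is not  *)
(* orthogonal to v; this leaves only the v of degree at most 2 g - n.         *)
Lemma gsum_mon n : (n <= 2 * g)%N ->
  \sum_(f <- mon F n) gsum f = (q ^ n)%:R * ((q.-1)%:R * \sum_(f <- mon F (2 * g - n)) chi f D).
Proof.
move=> ng; rewrite /gsum exchange_big /= -sum_lead mulr_sumr.
rewrite -(sum_npoly_le (fun h => (q ^ n)%:R * (chi h D * qr h`_(2 * g - n))) (n := deg D)); last first.
  by rewrite sD ltnS leq_subr.
rewrite [RHS]big_mkcond; apply: eq_bigr => v _; rewrite -mulr_sumr.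
case: leqP => sv; first by rewrite inner_small // mulrCA.
by rewrite inner_big ?mulr0 // sv -sD npoly_val.
Qed.

(* The polynomials of degree < g are totally isotropic for v |-> lam (v ^+ 2), *)
(* and their orthogonal consists of the polynomials of degree <= g.           *)
Lemma sum_qr_lam_sqr : \sum_(v : {poly_(deg D) F}) qr (lam (val v ^+ 2)) = (q.-1)%:R * (q ^ g)%:R.
Proof.
rewrite sD (_ : (2 * g).+1 = g + (1 + g))%N; last by lia.
(* Write v = a + X^g (c + X w) with c constant and a, w of degree below g. For w != 0 the sum over a
   cancels, since translating a changes the form by a nonzero linear term. For w = 0 the form is
   c^2, whatever a is. *)
rewrite (sum_npoly_split _ _ (fun h => qr (lam (h ^+ 2)))).
have sa2 (a : {poly_g F}) : lam (val a ^+ 2) = 0.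
  have [->|a0] := eqVneq (val a) 0; first by rewrite expr0n /lam mod0p coef0.
  have s2 : (size (val a ^+ 2) <= 2 * g)%N.
    apply: leq_trans (size_poly_exp_leq _ _) _; have := npoly_val a.
    by rewrite (polySpred a0) /=; move: (size _).-1 => s; lia.
  by rewrite lam_small ?nth_default // ltnW.
rewrite (sum_npoly_split _ _ (fun h => \sum_(a : {poly_g F}) qr (lam ((val a + 'X^g * h) ^+ 2)))).
rewrite (bigD1 0) //= [X in _ + X]big1 ?addr0; last first.
  move=> w w0; rewrite (sum_npoly1 (fun h => \sum_(a : {poly_g F}) qr (lam ((val a + 'X^g * (h + 'X^1 * val w)) ^+ 2)))).
  rewrite big1 // => c _; apply: sum_zero_q.
  have vw0 : val w != 0 by apply: contra w0 => /eqP w0; apply/eqP/val_inj.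
  have := npoly_val w; rewrite (polySpred vw0) /=; set s := (size (val w)).-1 => sg.
  set h := c%:P + _.
  have sh : size h = s.+2.
    rewrite /h addrC size_polyDl size_monicM ?monicXn // size_polyXn (polySpred vw0) ?addSn //=.
    by rewrite !ltnS size_polyC; case: (c != 0).
  have shg : (s.+1 + g <= 2 * g)%N by lia.
  have sXh : size ('X^g * h) = (s.+1 + g).+1.
    by rewrite size_monicM ?monicXn -?size_poly_eq0 ?sh // size_polyXn addSn /= addnC addSn.
  have [E L0] := coef_lead_shift sXh shg.
  set i := (2 * g - _)%N in E.
  have ci (t : F) : (size (t *: 'X^i) <= g)%N.
    by apply: leq_trans (size_scale_leq _ _) _; rewrite size_polyXn /i; lia.
  transitivity (\sum_(t : F) \sum_(a : {poly_g F}) qr (lam ((val a + t *: 'X^i + 'X^g * h) ^+ 2))).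
    rewrite [RHS](eq_bigr (fun=> \sum_(a : {poly_g F}) qr (lam ((val a + 'X^g * h) ^+ 2)))) ?sumr_const //.
    by move=> t _; rewrite (sum_npoly_shift (fun a => qr (lam ((a + 'X^g * h) ^+ 2))) (ci t)).
  rewrite exchange_big big1 // => a _ /=.
  have L20 : 2%:R * lead_coef ('X^g * h) != 0 by rewrite mulf_neq0 ?two_neq0.
  rewrite -[RHS](sum_qr_affine (lam (2%:R *: (val a * ('X^g * h)) + ('X^g * h) ^+ 2)) L20).
  apply: eq_bigr => t _; congr qr.
  have -> : (val a + t *: 'X^i + 'X^g * h) ^+ 2 = (val a + t *: 'X^i) ^+ 2 +
      ((2%:R *: (val a * ('X^g * h)) + ('X^g * h) ^+ 2) + (t * 2%:R) *: ('X^i * ('X^g * h))).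
    by rewrite -!mul_polyC polyCM polyC_natr; ring.
  have := sa2 (a + mk_small (ci t)); rewrite /= => a20.
  by rewrite lamD a20 add0r lamD lamZ E -[t * 2%:R * _]mulrA.
rewrite (sum_npoly1 (fun h => \sum_(a : {poly_g F}) qr (lam ((val a + 'X^g * (h + 'X^1 * 0)) ^+ 2)))).
rewrite -qr_sum_sqr // mulr_suml; apply: eq_bigr => c _.
rewrite (eq_bigr (fun=> qr (c ^+ 2))) ?sumr_const ?card_npoly ?mulr_natr // => a _.
rewrite mulr0 addr0 mulrC mul_polyC; congr qr.
have -> : (val a + c *: 'X^g) ^+ 2 = val a ^+ 2 + ((2%:R * c) *: ('X^g * val a) + c ^+ 2 *: 'X^(2 * g)).
  by rewrite -!mul_polyC polyCM polyC_natr polyC_exp mulnC exprM; ring.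
have sX : (size ('X^g * val a)%R <= 2 * g)%N.
  have [->|a0] := eqVneq (val a) 0; first by rewrite mulr0 size_poly0.
  by rewrite size_monicM ?monicXn // size_polyXn addSn /= mul2n -addnn leq_add2l npoly_val.
rewrite lamD sa2 add0r lamD !lamZ !lam_small ?size_polyXn // 1?ltnW //.
by rewrite [('X^g * _)`__]nth_default // mulr0 add0r coefXn eqxx mulr1.
Qed.

Definition pdiv_seq := [seq p <- irr F (deg D) | p %| D].

Lemma pdiv_seq_mirr p : p \in pdiv_seq -> mirr p /\ p %| D.
Proof. by rewrite mem_filter mem_irr => /and3P[-> ->]. Qed.

Lemma vP_sqf p : mirr p -> vP p D = (p %| D).
Proof.
move=> pi; have := Dsq pi; rewrite (dvd_vP _ pi (monic_neq0 Dm)).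
have := dvd_vP 1 pi (monic_neq0 Dm); rewrite expr1 => ->.
by case: (vP p D) => [|[]].
Qed.

Lemma prod_pdiv_seq : \prod_(p <- pdiv_seq) p = D.
Proof.
rewrite [RHS](@prod_irr_vP _ D (deg D)) ?size_deg // big_filter big_mkcond.
rewrite [LHS]big_seq [RHS]big_seq; apply: eq_bigr => p; rewrite mem_irr => /andP[pi _].
by rewrite vP_sqf //; case: (p %| D).
Qed.

Lemma chi_pdiv_seq h : chi h D = \prod_(p <- pdiv_seq) leg h p.
Proof.
rewrite /chi [RHS]big_filter [RHS]big_mkcond.
rewrite [LHS]big_seq [RHS]big_seq; apply: eq_bigr => p; rewrite mem_irr => /andP[pi _].
by rewrite vP_sqf //; case: (p %| D).
Qed.

(** Put E = D / p, of degree at most 2 g. Translation by t X^(2 g - deg E) E does not affect G, but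
    adds t to [lam]. *)
Lemma sum_lam_periodic p (G : {poly F} -> int) : p \in pdiv_seq ->
  (forall h h', D %/ p %| h - h' -> G h = G h') ->
  \sum_(v : {poly_(deg D) F}) qr (lam (val v)) * G (val v) = 0.
Proof.
move=> /pdiv_seq_mirr[pi pD] GP; apply: sum_zero_q.
have DE := divpK pD; set E := D %/ p in DE GP.
have Em : E \is monic by move: Dm; rewrite -DE monicMr // mirr_monic.
have dE : (deg D = deg E + deg p)%N by rewrite -DE degM // mirr_monic.
have dp := deg_gt0 pi.
have sE := size_deg Em; have sEg : (deg E <= 2 * g)%N by lia.
have [lE L0] := coef_lead_shift sE sEg.
set i := (2 * g - _)%N in lE.
have sc (t : F) : (size (t *: ('X^i * E)) <= deg D)%N.
  apply: leq_trans (size_scale_leq _ _) _; rewrite size_monicM ?monicXn ?monic_neq0 //.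
  by rewrite size_polyXn sE sD /i; lia.
transitivity (\sum_(t : F) \sum_(v : {poly_(deg D) F}) qr (lam (val v + t *: ('X^i * E))) * G (val v + t *: ('X^i * E))).
  rewrite [RHS](eq_bigr (fun=> \sum_(v : {poly_(deg D) F}) qr (lam (val v)) * G (val v))) ?sumr_const //.
  by move=> t _; rewrite (sum_npoly_shift (fun v => qr (lam v) * G v) (sc t)).
rewrite exchange_big big1 // => v _ /=.
under eq_bigr => t _.
  rewrite (GP _ (val v)); last by rewrite addrAC subrr add0r -mul_polyC !dvdp_mull.
  rewrite lamD lamZ lE; over.
by rewrite -mulr_suml sum_qr_affine // mul0r.
Qed.

(* The product over s2 is expanded one factor at a time: each summand in which *)
(* the factor leg _ p is missing has period D / p, so it contributes 0.       *)
Lemma sum_lam_prod (s1 s2 : seq {poly F}) : perm_eq (s1 ++ s2) pdiv_seq ->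
  \sum_(v : {poly_(deg D) F}) qr (lam (val v)) *
     ((\prod_(p <- s1) leg (val v) p) * \prod_(p <- s2) (1 + leg (val v) p)) =
  \sum_(v : {poly_(deg D) F}) qr (lam (val v)) * chi (val v) D.
Proof.
elim: s2 s1 => [|p s2 IHs] s1 sE.
  rewrite cats0 in sE; apply: eq_bigr => v _; rewrite big_nil mulr1.
  by rewrite chi_pdiv_seq (perm_big _ sE).
have ps : p \in pdiv_seq by rewrite -(perm_mem sE) mem_cat mem_head orbT.
have [pi pD] := pdiv_seq_mirr ps.
rewrite -(IHs (p :: s1)); last first.
  by apply: perm_trans sE; apply/permP => a; rewrite /= !count_cat /= addnCA.
apply/eqP; rewrite -subr_eq0 -sumrB; apply/eqP.
rewrite -[RHS](sum_lam_periodic (G := fun h => (\prod_(p <- s1) leg h p) * \prod_(p <- s2) (1 + leg h p)) ps).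
  by apply: eq_bigr => v _; rewrite !big_cons; ring.
have us : uniq (s1 ++ p :: s2) by rewrite (perm_uniq sE) filter_uniq // irr_uniq.
move=> h h' hh'.
have leq p' : p' \in s1 ++ s2 -> leg h p' = leg h' p'.
  move=> p's; have p's' : p' \in pdiv_seq.
    by rewrite -(perm_mem sE) mem_cat inE; move: p's; rewrite mem_cat => /orP[]->; rewrite ?orbT.
  have [pi' pD'] := pdiv_seq_mirr p's'.
  apply: (leg_mod pi'); apply: dvdp_trans hh'.
  move: pD'; rewrite -{1}(divpK pD) mirr_dvdM // => /orP[//|/(mirr_dvd_eq pi' pi) pp].
  by move: us; rewrite uniq_catC cat_cons /= -pp mem_cat orbC -mem_cat p's.
congr (_ * _); rewrite [LHS]big_seq [RHS]big_seq; apply: eq_bigr => p' p's; rewrite leq // mem_cat p's ?orbT //.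
Qed.

(* Replacing v by its square determines the sign of the functional equation. *)
Lemma gsum1_val : gsum 1 = (q.-1)%:R * (q ^ g)%:R.
Proof.
rewrite -sum_qr_lam_sqr.
(* Group the v by w = v^2 modulo D. The number of square roots is the product of 1 + (w/p) over the
   primes p dividing D, and by [sum_lam_prod] only the full product of symbols survives. *)
transitivity (\sum_(w : {poly_(deg D) F}) qr (lam (val w)) * nsqrt D (val w)).
  have nsE h : nsqrt D h = \prod_(p <- pdiv_seq) (1 + leg h p).
    rewrite -{1}prod_pdiv_seq nsqrt_prod //; first exact/filter_uniq/irr_uniq.
    by apply/allP => p /pdiv_seq_mirr[].
  under [RHS]eq_bigr => w _ do rewrite nsE.
  have E := @sum_lam_prod [::] pdiv_seq (perm_refl _).
  transitivity (\sum_(v : {poly_(deg D) F}) qr (lam (val v)) * chi (val v) D).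
    by apply: eq_bigr => v _; rewrite mul1r mulrC.
  by rewrite -E; apply: eq_bigr => v _; rewrite big_nil mul1r.
rewrite /nsqrt; under eq_bigr do rewrite mulr_sumr.
rewrite exchange_big /=; apply: eq_bigr => v _.
have sm : (size (val v ^+ 2 %% D)%R <= deg D)%N by rewrite -ltnS -size_deg // ltn_modp monic_neq0.
rewrite (bigD1 (mk_small sm)) //= big1 ?addr0.
  rewrite lam_modp (_ : D %| _) ?mulr1 //.
  by apply/eqP; rewrite modpD modpN modp_id subrr.
move=> w wv; case: (boolP (D %| _)) => [Dw|_]; last by rewrite mulr0.
case/eqP: wv; apply: val_inj => /=; apply/eqP; rewrite eq_sym -subr_eq0.
have -> : val w = val w %% D by rewrite modp_small // (size_deg Dm) ltnS npoly_val.
by rewrite -modpN -modpD.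
Qed.

(** Evaluate the sum of [gsum f] over the monic f of degree n in two ways, by [gsum_mon] and by
    [gsum_chi] with [gsum1_val], and cancel q - 1. *)
Lemma functional_equation n : (n <= 2 * g)%N ->
  (q ^ g)%:R * \sum_(f <- mon F n) chi f D = (q ^ n)%:R * \sum_(f <- mon F (2 * g - n)) chi f D.
Proof.
move=> ng; have q10 : (q.-1)%:R != 0 :> int.
  by rewrite pnatr_eq0; have := finNzRing_gt1 F; case: #|F| => [|[]].
apply: (mulfI q10); rewrite [RHS]mulrCA -gsum_mon //.
under [in RHS]eq_bigr do rewrite gsum_chi gsum1_val.
by rewrite -mulr_suml [RHS]mulrC mulrA.
Qed.

End FunctionalEquation.

(** * The zeta function *)

Section Zeta.

Variable F : finFieldType.
Hypothesis q4 : #|F| = 1 %[mod 4].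
Local Notation q := #|F|.

Lemma F_odd : odd q.
Proof.
rewrite (divn_eq q 4) q4 modn_small // oddD oddM.
by rewrite [odd 4]/= andbF.
Qed.

Lemma exists_ext n : exists (L : finFieldType) (io : {rmorphism F -> L}), #|L| = (q ^ n.+1)%N.
Proof.
exists (finvect_type (ext_field F n)), (in_alg (ext_field F n)).
exact: card_ext_field.
Qed.

Lemma card_curveE (D : {poly F}) n :
  (card_curve D n)%:R = (q ^ n.+1)%:R + 1 + psum D n.+1 :> int.
Proof.
rewrite /card_curve -addn1 natrD [RHS]addrAC; congr (_ + 1).
set K := finvect_type _; have cK : #|K| = (q ^ n.+1)%N := card_ext_field F n.
have oK : odd #|K| by rewrite cK oddX F_odd orbT.
pose io : {rmorphism F -> K} := in_alg (ext_field F n).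
rewrite /psum -(sum_qr_irr F_odd io cK D) -cK -sum1_card natr_sum.
rewrite -[in RHS]sum1_card natr_sum -big_split /=.
transitivity (\sum_(x : K) \sum_(y : K) ((y ^+ 2 == (map_poly io D).[x])%:R : int)).
  rewrite pair_big /= big_mkcond /=; apply: eq_bigr => -[x y] _ /=.
  by rewrite inE /=; case: ifP.
apply: eq_bigr => x _; rewrite -(card_sqrt oK) -sum1_card natr_sum [RHS]big_mkcond.
by apply: eq_bigr => y _; rewrite inE; case: ifP.
Qed.

Section Trunc.
Variables (D : {poly F}) (n : nat).
Local Notation k := n.
Local Notation Q := (q%:R : rat).
Local Notation s := (fun j => (psum D j)%:~R : rat).

(** [S] truncates log Z, [E l] truncates the exponential of [S], and [P] is the denominator of Z. So
    [E n.+1 * P] is Z(u)(1 - u)(1 - q u) modulo u^(n+1), and [sigma] will be its logarithmic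
    derivative. *)
Let S : {poly rat} := \sum_(m < n.+1) ((card_curve D m)%:R / m.+1%:R) *: 'X^(m.+1).
Let E (l : nat) : {poly rat} := \sum_(i < l) i`!%:R^-1 *: S ^+ i.
Let P : {poly rat} := (1 - 'X) * (1 - Q *: 'X).
Let sigma : {poly rat} := \sum_(m < n.+1) s m.+1 *: 'X^m.

Lemma deriv_E l : (E l.+1)^`() = S^`() * E l.
Proof.
rewrite /E raddf_sum big_ord_recl /= expr0 derivZ derivC scaler0 add0r mulr_sumr.
apply: eq_bigr => i _; rewrite /bump /= add1n derivZ deriv_exp /= -scaler_nat scalerA.
by rewrite -scalerAr factS natrM invfM mulrAC mulVf ?pnatr_eq0 // mul1r.
Qed.

Lemma deriv_S : S^`() = sigma + \sum_(m < n.+1) 'X^m + \sum_(m < n.+1) Q ^+ m.+1 *: 'X^m.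
Proof.
rewrite /S /sigma raddf_sum -!big_split /=; apply: eq_bigr => m _.
rewrite derivZ derivXn /= -scaler_nat scalerA mulrVK ?unitfE ?pnatr_eq0 //.
rewrite -[X in _ + X + _]scale1r -!scalerDl; congr (_ *: _).
have := congr1 (intr : int -> rat) (card_curveE D m).
by rewrite !rmorphD /= !rmorph_nat rmorph1 natrX => ->; ring.
Qed.

Lemma geom_X (c : rat) : (\sum_(m < n.+1) c ^+ m *: 'X^m) * (1 - c *: 'X) = 1 - c ^+ n.+1 *: 'X^(n.+1) :> {poly rat}.
Proof.
elim: n => [|l IHl]; first by rewrite big_ord1 !expr0 scale1r mul1r !expr1.
rewrite big_ord_recr /= mulrDl IHl -!mul_polyC !polyC_exp !exprS; ring.
Qed.

(** The geometric series in S' coming from the terms q^m + 1 of the point counts cancel against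
    P'/P. Only [sigma] remains, up to truncation. *)
Lemma S_P : S^`() * P + P^`() = sigma * P - 'X^(n.+1) * ((1 - Q *: 'X) + (Q ^+ n.+2)%:P * (1 - 'X)).
Proof.
have g1 : (\sum_(m < n.+1) 'X^m) * (1 - 'X) = 1 - 'X^(n.+1) :> {poly rat}.
  have := geom_X 1; rewrite expr1n !scale1r => <-; congr (_ * _).
  by apply: eq_bigr => m _; rewrite expr1n scale1r.
have g2 : (\sum_(m < n.+1) Q ^+ m.+1 *: 'X^m) * (1 - Q *: 'X) = Q%:P * (1 - (Q ^+ n.+1) *: 'X^(n.+1)) :> {poly rat}.
  rewrite -geom_X mulrA; congr (_ * _); rewrite mulr_sumr; apply: eq_bigr => m _.
  by rewrite mul_polyC scalerA exprS.
have P' : P^`() = - (1 - Q *: 'X) - Q%:P * (1 - 'X).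
  by rewrite /P derivM !derivB derivX derivC derivZ derivX -!mul_polyC; ring.
rewrite deriv_S P' /P.
set A := sigma; set B := (\sum_(m < n.+1) 'X^m) in g1 *.
set C := (\sum_(m < n.+1) Q ^+ m.+1 *: 'X^m) in g2 *.
transitivity (A * ((1 - 'X) * (1 - Q *: 'X)) + B * (1 - 'X) * (1 - Q *: 'X)
   + C * (1 - Q *: 'X) * (1 - 'X) - (1 - Q *: 'X) - Q%:P * (1 - 'X)); first by ring.
by rewrite g1 g2 [Q ^+ n.+2]exprS polyCM -!mul_polyC; ring.
Qed.

Lemma dvd_Xn_S l : exists R, S ^+ l = 'X^l * R.
Proof.
exists ((\sum_(m < n.+1) ((card_curve D m)%:R / m.+1%:R) *: 'X^m) ^+ l).
rewrite -exprMn; congr (_ ^+ _); rewrite mulr_sumr /S.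
by apply: eq_bigr => m _; rewrite -scalerAr exprS.
Qed.

Lemma deriv_Y : exists R, (E n.+1 * P)^`() = sigma * (E n.+1 * P) + 'X^n * R.
Proof.
have [R SR] := dvd_Xn_S n.
exists (- 'X * ((1 - Q *: 'X) + (Q ^+ n.+2)%:P * (1 - 'X)) * E n.+1 - S^`() * (n`!%:R^-1)%:P * R * P).
rewrite derivM deriv_E.
(* Differentiation drops the last term of the truncated exponential, a multiple of [S ^+ n], hence
   of 'X^n. *)
have -> : E n = E n.+1 - (n`!%:R^-1)%:P * ('X^n * R).
  by rewrite /E big_ord_recr /= SR mul_polyC addrK.
transitivity (E n.+1 * (S^`() * P + P^`()) - S^`() * (n`!%:R^-1)%:P * ('X^n * R) * P); first by ring.
by rewrite S_P exprS; ring.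
Qed.

Lemma Y_coef0 : (E n.+1 * P)`_0 = 1.
Proof.
have S0 : S`_0 = 0.
  by rewrite /S coef_sum big1 // => m _; rewrite coefZ coefXn mulr0.
rewrite /P !coef0M !coefB !coefZ !coef1 !coefX /= mulr0 subr0 !mulr1 /E coef_sum.
rewrite big_ord_recl /= coefZ expr0 coef1 /= mulr1 fact0 invr1 big1 ?addr0 // => i _.
by rewrite coefZ exprS coef0M S0 mul0r mulr0.
Qed.

(** By [deriv_Y] the coefficients satisfy Newton's identities with the power sums [psum], which
    determine them from the constant term 1. [Lcoef_newton] is the same recurrence. *)
Lemma Y_coef i : (i <= n)%N -> (E n.+1 * P)`_i = (Lcoef D i)%:~R.
Proof.
elim/ltn_ind: i => -[_ _|i IHi li]; first by rewrite Y_coef0 Lcoef0.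
have i0 : i.+1%:R != 0 :> rat by rewrite pnatr_eq0.
apply: (mulfI i0).
have -> : i.+1%:R * (Lcoef D i.+1)%:~R = (i.+1%:R * Lcoef D i.+1)%:~R :> rat.
  by rewrite rmorphM /= rmorph_nat.
rewrite Lcoef_newton rmorph_sum /=.
have [R YE] := deriv_Y; have := congr1 (fun p : {poly rat} => p`_i) YE.
rewrite /= coef_deriv coefD coefXnM li addr0 mulr_natl => ->.
rewrite coefM big_add1 /= big_mkord; apply: eq_bigr => j _.
have jn : (j < n.+1)%N by apply: leq_trans (ltn_ord j) _; exact: leqW.
rewrite /sigma coef_sum (bigD1 (inord j)) //= coefZ coefXn inordK // eqxx mulr1 big1 ?addr0.
  rewrite rmorphM /= subSS IHi //; first by rewrite ltnS leq_subr.
  by apply: leq_trans (ltnW li); rewrite leq_subr.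
move=> l lj; rewrite coefZ coefXn; case: eqP => [jl|_]; last by rewrite mulr0.
by case/eqP: lj; apply: val_inj; rewrite /= inordK.
Qed.

End Trunc.

Lemma dvd_Xn_coef (K : fieldType) (p : {poly K}) n : (forall i, (i < n)%N -> p`_i = 0) -> 'X^n %| p.
Proof.
move=> p0; rewrite -[p]coefK poly_def.
apply: (big_ind (fun p => 'X^n %| p)) => [|r t|i _]; first exact: dvdp0.
  exact: dvdp_add.
case: (ltnP i n) => li; first by rewrite p0 // scale0r dvdp0.
by rewrite -mul_polyC dvdp_mull // dvdp_exp2l.
Qed.

Definition Lpoly (D : {poly F}) g : {poly int} := \poly_(i < (2 * g).+1) Lcoef D i.

Lemma zeta_numerator_Lpoly (D : {poly F}) g : D \is monic -> deg D = (2 * g).+1 ->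
  zeta_numerator D (Lpoly D g).
Proof.
move=> Dm dD [|n]; first by rewrite expr0 dvd1p.
(* An odd degree excludes squares, so [Lcoef_vanish] cuts the L-series off after degree 2 g. *)
have nsq : ~~ issq D.
  apply/negP => /(issqP Dm)[l lm DE]; have := congr1 odd dD.
  by rewrite DE degX // oddM /= mul2n odd_double.
have coefL i : (Lpoly D g)`_i = Lcoef D i.
  rewrite coef_poly; case: ltnP => // gi; rewrite (Lcoef_vanish F_odd q4 exists_ext) // dD //.
apply: dvd_Xn_coef => i li.
by rewrite coefB coef_map /= coefL -mulrA Y_coef ?subrr.
Qed.

Lemma curve_polyE (D : {poly F}) g : D \is monic -> deg D = (2 * g).+1 ->
  curve_poly D = Lpoly D g.
Proof.
move=> Dm dD; apply: xget_subset1; first exact: zeta_numerator_Lpoly.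
move=> p r pz rz; apply/polyP => i.
have := pz i.+1; have := rz i.+1; set Z := _ * _ * _ => h1 h2.
have : 'X^(i.+1) %| (map_poly intr p - map_poly intr r : {poly rat}).
  by have := dvdp_sub h1 h2; rewrite opprB addrC addrA subrK.
move=> /dvdpP[R RE]; have := congr1 (fun p : {poly rat} => p`_i) RE.
rewrite /= coefB !coef_map coefMXn ltnSn /= => /eqP; rewrite subr_eq0 => /eqP.
exact: intr_inj.
Qed.

End Zeta.

(** * A sieve identity and squarefree polynomials *)

Section Sieve.

Variables (R : fieldType) (F : finFieldType).
Local Notation q := #|F|.
Implicit Types (f l p : {poly F}) (s : seq {poly F}).

(* The coefficient of 'X^j in the power series P / (1 - q 'X). *)
Definition geom_conv (P : {poly R}) j : R := \sum_(k < j.+1) P`_k * q%:R ^+ (j - k).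

Lemma geom_convD P P' j : geom_conv (P + P') j = geom_conv P j + geom_conv P' j.
Proof. by rewrite /geom_conv -big_split; apply: eq_bigr => k _; rewrite coefD mulrDl. Qed.

Lemma geom_convZ c P j : geom_conv (c *: P) j = c * geom_conv P j.
Proof. by rewrite /geom_conv mulr_sumr; apply: eq_bigr => k _; rewrite coefZ mulrA. Qed.

Lemma geom_convXn d P j : geom_conv ('X^d * P) j = if (d <= j)%N then geom_conv P (j - d) else 0.
Proof.
rewrite /geom_conv; case: leqP => dj; last first.
  by rewrite big1 // => k _; rewrite coefXnM (leq_ltn_trans _ dj) ?mul0r // -ltnS.
have [i jE] : exists i, j = (d + i)%N by exists (j - d)%N; rewrite subnKC.
rewrite jE addKn -addnS big_split_ord /= big1 ?add0r; last first.
  by move=> k _; rewrite coefXnM ltn_ord mul0r.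
by apply: eq_bigr => k _; rewrite coefXnM ltnNge leq_addr /= addKn subnDl.
Qed.

Lemma geom_conv1 j : geom_conv 1 j = q%:R ^+ j.
Proof.
rewrite /geom_conv big_ord_recl coef1 /= mul1r subn0 big1 ?addr0 // => k _.
by rewrite coef1 mul0r.
Qed.

Definition sieve_poly (v : {poly F} -> R) s : {poly R} := \prod_(p <- s) (1 + v p *: 'X^(deg p)).

(** The left side sums the multiplicative function equal to 1 + v p on all positive powers of p in
    s, and to 1 on powers of other primes. Its generating series is the zeta series 1/(1 - q u)
    times the factors 1 + v p u^(deg p), which are inserted one prime at a time. *)
Lemma sieve (v : {poly F} -> R) s j : uniq s -> all (@mirr F) s ->
  \sum_(l <- mon F j) \prod_(p <- s | p %| l) (1 + v p) = geom_conv (sieve_poly v s) j.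
Proof.
elim: s j => [|p s IHs] j /=.
  move=> _ _; under eq_bigr do rewrite big_nil.
  by rewrite /sieve_poly big_nil geom_conv1 big_const_seq count_predT size_mon iter_addr_0 natrX.
move=> /andP[ps us] /andP[pi si].
have pm := mirr_monic pi.
rewrite /sieve_poly big_cons -/(sieve_poly v s) mulrDl mul1r -scalerAl geom_convD geom_convZ geom_convXn -!IHs //.
transitivity (\sum_(l <- mon F j) (\prod_(p' <- s | p' %| l) (1 + v p') +
    if p %| l then v p * \prod_(p' <- s | p' %| l) (1 + v p') else 0)).
  apply: eq_bigr => l _; rewrite big_cons; case: ifP => _; last by rewrite addr0.
  by rewrite mulrDl mul1r.
rewrite big_split /=; congr (_ + _).
rewrite -big_mkcond /= sum_mon_dvd // -/(deg p); case: ifP => _; last by rewrite mulr0.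
rewrite mulr_sumr; apply: eq_bigr => e _; congr (_ * _).
rewrite [LHS]big_seq_cond [RHS]big_seq_cond; apply: eq_bigl => p'.
case p's: (p' \in s) => //=; have pi' := allP si _ p's.
rewrite mirr_dvdM //; case p'p: (p' %| p) => //=.
by move: ps; rewrite -(mirr_dvd_eq pi' pi p'p) p's.
Qed.

Definition prime_divs f := [seq p <- irr F (deg f) | p %| f].

Lemma mem_prime_divs f p : f \is monic -> (p \in prime_divs f) = mirr p && (p %| f).
Proof.
move=> fm; rewrite mem_filter mem_irr; apply/and3P/andP => [[-> ->]//|[pi pf]].
by split=> //; have := dvdp_leq (monic_neq0 fm) pf; rewrite (size_deg fm).
Qed.

Lemma prime_divs_uniq f : uniq (prime_divs f).
Proof. exact/filter_uniq/irr_uniq. Qed.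

Lemma prime_divs_mirr f : all (@mirr F) (prime_divs f).
Proof. by apply/allP => p; rewrite mem_filter mem_irr => /and3P[_ ->]. Qed.

Lemma coprime_prime_divs f l : f \is monic ->
  (coprimep f l)%:R = \prod_(p <- prime_divs f | p %| l) (1 + -1) :> R.
Proof.
move=> fm; case: (coprimep_mirr l (monic_neq0 fm)) => [H|H].
  rewrite big_seq_cond big1 // => p; rewrite mem_prime_divs // => /andP[/andP[pi pf] pl].
  by have := H p pi pf; rewrite pl.
have [[p pp pl]|nh] := altP (@hasP _ (fun p => p %| l) (prime_divs f)).
  by rewrite big_mkcond (bigD1_seq p) ?prime_divs_uniq //= pl subrr mul0r.
case: H => p pi pf; apply: contra nh => pl; apply/hasP; exists p => //.
by rewrite mem_prime_divs // pi.
Qed.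

Lemma coprime_count f a : f \is monic ->
  \sum_(l <- mon F a) (coprimep f l)%:R = geom_conv (sieve_poly (fun=> -1) (prime_divs f)) a.
Proof.
move=> fm; rewrite -sieve ?prime_divs_uniq ?prime_divs_mirr //.
by apply: eq_bigr => l _; rewrite coprime_prime_divs.
Qed.

End Sieve.

(** * Unique decomposition into a square and a squarefree part *)

Section Squarefree.

Variable F : finFieldType.
Local Notation q := #|F|.
Implicit Types (f l p B D : {poly F}).

Definition sqf D := all (fun p => ~~ (p ^+ 2 %| D)) (irr F (deg D)).

Lemma sqfP D : D \is monic -> reflect (forall p, mirr p -> (vP p D <= 1)%N) (sqf D).
Proof.
move=> Dm; have D0 := monic_neq0 Dm; apply: (iffP allP) => [H p pi|H p].
  have [pD|pD] := boolP (p %| D); last by rewrite vP0.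
  have := H p; rewrite mem_irr pi -(size_deg Dm) (dvdp_leq D0 pD) (dvd_vP _ pi D0).
  by rewrite -ltnNge ltnS; apply.
by rewrite mem_irr => /andP[pi _]; rewrite (dvd_vP _ pi D0) -ltnNge ltnS H.
Qed.

Lemma square_freeP D : D \is monic -> square_free D <-> sqf D.
Proof.
move=> Dm; have D0 := monic_neq0 Dm; split=> [H|/(sqfP Dm) H d dD].
  apply/allP => p; rewrite mem_irr => /andP[pi _]; apply/negP => /H sp.
  by have := mirr_size pi; rewrite sp.
apply/eqP; rewrite eqn_leq; apply/andP; split.
  rewrite leqNgt; apply/negP => /mirr_dvd_exists[p pi pd'].
  have : p ^+ 2 %| D by apply: dvdp_trans dD; exact: dvdp_exp2r.
  by rewrite (dvd_vP _ pi D0) ltnNge H.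
rewrite lt0n size_poly_eq0; apply: contraTneq dD => ->.
by rewrite expr0n /= dvd0p monic_neq0.
Qed.

Lemma vP_prod p (s : seq {poly F}) (e : {poly F} -> nat) : mirr p -> uniq s -> all (@mirr F) s ->
  vP p (\prod_(p' <- s) p' ^+ e p') = if p \in s then e p else 0%N.
Proof.
move=> pi; elim: s => [|p' s IHs] /=.
  by rewrite big_nil vP0 ?oner_eq0 // dvdp1 gtn_eqF // mirr_size.
move=> /andP[ps us] /andP[pi' si]; have p'0 := mirr_neq0 pi'.
have s0 : \prod_(p' <- s) p' ^+ e p' != 0.
  rewrite prodf_seq_neq0; apply/allP => r /(allP si) ri.
  by rewrite expf_neq0 // mirr_neq0.
have vX n : vP p (p' ^+ n) = (n * (p == p'))%N.
  elim: n => [|n IHn]; first by rewrite expr0 vP0 ?oner_eq0 // dvdp1 gtn_eqF // mirr_size.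
  by rewrite exprS vPM ?expf_neq0 // IHn vP_irr // mulSn.
rewrite big_cons vPM ?expf_neq0 // vX IHs // inE; case: eqVneq => [pp|_] /=.
  by rewrite muln1 pp (negbTE ps) addn0.
by rewrite muln0.
Qed.

Lemma eq_vP f l : f \is monic -> l \is monic -> (forall p, mirr p -> vP p f = vP p l) -> f = l.
Proof.
move=> fm lm H; rewrite (@prod_irr_vP _ f (deg f + deg l)) ?(size_deg fm) ?ltnS ?leq_addr //.
rewrite [RHS](@prod_irr_vP _ l (deg f + deg l)) ?(size_deg lm) ?ltnS ?leq_addl //.
rewrite [LHS]big_seq [RHS]big_seq; apply: eq_bigr => p; rewrite mem_irr => /andP[pi _].
by rewrite H.
Qed.

Lemma vPX p f n : mirr p -> f \is monic -> vP p (f ^+ n) = (n * vP p f)%N.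
Proof.
move=> pi fm; elim: n => [|n IHn].
  by rewrite expr0 vP0 ?oner_eq0 // dvdp1 gtn_eqF // mirr_size.
by rewrite exprS vPM ?expf_neq0 ?monic_neq0 // IHn mulSn.
Qed.

Definition sqroot B := \prod_(p <- irr F (deg B)) p ^+ (vP p B)./2.
Definition sqfpart B := \prod_(p <- irr F (deg B)) p ^+ odd (vP p B).

Lemma prod_mirr_monic (s : seq {poly F}) (e : {poly F} -> nat) : all (@mirr F) s ->
  \prod_(p <- s) p ^+ e p \is monic.
Proof. by move=> si; rewrite big_seq monic_prod // => p /(allP si)/mirr_monic pm; rewrite monic_exp. Qed.

Lemma irr_mirr n : all (@mirr F) (irr F n).
Proof. by apply/allP => p; rewrite mem_irr => /andP[]. Qed.

Lemma sqdecomp B : B \is monic -> B = sqroot B ^+ 2 * sqfpart B.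
Proof.
move=> Bm; rewrite {1}(@prod_irr_vP _ B (deg B)) ?(size_deg Bm) //.
rewrite /sqroot /sqfpart -prodrXl -big_split /=; apply: eq_bigr => p _.
by rewrite -exprM -exprD muln2 addnC odd_double_half.
Qed.

Lemma sqroot_monic B : sqroot B \is monic.
Proof. exact/prod_mirr_monic/irr_mirr. Qed.

Lemma sqfpart_monic B : sqfpart B \is monic.
Proof. exact/prod_mirr_monic/irr_mirr. Qed.

Lemma sqfpart_sqf B : sqf (sqfpart B).
Proof.
apply/sqfP => [|p pi]; first exact: sqfpart_monic.
by rewrite vP_prod ?irr_uniq ?irr_mirr //; case: ifP => // _; exact: leq_b1.
Qed.

Lemma sqdecomp_uniq D l : D \is monic -> l \is monic -> sqf D ->
  l = sqroot (l ^+ 2 * D).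
Proof.
move=> Dm lm /(sqfP Dm) sD; apply: eq_vP => //; first exact: sqroot_monic.
move=> p pi; rewrite vP_prod ?irr_uniq ?irr_mirr //.
have lD0 : l ^+ 2 * D \is monic by rewrite monicMl // monic_exp.
have vE : vP p (l ^+ 2 * D) = (2 * vP p l + vP p D)%N.
  by rewrite vPM ?expf_neq0 ?monic_neq0 // vPX.
have half : (vP p (l ^+ 2 * D))./2 = vP p l.
  rewrite vE; have := sD p pi; case: (vP p D) => [|[]] // _.
    by rewrite addn0 mul2n doubleK.
  by rewrite addnC mul2n (half_bit_double _ true).
rewrite mem_irr pi /=; case: leqP => // ps; rewrite -half (vP0 pi (monic_neq0 lD0)) //.
apply/negP => plD; have := dvdp_leq (monic_neq0 lD0) plD.
by rewrite (size_deg lD0) leqNgt ps.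
Qed.

Lemma sum_sqdecomp (V : nmodType) n (G : {poly F} -> V) :
  \sum_(B <- mon F n) G B =
  \sum_(a < n./2.+1) \sum_(l <- mon F a) \sum_(D <- mon F (n - 2 * a) | sqf D) G (l ^+ 2 * D).
Proof.
transitivity (\sum_(B <- mon F n) \sum_(a < n./2.+1) \sum_(l <- mon F a | (l ^+ 2 %| B) && sqf (B %/ l ^+ 2)) G B).
  rewrite [LHS]big_seq [RHS]big_seq; apply: eq_bigr => B Bn; have Bm := mon_monic Bn.
  have lm := sqroot_monic B.
  have dB := deg_mon Bn; have := congr1 (@deg F) (sqdecomp Bm).
  rewrite degM ?monic_exp ?sqfpart_monic // degX // dB => nE.
  have al : (deg (sqroot B) < n./2.+1)%N by rewrite ltnS; lia.
  have u l : l \is monic -> (l ^+ 2 %| B) && sqf (B %/ l ^+ 2) = (l == sqroot B).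
    move=> lm'; apply/andP/eqP => [[lB]|->].
      have := divpK lB; rewrite mulrC => BE sB.
      have Dm : B %/ l ^+ 2 \is monic by move: Bm; rewrite -{1}BE monicMl // monic_exp.
      by rewrite -BE; exact: sqdecomp_uniq.
    rewrite [X in X %/ _](sqdecomp Bm).
    rewrite [X in _ %| X](sqdecomp Bm) dvdp_mulr //; split=> //.
    by rewrite mulKp ?expf_neq0 ?monic_neq0 //; exact: sqfpart_sqf.
  rewrite (bigD1 (Ordinal al)) //= [X in _ + X]big1 ?addr0.
    rewrite big_mkcond (bigD1_seq (sqroot B)) ?mon_uniq ?monic_in_mon //=.
    rewrite u // eqxx /= big1_seq ?addr0 // => l /andP[ln lmn].
    by rewrite u ?(mon_monic lmn) // (negbTE ln).
  move=> a aE; rewrite big_seq_cond big_pred0 // => l; apply/negbTE/negP => /andP[la].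
  rewrite u ?(mon_monic la) // => /eqP lE; case/eqP: aE; apply: val_inj => /=.
  by rewrite -lE (deg_mon la).
rewrite exchange_big /=; apply: eq_bigr => a _.
under eq_bigr do rewrite big_mkcond.
rewrite exchange_big /= [LHS]big_seq [RHS]big_seq; apply: eq_bigr => l la.
have lm := mon_monic la.
have an : (2 * a <= n)%N by have := ltn_ord a; rewrite ltnS; lia.
have l2m : l ^+ 2 \is monic by rewrite monic_exp.
transitivity (\sum_(B <- mon F n | l ^+ 2 %| B) if sqf (B %/ l ^+ 2) then G B else 0).
  by rewrite [RHS]big_mkcond; apply: eq_bigr => B _; case: (_ %| _).
rewrite sum_mon_dvd // -/(deg _) degX // (deg_mon la) an [RHS]big_mkcond /=.
by apply: eq_bigr => D _; rewrite mulrC mulpK ?monic_neq0 // mulrC.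
Qed.

End Squarefree.

(** * Character sums over squarefree polynomials *)

Section EvenSums.

Lemma sum_even (V : nmodType) n (G : nat -> V) :
  \sum_(k < n.+1) (if (2 %| k)%N then G (k %/ 2)%N else 0) = \sum_(a < n./2.+1) G a.
Proof.
elim: n => [|n IHn]; first by rewrite !big_ord1.
rewrite big_ord_recr IHn /= dvdn2 /= negbK; case: (boolP (odd n)) => on.
  rewrite uphalf_half on add1n [RHS]big_ord_recr /= divn2 /=.
  by rewrite uphalf_half on add1n.
by rewrite uphalf_half (negbTE on) add0n addr0.
Qed.

Lemma prod_ge_1sub (R : realFieldType) (I : eqType) (s : seq I) (x : I -> R) :
  (forall i, i \in s -> 0 <= x i <= 1) ->
  1 - \sum_(i <- s) x i <= \prod_(i <- s) (1 - x i) <= 1.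
Proof.
elim: s => [|i s IHs] xs; first by rewrite !big_nil subr0 lexx.
have /andP[h1 h2] : 1 - \sum_(i <- s) x i <= \prod_(i <- s) (1 - x i) <= 1.
  by apply: IHs => j js; apply: xs; rewrite inE js orbT.
have /andP[x0 x1] := xs i (mem_head _ _).
have p0 : 0 <= \prod_(i <- s) (1 - x i).
  by rewrite big_seq prodr_ge0 // => j js; rewrite subr_ge0; have /andP[] := xs j (mem_behead (s := i :: s) js).
by rewrite !big_cons; apply/andP; split; nra.
Qed.

Definition nnpoly (R : realFieldType) (p : {poly R}) := forall k, 0 <= p`_k.

Lemma nnpolyM (R : realFieldType) (p r : {poly R}) : nnpoly p -> nnpoly r -> nnpoly (p * r).
Proof. by move=> p0 r0 k; rewrite coefM sumr_ge0 // => i _; rewrite mulr_ge0. Qed.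

Lemma nnpoly1 (R : realFieldType) : nnpoly (1 : {poly R}).
Proof. by move=> k; rewrite coef1 ler0n. Qed.

End EvenSums.

Lemma coef_eq_modXn (K : fieldType) (p r : {poly K}) n :
  (forall i, (i < n)%N -> p`_i = r`_i) -> exists t, p = r + 'X^n * t.
Proof.
move=> pr; have /dvdpP[t tE] : 'X^n %| p - r.
  by apply: dvd_Xn_coef => i li; rewrite coefB pr // subrr.
by exists t; rewrite mulrC -tE addrC subrK.
Qed.

(** * From complete character sums to sums over squarefree polynomials *)

Section Twisted.

Variables (R : realFieldType) (F : finFieldType).
Hypothesis q4 : #|F| = 1 %[mod 4].
Local Notation q := #|F|.
Local Notation Q := (q%:R : R).
Implicit Types (p B D : {poly F}).

Lemma q_ge5 : (5 <= q)%N.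
Proof.
rewrite (divn_eq q 4) q4 modn_small //; have := finNzRing_gt1 F.
rewrite {1}(divn_eq q 4) q4 modn_small //; case: (q %/ 4)%N => // n _.
by rewrite mulSn addnC addnA leq_addr.
Qed.

Lemma Q_ge5 : 5 <= Q.
Proof. by rewrite (ler_nat _ 5) q_ge5. Qed.

Lemma Q_gt0 : 0 < Q.
Proof. by apply: lt_le_trans Q_ge5; lra. Qed.

Variable f : {poly F}.
Hypothesis fm : f \is monic.
Local Notation m := (deg f).

Definition charsum j : R := \sum_(B <- mon F j) (chi B f)%:~R.
Definition sqf_charsum j : R := \sum_(D <- mon F j | sqf D) (chi D f)%:~R.
(** The product of 1 - 'X^(deg p) over the primes p dividing f: inclusion-exclusion for the
    condition of being prime to f. *)
Definition Apoly : {poly R} := sieve_poly (fun=> -1) (prime_divs f).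

Lemma chi_sq l : (chi l f * chi l f)%:~R = (coprimep f l)%:R :> R.
Proof.
have := chi_eq0 l fm; case: coprimep => /= [/negbT c0|/eqP->]; last by rewrite mulr0.
by rewrite pm1_sqr // chi_pm1.
Qed.

Lemma charsum_conv n : charsum n = \sum_(a < n./2.+1) geom_conv F Apoly a * sqf_charsum (n - 2 * a).
Proof.
rewrite /charsum sum_sqdecomp; apply: eq_bigr => a _.
rewrite -coprime_count // mulr_suml; apply: eq_bigr => l _.
rewrite mulr_sumr; apply: eq_bigr => D _.
by rewrite -chi_sq chiMl ?expr2 ?(F_odd q4) // chiMl ?(F_odd q4) // !rmorphM.
Qed.

Lemma norm_charsum j : `|charsum j| <= Q ^+ j.
Proof.
apply: le_trans (ler_norm_sum _ _ _) _.
apply: le_trans (_ : \sum_(B <- mon F j) 1 <= _).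
  apply: ler_sum => B _; have := chi_pm1 B f.
  by case/or3P=> /eqP->; rewrite ?mulr0z ?mulr1z ?mulrN1z ?normrN ?normr0 ?normr1 ?ler01.
by rewrite big_const_seq count_predT size_mon iter_addr_0 natrX.
Qed.

Lemma geom_convS (P : {poly R}) j : geom_conv F P j.+1 = Q * geom_conv F P j + P`_j.+1.
Proof.
rewrite /geom_conv big_ord_recr /= subnn mulr1; congr (_ + _).
rewrite mulr_sumr; apply: eq_bigr => k _.
by rewrite mulrCA -exprS subSn // -ltnS.
Qed.

Variable M : nat.
(* An inverse of Apoly modulo 'X^M. *)
Definition Tpoly : {poly R} := \prod_(p <- prime_divs f) \sum_(i < M) 'X^(deg p * i).

Lemma sum_Xmul (x : {poly R}) : (\sum_(i < M) x ^+ i) * (1 - x) = 1 - x ^+ M.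
Proof. by rewrite mulrC -[1 - x]opprB mulNr -subrX1 opprB. Qed.

Lemma TA : Tpoly * Apoly = \prod_(p <- prime_divs f) (1 - 'X^(deg p * M)).
Proof.
rewrite /Tpoly /Apoly /sieve_poly -big_split /=; apply: eq_bigr => p _.
rewrite scaleN1r; under eq_bigr do rewrite exprM.
by rewrite sum_Xmul exprM.
Qed.

Lemma TA_mod : exists r, Tpoly * Apoly = 1 + 'X^M * r.
Proof.
rewrite TA; have := prime_divs_mirr f; elim: (prime_divs f) => [|p s IHs] /= si.
  by rewrite big_nil; exists 0; rewrite mulr0 addr0.
case/andP: si => pi /IHs[r rE]; rewrite big_cons rE.
have -> : 'X^(deg p * M) = 'X^M * 'X^(deg p * M - M) :> {poly R}.
  by rewrite -exprD subnKC // leq_pmull // deg_gt0.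
by exists (r - 'X^(deg p * M - M) * (1 + 'X^M * r)); ring.
Qed.

(* The coefficients of (1 - q 'X^2) \sum_j charsum j 'X^j. *)
Definition bdiff j : R := charsum j - (if (1 < j)%N then Q * charsum (j - 2) else 0).

(** With B and H the series of [charsum] and [sqf_charsum], the decomposition l^2 D says B(u) =
    A(u^2) H(u) / (1 - q u^2). Hence H(u) = A(u^2)^(-1) (1 - q u^2) B(u). [Tpoly] inverts A modulo
    'X^M, that is to precision 2 M > n after the substitution u^2. *)
Lemma sqf_charsum_conv n : (n < 2 * M)%N -> sqf_charsum n = \sum_(c < n./2.+1) Tpoly`_c * bdiff (n - 2 * c).
Proof.
move=> nM.
pose H := \poly_(i < n.+1) sqf_charsum i; pose B := \poly_(i < n.+1) charsum i.
pose E := \poly_(i < n.+1) geom_conv F Apoly i.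
have comp2 (P : {poly R}) k : (P \Po 'X^2)`_k = if (2 %| k)%N then P`_(k %/ 2) else 0.
  by rewrite coef_comp_poly_Xn.
have conv2 (P P' : {poly R}) k : ((P \Po 'X^2) * P')`_k = \sum_(a < k./2.+1) P`_a * P'`_(k - 2 * a).
  rewrite coefM -(sum_even _ (fun a => P`_a * P'`_(k - 2 * a))); apply: eq_bigr => i _.
  by rewrite comp2; case: ifP => [/divnK iE|_]; rewrite ?mul0r // mulnC iE.
have [r1 BE] : exists r, B = (E \Po 'X^2) * H + 'X^(n.+1) * r.
  apply: coef_eq_modXn => i li; rewrite conv2 coef_poly li charsum_conv.
  apply: eq_bigr => a _; have := ltn_ord a => ai.
  have an : (a < n.+1)%N by lia.
  by rewrite !coef_poly an (leq_ltn_trans (leq_subr _ _) li).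
have [r2 EE] : exists r, E * (1 - Q *: 'X) = Apoly + 'X^(n.+1) * r.
  apply: coef_eq_modXn => i li; rewrite mulrBr mulr1 -scalerAr coefB coefZ coefMX coef_poly li.
  case: i li => [|i] li /=.
    by rewrite mulr0 subr0 /geom_conv big_ord1 subnn expr0 mulr1.
  by rewrite coef_poly (ltnW li) geom_convS; ring.
have [r3 TAE] := TA_mod.
have C2 (P P' : {poly R}) : P = P' -> P \Po 'X^2 = P' \Po 'X^2 by move->.
have comp1 : 1 \Po 'X^2 = 1 :> {poly R} by rewrite -polyC1 comp_polyC.
have := C2 _ _ EE; rewrite comp_polyM comp_polyD comp_polyB comp_polyZ comp_polyM comp_Xn_poly comp_polyX comp1.
have := C2 _ _ TAE; rewrite comp_polyM comp_polyD comp_polyM comp_Xn_poly comp1.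
set T2 := Tpoly \Po _; set A2 := Apoly \Po _; set E2 := E \Po _ in BE *; set R2 := r2 \Po _; set R3 := r3 \Po _.
move=> TA2 EA2.
have X2M : ('X^2) ^+ M = 'X^(n.+1) * 'X^(2 * M - n.+1) :> {poly R}.
  by rewrite -exprM -exprD subnKC.
have X2n : ('X^2) ^+ n.+1 = 'X^(n.+1) * 'X^(n.+1) :> {poly R}.
  by rewrite -exprM mul2n -addnn exprD.
have HE : H = T2 * ((1 - Q *: 'X^2) * B) + 'X^(n.+1) *
   (- T2 * (1 - Q *: 'X^2) * r1 - 'X^(2 * M - n.+1) * R3 * H - T2 * 'X^(n.+1) * R2 * H).
  rewrite X2M in TA2; rewrite X2n in EA2.
  rewrite BE.
  transitivity ((1 - T2 * (E2 * (1 - Q *: 'X^2)) + 'X^(n.+1) * 'X^(2 * M - n.+1) * R3 + T2 * ('X^(n.+1) * 'X^(n.+1) * R2)) * H + T2 * ((1 - Q *: 'X^2) * (E2 * H + 'X^(n.+1) * r1)) + 'X^(n.+1) *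
   (- T2 * (1 - Q *: 'X^2) * r1 - 'X^(2 * M - n.+1) * R3 * H - T2 * 'X^(n.+1) * R2 * H)); last first.
    rewrite EA2 mulrDr TA2; ring.
  ring.
have := congr1 (fun P : {poly R} => P`_n) HE.
rewrite /= coefD coefXnM ltnSn addr0 coef_poly ltnSn => ->.
rewrite /T2 conv2; apply: eq_bigr => c _; congr (_ * _).
have cn : (n - 2 * c < n.+1)%N by rewrite ltnS leq_subr.
rewrite mulrBl mul1r -scalerAl coefB coefZ coefXnM coef_poly cn /bdiff; congr (_ - _).
case: (ltnP (n - 2 * c) 2) => c2; first by rewrite mulr0.
by rewrite coef_poly (leq_ltn_trans (leq_subr _ _) cn).
Qed.

End Twisted.

(** * The sum over squarefree D for one fixed f *)

Section Estimate.

Variables (R : realFieldType) (F : finFieldType).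
Hypothesis q4 : #|F| = 1 %[mod 4].
Local Notation q := #|F|.
Local Notation Q := (q%:R : R).
Implicit Types (p B D l : {poly F}).

Let Q5 := Q_ge5 R q4.
Let Q0 := Q_gt0 R q4.
Let Q1 : 1 <= Q. Proof. by have := Q5; lra. Qed.

Let QB a b : (b <= a)%N -> Q ^+ (a - b) = Q ^+ a * Q^-1 ^+ b.
Proof. by move=> ba; rewrite exprVn expfB_cond // gt_eqF. Qed.

Lemma sieve_poly_size (v : {poly F} -> R) s : (size (sieve_poly v s) <= (\sum_(p <- s) deg p).+1)%N.
Proof.
elim: s => [|p s IHs]; first by rewrite /sieve_poly !big_nil size_poly1.
rewrite /sieve_poly !big_cons -/(sieve_poly v s).
apply: leq_trans (size_polyMleq _ _) _.
have : (size (1 + v p *: 'X^(deg p))%R <= (deg p).+1)%N.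
  apply: leq_trans (size_polyD _ _) _; rewrite geq_max size_poly1 /=.
  by apply: leq_trans (size_scale_leq _ _) _; rewrite size_polyXn.
move=> sA; rewrite -subn1; apply: leq_trans (leq_sub2r 1 (leq_add sA IHs)) _.
by rewrite addSn addnS subn1.
Qed.

Lemma geom_conv_horner (P : {poly R}) j : (size P <= j.+1)%N -> geom_conv F P j = Q ^+ j * P.[Q^-1].
Proof.
move=> sP; rewrite (horner_coef_wide _ sP) mulr_sumr; apply: eq_bigr => k _.
by rewrite mulrCA -QB // -ltnS.
Qed.

Variable f : {poly F}.
Hypothesis fm : f \is monic.
Local Notation m := (deg f).

Lemma sum_deg_prime_divs : (\sum_(p <- prime_divs f) deg p <= m)%N.
Proof.
rewrite [X in (_ <= X)%N](deg_vP fm (leqnn _)) /prime_divs big_filter big_mkcond.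
rewrite big_seq [X in (_ <= X)%N]big_seq; apply: leq_sum => p; rewrite mem_irr => /andP[pi _].
case: ifP => // pf; rewrite leq_pmull // -dvd_vP ?expr1 //; exact: monic_neq0.
Qed.

Lemma size_prime_divs : (size (prime_divs f) <= m)%N.
Proof.
apply: leq_trans sum_deg_prime_divs; rewrite -sum1_size big_seq [X in (_ <= X)%N]big_seq.
by apply: leq_sum => p /(allP (prime_divs_mirr f)); exact: deg_gt0.
Qed.

(** This is phi(f)/|f|, with phi the Euler function of F[x]. *)
Definition coprime_density : R := (Apoly R f).[Q^-1].

Lemma Apoly_horner x : (Apoly R f).[x] = \prod_(p <- prime_divs f) (1 - x ^+ deg p).
Proof.
rewrite /Apoly /sieve_poly horner_prod; apply: eq_bigr => p _.
by rewrite !hornerE mulN1r.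
Qed.

Lemma powV01 (x : R) k : 1 <= x -> 0 <= x^-1 ^+ k <= 1.
Proof.
move=> x1; have x0 : 0 < x by lra.
by rewrite exprn_ge0 ?exprn_ile1 // ?invr_ge0 ?invf_le1 // ltW.
Qed.

Lemma coprime_density01 : 0 <= coprime_density <= 1.
Proof.
rewrite /coprime_density Apoly_horner big_seq; apply/andP; split.
  apply: prodr_ge0 => p _; rewrite subr_ge0; by have /andP[] := powV01 (deg p) Q1.
apply: prodr_ile1 => p _; have /andP[h0 h1] := powV01 (deg p) Q1.
by rewrite subr_ge0 h1 /= gerBl.
Qed.

Lemma charsum_nonsq j : ~~ issq f -> (m <= j)%N -> charsum R f j = 0.
Proof.
move=> nsq mj; rewrite /charsum -rmorph_sum /=.
by rewrite (sum_chi_nonsq (F_odd q4) fm nsq mj).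
Qed.

Lemma charsum_sq j : issq f -> (m <= j)%N -> charsum R f j = Q ^+ j * coprime_density.
Proof.
move=> /(issqP fm)[l lm fE] mj; rewrite /coprime_density -geom_conv_horner; last first.
  by apply: leq_trans (sieve_poly_size _ _) _; rewrite ltnS; apply: leq_trans mj; exact: sum_deg_prime_divs.
rewrite -coprime_count //; apply: eq_bigr => B _.
by rewrite fE chi_sqr // coprimep_pexpl //; case: coprimep.
Qed.

(** The constant for which [bdiff] is exactly [beta * Q ^+ j] once j >= deg f + 2. *)
Definition beta : R := if issq f then coprime_density * (1 - Q^-1) else 0.

Lemma QV01 : 0 <= Q^-1 <= 1.
Proof. by have := powV01 1 Q1; rewrite expr1. Qed.

Lemma beta01 : 0 <= beta <= 1.
Proof.
rewrite /beta; case: ifP => _; last by rewrite lexx ler01.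
by have /andP[k0 k1] := coprime_density01; have /andP[v0 v1] := QV01; apply/andP; split; nra.
Qed.

Lemma bdiff_big j : (m.+2 <= j)%N -> bdiff R f j = beta * Q ^+ j.
Proof.
move=> mj; rewrite /bdiff /beta; have -> : (1 < j)%N by lia.
have mj2 : (m <= j - 2)%N by lia.
have mj' : (m <= j)%N by lia.
case: (boolP (issq f)) => sq; last by rewrite !charsum_nonsq // mulr0 subrr mul0r.
rewrite !charsum_sq // (_ : j = (j - 2) + 2)%N; last by lia.
rewrite addnK exprD; have := gt_eqF Q0 => Qn; field.
by rewrite Qn.
Qed.

Lemma bdiff_le j : `|bdiff R f j| <= 2 * Q ^+ j.
Proof.
rewrite /bdiff; have := norm_charsum R f j => h1.
have Qj : 0 <= Q ^+ j by rewrite exprn_ge0 // ltW.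
case: ifP => j2; last by rewrite subr0; lra.
apply: le_trans (ler_normB _ _) _; rewrite normrM (gtr0_norm Q0).
have := norm_charsum R f (j - 2) => h2.
have : Q * `|charsum R f (j - 2)| <= Q ^+ j.
  apply: le_trans (ler_wpM2l (ltW Q0) h2) _; rewrite -exprS ler_weXn2l //; lia.
lra.
Qed.

(** [sqf_density] is the local density of being prime to f among squarefree polynomials.
    [rankin_weight] is the product of 1/(1 - 2^(-deg p)), the limit of [Tpoly] at 1/2 for large
    M. *)
Definition sqf_density : R := \prod_(p <- prime_divs f) (1 - 1 / (Q ^+ deg p + 1)).
Definition rankin_weight : R := \prod_(p <- prime_divs f) (1 + 1 / (2 ^+ deg p - 1)).

Section WithM.
Variable M : nat.
Local Notation T := (Tpoly R f M).

Lemma Tpoly_ge0 : nnpoly T.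
Proof.
rewrite /Tpoly; apply: (big_ind (@nnpoly R)); [exact: nnpoly1 | exact: nnpolyM|].
by move=> p _ k; rewrite coef_sum sumr_ge0 // => i _; rewrite coefXn ler0n.
Qed.

Lemma Tpoly_horner x : T.[x] = \prod_(p <- prime_divs f) \sum_(i < M) (x ^+ deg p) ^+ i.
Proof.
rewrite /Tpoly horner_prod; apply: eq_bigr => p _; rewrite horner_sum.
by apply: eq_bigr => i _; rewrite hornerXn exprM.
Qed.

Lemma pow2_gt1 d : (0 < d)%N -> 2 <= 2 ^+ d :> R.
Proof. by move=> d0; rewrite -{1}[2]expr1 ler_weXn2l // (ler_nat _ 1 2). Qed.

Lemma Tpoly_half : T.[2^-1] <= rankin_weight.
Proof.
rewrite Tpoly_horner /rankin_weight big_seq [X in _ <= X]big_seq; apply: ler_prod => p pp.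
have pi := allP (prime_divs_mirr f) _ pp; have h := pow2_gt1 (deg_gt0 pi).
set x := _ ^+ deg p; have xE : x = (2 ^+ deg p)^-1 by rewrite /x exprVn.
have x0 : 0 <= x by rewrite xE invr_ge0; lra.
have -> : 1 + 1 / (2 ^+ deg p - 1) = (1 - x)^-1.
  rewrite xE; field; apply/andP; split; lra.
have x1 : 0 < 1 - x by rewrite subr_gt0 xE invf_lt1; lra.
rewrite sumr_ge0 => [|i _]; last by rewrite exprn_ge0.
rewrite -[X in _ <= X]mul1r ler_pdivlMr //= mulrC -[1 - x]opprB mulNr -subrX1 opprB.
by rewrite gerBl exprn_ge0.
Qed.

(** For z = |p| the local identity is (1 - 1/z)/(1 - 1/z^2) = 1 - 1/(z + 1). The remaining product
    corrects the truncation of the geometric series at M. *)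
Lemma coprime_densityT : coprime_density * T.[Q^-1 ^+ 2] = sqf_density * \prod_(p <- prime_divs f) (1 - Q^-1 ^+ (2 * deg p * M)).
Proof.
rewrite /coprime_density Apoly_horner Tpoly_horner /sqf_density -!big_split /= big_seq [RHS]big_seq.
apply: eq_bigr => p pp; have pi := allP (prime_divs_mirr f) _ pp.
have Qd : 5 <= Q ^+ deg p.
  by apply: le_trans Q5 _; rewrite -{1}[Q]expr1 ler_weXn2l // deg_gt0.
set y := (Q^-1 ^+ 2) ^+ deg p.
have yE : y = (Q ^+ deg p)^-1 ^+ 2 by rewrite /y -exprM mulnC exprM exprVn.
have -> : Q^-1 ^+ (2 * deg p * M) = y ^+ M by rewrite /y -!exprM mulnA.
have -> : 1 - y ^+ M = (1 - y) * \sum_(i < M) y ^+ i.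
  by rewrite -[1 - y]opprB mulNr -subrX1 opprB.
rewrite mulrA; congr (_ * _); rewrite yE !exprVn.
move: (Q ^+ deg p) Qd => z z5; field; apply/andP; split; lra.
Qed.

End WithM.

Lemma rankin_weight_ge1 : 1 <= rankin_weight.
Proof.
rewrite /rankin_weight big_seq; apply: (big_ind (fun x => 1 <= x)) => // [x y x1 y1|p pp].
  by nra.
have pi := allP (prime_divs_mirr f) _ pp; have h := pow2_gt1 (deg_gt0 pi).
by rewrite lerDl divr_ge0 //; lra.
Qed.

Lemma sqf_density01 : 0 <= sqf_density <= 1.
Proof.
have h p : 0 <= 1 / (Q ^+ deg p + 1) <= 1.
  have : 0 <= Q ^+ deg p by rewrite exprn_ge0 // ltW.
  move: (Q ^+ _) => z z0; rewrite divr_ge0 /= ?ler_pdivrMr; lra.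
rewrite /sqf_density; apply/andP; split.
  by apply: prodr_ge0 => p _; rewrite subr_ge0; have /andP[] := h p.
by apply: prodr_ile1 => p _; have /andP[h0 h1] := h p; rewrite subr_ge0 h1 gerBl.
Qed.

(** The hypothesis gives q^(2 g - 2 c) <= q^m. If c <= g, then 2^(g - c) >= 1 can be inserted
    freely. If c > g, the loss 2^(c - g) is absorbed by q^(2 (c - g)). *)
Lemma rankin g c : (2 * g <= 2 * c + m)%N ->
  Q ^+ (2 * g).+1 * Q^-1 ^+ (2 * c) <= Q * 2 ^+ g * Q ^+ m * 2^-1 ^+ c.
Proof.
move=> gc; rewrite !exprVn ler_pdivrMr ?exprn_gt0 //.
rewrite mulrAC ler_pdivlMr ?exprn_gt0 // exprS -!mulrA ler_wpM2l ?(ltW Q0) //.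
have [cg|gc'] := leqP c g.
  rewrite mulrC; apply: ler_pM; rewrite ?exprn_ge0 ?(ltW Q0) //.
    by rewrite ler_weXn2l // (ler_nat _ 1 2).
  by rewrite -exprD ler_weXn2l // addnC.
have [e cE] : exists e, c = (g + e)%N by exists (c - g)%N; rewrite subnKC // ltnW.
rewrite cE mulnDr (exprD Q (2 * g) (2 * e)) (exprD 2 g e).
have h2 : (2 : R) ^+ e <= Q ^+ (2 * e).
  rewrite exprM; apply: lerXn2r; rewrite ?nnegrE ?exprn_ge0 ?(ltW Q0) //.
  by move: Q5; rewrite expr2; nra.
have hm : 1 <= Q ^+ m by rewrite exprn_ege1.
have hg : 0 <= Q ^+ (2 * g) by rewrite exprn_ge0 ?(ltW Q0).
have h2g : (0 : R) <= 2 ^+ g by rewrite exprn_ge0.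
have h2e : (0 : R) <= 2 ^+ e by rewrite exprn_ge0.
move: (Q ^+ (2 * g)) (2 ^+ g) (2 ^+ e) (Q ^+ m) (Q ^+ (2 * e)) h2 hm hg h2g h2e => a b d x y h2 hm hg h2g h2e.
have -> : a * (b * d) = (a * b) * d by ring.
have -> : b * (x * (a * y)) = (a * b) * (x * y) by ring.
by rewrite ler_wpM2l ?mulr_ge0 //; nra.
Qed.

Lemma sqf_charsum_estimate g : (m <= g)%N ->
  `|sqf_charsum R f (2 * g).+1 - (if issq f then sqf_density * (1 - Q^-1) * Q ^+ (2 * g).+1 else 0)|
  <= 4 * (Q * 2 ^+ g * Q ^+ m * rankin_weight).
Proof.
(* M > g suffices for [sqf_charsum_conv]; the larger value makes the error of truncating the density
   product at most 1 in [err2]. *)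
move=> mg; set N := (2 * g).+1; pose M := N.+1; pose T := Tpoly R f M.
set X := Q * 2 ^+ g * Q ^+ m; have w1 := rankin_weight_ge1.
have X1 : 1 <= X.
  have h2 : (1 : R) <= 2 ^+ g by rewrite exprn_ege1 // (ler_nat _ 1 2).
  have hm : 1 <= Q ^+ m by rewrite exprn_ege1.
  by rewrite /X !mulr_ege1.
have NE : (N./2 = g)%N by rewrite /N mul2n /= uphalf_double.
have /andP[b0 b1] := beta01.
(* The deviation of [bdiff] from its exact form vanishes for 2 c + m + 2 <= N. Elsewhere the trivial
   bounds 2 and 1 on its two parts give 3 q^(N - 2 c), to which [rankin] applies. The terms c > g
   complete the main term to the full value of T at q^(-2). *)
pose u c : R := (if (c <= g)%N then bdiff R f (N - 2 * c) else 0) - beta * (Q ^+ N * Q^-1 ^+ (2 * c)).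
have uE c : `|u c| <= 3 * X * 2^-1 ^+ c.
  have X0 : 0 <= X * 2^-1 ^+ c by rewrite mulr_ge0 ?exprn_ge0 ?invr_ge0 //; lra.
  rewrite -mulrA /u; have [small|big] := leqP (2 * c + m.+2) N.
    have cg : (c <= g)%N by rewrite /N in small; clear -small; lia.
    rewrite cg bdiff_big; last by clear -small; lia.
    have -> : Q ^+ (N - 2 * c) = Q ^+ N * Q^-1 ^+ (2 * c).
      by rewrite QB // /N; clear -cg; lia.
    by rewrite subrr normr0 mulr_ge0.
  have rk : Q ^+ N * Q^-1 ^+ (2 * c) <= X * 2^-1 ^+ c by apply: rankin; rewrite /N in big; clear -big; lia.
  have y0 : 0 <= Q ^+ N * Q^-1 ^+ (2 * c) by rewrite mulr_ge0 ?exprn_ge0 ?invr_ge0 ?(ltW Q0).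
  have h1 : `|if (c <= g)%N then bdiff R f (N - 2 * c) else 0| <= 2 * (Q ^+ N * Q^-1 ^+ (2 * c)).
    case: leqP => cg; last by rewrite normr0 mulr_ge0.
    apply: le_trans (bdiff_le _) _.
    by rewrite QB // /N; clear -cg; lia.
  apply: le_trans (ler_normB _ _) _; rewrite normrM (ger0_norm b0) (ger0_norm y0).
  move: h1 rk y0; move: `|_| (Q ^+ N * _) (X * _) => a b d; nra.
pose K := (g.+1 + size T)%N.
have TK x : T.[x] = \sum_(c < K) T`_c * x ^+ c by apply: horner_coef_wide; exact: leq_addl.
have convE : sqf_charsum R f N - beta * Q ^+ N * T.[Q^-1 ^+ 2] = \sum_(c < K) T`_c * u c.
  rewrite (@sqf_charsum_conv _ _ q4 _ fm M); last by rewrite /M; clear; lia.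
  rewrite NE TK mulr_sumr.
  have -> : \sum_(c < g.+1) T`_c * bdiff R f (N - 2 * c) =
    \sum_(c < K) T`_c * (if (c <= g)%N then bdiff R f (N - 2 * c) else 0).
    rewrite /K big_split_ord /= [X in _ = _ + X]big1 ?addr0; last first.
      by move=> c _; rewrite leqNgt addSn ltnS leq_addr /= mulr0.
    by apply: eq_bigr => c _; rewrite -ltnS ltn_ord.
  rewrite -sumrB; apply: eq_bigr => c _; rewrite /u mulrBr; congr (_ - _).
  by rewrite -exprM; ring.
have T0 := Tpoly_ge0 M.
have err1 : `|sqf_charsum R f N - beta * Q ^+ N * T.[Q^-1 ^+ 2]| <= 3 * X * rankin_weight.
  rewrite convE; apply: le_trans (ler_norm_sum _ _ _) _.
  apply: le_trans (_ : 3 * X * T.[2^-1] <= _); last first.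
    by rewrite ler_wpM2l ?Tpoly_half //; lra.
  rewrite TK mulr_sumr; apply: ler_sum => c _.
  rewrite normrM (ger0_norm (T0 c)) mulrCA ler_wpM2l //.
have err2 : `|beta * Q ^+ N * T.[Q^-1 ^+ 2] -
     (if issq f then sqf_density * (1 - Q^-1) * Q ^+ N else 0)| <= 1.
  rewrite /beta; case: ifP => _; last by rewrite !mul0r subrr normr0 ler01.
  pose Pi := \prod_(p <- prime_divs f) (1 - Q^-1 ^+ (2 * deg p * M)).
  have -> : coprime_density * (1 - Q^-1) * Q ^+ N * T.[Q^-1 ^+ 2] - sqf_density * (1 - Q^-1) * Q ^+ N =
     sqf_density * (1 - Q^-1) * Q ^+ N * (Pi - 1).
    transitivity ((1 - Q^-1) * Q ^+ N * (coprime_density * T.[Q^-1 ^+ 2]) - sqf_density * (1 - Q^-1) * Q ^+ N); first by ring.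
    by rewrite (coprime_densityT M) -/Pi; ring.
  have /andP[pi1 pi2] : 1 - \sum_(p <- prime_divs f) Q^-1 ^+ (2 * deg p * M) <= Pi <= 1.
    by apply: prod_ge_1sub => p _; exact: powV01.
  have S1 : \sum_(p <- prime_divs f) Q^-1 ^+ (2 * deg p * M) <= m%:R * Q^-1 ^+ (2 * N).
    apply: le_trans (_ : \sum_(p <- prime_divs f) Q^-1 ^+ (2 * N) <= _); last first.
      rewrite big_const_seq count_predT iter_addr_0 -[X in X <= _]mulr_natl; apply: ler_wpM2r.
        by have /andP[] := powV01 (2 * N) Q1.
      by rewrite ler_nat size_prime_divs.
    rewrite big_seq [X in _ <= X]big_seq; apply: ler_sum => p pp.
    have d0 := deg_gt0 (allP (prime_divs_mirr f) _ pp).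
    have /andP[v0 v1] := QV01; apply: ler_wiXn2l => //.
    by rewrite -mulnA leq_mul2l /= /M; apply: leq_trans (leq_pmull _ d0); exact: leqnSn.
  have S2 : m%:R <= Q ^+ N.
    rewrite -natrX ler_nat; apply: leq_trans (ltnW (ltn_expl N (finNzRing_gt1 F))).
    by rewrite /N; clear -mg; lia.
  have QN0 : 0 < Q ^+ N by rewrite exprn_gt0.
  have S3 : Q ^+ N * (m%:R * Q^-1 ^+ (2 * N)) <= 1.
    rewrite mulrA exprVn ler_pdivrMr ?exprn_gt0 // mul1r mulnC exprM expr2 ler_wpM2l //; exact: ltW.
  have /andP[a0 a1] := sqf_density01; have /andP[v0 v1] := QV01.
  rewrite normrM (ger0_norm (_ : 0 <= sqf_density * (1 - Q^-1) * Q ^+ N)); last first.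
    by rewrite !mulr_ge0 ?subr_ge0 // ltW.
  rewrite ler0_norm ?subr_le0 // opprB.
  apply: le_trans S3; apply: le_trans (_ : Q ^+ N * (1 - Pi) <= _); last first.
    by rewrite ler_wpM2l ?(ltW QN0) //; lra.
  rewrite ler_wpM2r ?subr_ge0 // -[X in _ <= X]mul1r ler_wpM2r ?(ltW QN0) //.
  nra.
rewrite -[X in `|X|](subrKA (beta * Q ^+ N * T.[Q^-1 ^+ 2])).
apply: le_trans (ler_normD _ _) _.
have : 1 <= X * rankin_weight by move: X1 w1; nra.
rewrite mulrA in err1 *; lra.
Qed.

End Estimate.

(** * Averages over primes *)

Section PrimeSums.

Variables (R : realType) (F : finFieldType).
Hypothesis q4 : #|F| = 1 %[mod 4].
Local Notation q := #|F|.
Local Notation Q := (q%:R : R).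
Implicit Types (p B D l : {poly F}).

Let Q5 : 5 <= Q. Proof. exact: Q_ge5. Qed.
Let Q0 : 0 < Q. Proof. exact: Q_gt0. Qed.

(** Only the trivial bound q^d for the number of primes of degree d is used. *)
Lemma sum_irr_le n (G : nat -> R) : (forall d, 0 <= G d) ->
  \sum_(p <- irr F n) G (deg p) <= \sum_(1 <= d < n.+1) Q ^+ d * G d.
Proof.
move=> G0.
have -> : \sum_(p <- irr F n) G (deg p) =
    \sum_(p <- irr F n) \sum_(1 <= d < n.+1 | deg p == d) G d.
  rewrite [LHS]big_seq [RHS]big_seq; apply: eq_bigr => p; rewrite mem_irr => /andP[pi sp].
  rewrite big_mkcond (bigD1_seq (deg p)) ?iota_uniq //=.
    rewrite eqxx big1 ?addr0 // => d /negbTE; rewrite eq_sym => ->; by [].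
  by rewrite mem_index_iota deg_gt0 // -(size_deg (mirr_monic pi)).
under eq_bigr do rewrite big_mkcond.
rewrite exchange_big /=; apply: ler_sum => d _.
rewrite -big_mkcond /= -big_filter big_const_seq count_predT iter_addr_0 -[X in X <= _]mulr_natl.
rewrite ler_wpM2r // -natrX ler_nat -size_mon; apply: uniq_leq_size.
  exact/filter_uniq/irr_uniq.
move=> p; rewrite mem_filter mem_irr => /andP[/eqP<- /andP[pi _]].
exact/monic_in_mon/mirr_monic.
Qed.

Lemma prod_le_exp (I : eqType) (s : seq I) (x : I -> R) : (forall i, i \in s -> 0 <= x i) ->
  \prod_(i <- s) (1 + x i) <= expR (\sum_(i <- s) x i).
Proof.
elim: s => [|i s IHs] xs; first by rewrite !big_nil expR0.
rewrite !big_cons expRD; apply: ler_pM.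
- by rewrite addr_ge0 // xs // mem_head.
- rewrite big_seq prodr_ge0 // => j js; rewrite addr_ge0 // xs // inE js orbT //.
- exact: expR_ge1Dx.
by apply: IHs => j js; rewrite xs // inE js orbT.
Qed.

Lemma half_geom_sum n : \sum_(1 <= d < n.+1) (2^-1 : R) ^+ d <= 1.
Proof.
have -> : \sum_(1 <= d < n.+1) (2^-1 : R) ^+ d = 1 - 2^-1 ^+ n.
  elim: n => [|n IHn]; first by rewrite big_geq // expr0 subrr.
  by rewrite big_nat_recr //= IHn exprS; field.
by rewrite gerBl exprn_ge0.
Qed.

Lemma sum_irr_half n : \sum_(p <- irr F n) Q^-1 ^+ deg p * 2^-1 ^+ deg p <= 1.
Proof.
apply: le_trans (sum_irr_le n (G := fun d => Q^-1 ^+ d * 2^-1 ^+ d) _) _.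
  by move=> d; rewrite mulr_ge0 ?exprn_ge0 // invr_ge0 ltW.
apply: le_trans (half_geom_sum n); apply: ler_sum => d _.
by rewrite mulrA -exprMn mulfV ?gt_eqF // expr1n mul1r.
Qed.

Lemma sieve_poly_horner (v : {poly F} -> R) s x :
  (sieve_poly v s).[x] = \prod_(p <- s) (1 + v p * x ^+ deg p).
Proof. by rewrite /sieve_poly horner_prod; apply: eq_bigr => p _; rewrite !hornerE. Qed.

Lemma sieve_poly_ge0 (v : {poly F} -> R) s : {in s, forall p, 0 <= v p} -> nnpoly (sieve_poly v s).
Proof.
move=> v0; rewrite /sieve_poly big_seq; apply: (big_ind (@nnpoly R)); [exact: nnpoly1|exact: nnpolyM|].
move=> p ps k; rewrite coefD coef1 coefZ coefXn addr_ge0 // mulr_ge0 ?v0 //.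
Qed.

Lemma nnpoly_trunc (P : {poly R}) n x : nnpoly P -> 0 <= x ->
  \sum_(k < n) P`_k * x ^+ k <= P.[x].
Proof.
move=> P0 x0; rewrite (@horner_coef_wide _ (n + size P)) ?leq_addl //.
rewrite big_split_ord /= lerDl sumr_ge0 // => k _.
by rewrite mulr_ge0 // exprn_ge0.
Qed.

(** By [sieve] with v p = 1/(2^(deg p) - 1) <= 2 * 2^(-deg p), the average is at most the product of
    1 + v p |p|^(-1). This is bounded by the exponential of twice the sum in [sum_irr_half]. *)
Lemma rankin_weight_avg m : \sum_(f <- mon F m) rankin_weight R f <= expR 2 * Q ^+ m.
Proof.
pose v p : R := 1 / (2 ^+ deg p - 1).
have vb p : mirr p -> 0 <= v p <= 2 * 2^-1 ^+ deg p.
  move=> pi; have := pow2_gt1 R (deg_gt0 pi).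
  rewrite /v exprVn; move: (2 ^+ _) => z z2; apply/andP; split.
    by rewrite divr_ge0 //; lra.
  by rewrite ler_pdivrMr ?subr_gt0; [rewrite mulrAC ler_pdivlMr|]; lra.
have -> : \sum_(f <- mon F m) rankin_weight R f = geom_conv F (sieve_poly v (irr F m)) m.
  rewrite -sieve ?irr_uniq ?irr_mirr // [LHS]big_seq [RHS]big_seq; apply: eq_bigr => f fmm.
  by rewrite /rankin_weight /prime_divs (deg_mon fmm) big_filter.
have v0 : {in irr F m, forall p, 0 <= v p}.
  by move=> p; rewrite mem_irr => /andP[/vb/andP[]].
have QV0 : 0 <= Q^-1 by rewrite invr_ge0 ltW.
have -> : geom_conv F (sieve_poly v (irr F m)) m = Q ^+ m * \sum_(k < m.+1) (sieve_poly v (irr F m))`_k * Q^-1 ^+ k.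
  rewrite /geom_conv mulr_sumr; apply: eq_bigr => k _; rewrite mulrCA; congr (_ * _).
  by rewrite exprVn expfB_cond // gt_eqF // add0n -ltnS.
rewrite mulrC ler_wpM2r ?exprn_ge0 ?(ltW Q0) //.
apply: le_trans (nnpoly_trunc _ (sieve_poly_ge0 v0) QV0) _.
rewrite sieve_poly_horner; apply: le_trans (prod_le_exp _) _.
  by move=> p ps; rewrite mulr_ge0 ?v0 ?exprn_ge0.
rewrite ler_expR; apply: le_trans (_ : 2 * \sum_(p <- irr F m) Q^-1 ^+ deg p * 2^-1 ^+ deg p <= _); last first.
  by have := sum_irr_half m; lra.
rewrite mulr_sumr big_seq [X in _ <= X]big_seq; apply: ler_sum => p; rewrite mem_irr => /andP[pi _].
have /andP[_ h] := vb p pi; rewrite [X in X <= _]mulrC [X in _ <= X]mulrCA ler_wpM2l ?exprn_ge0 //.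
Qed.

(** The partial Euler product of P(s) in the variable u = q^(-s). Primes of degree above n do not
    affect its coefficients up to n, so [ecoef] gives the coefficients of the full product E. *)
Definition epoly n : {poly R} := sieve_poly (fun p => - (1 / (Q ^+ deg p + 1))) (irr F n).
Definition ecoef k : R := (epoly k)`_k.

Lemma epoly_horner n x : (epoly n).[x] = \prod_(p <- irr F n) (1 - x ^+ deg p / (Q ^+ deg p + 1)).
Proof.
rewrite sieve_poly_horner; apply: eq_bigr => p _; congr (1 + _).
by rewrite mulNr mulrAC mul1r.
Qed.

Lemma sieve_poly_stable (v : {poly F} -> R) n k : (k <= n)%N ->
  (sieve_poly v (irr F n))`_k = (sieve_poly v (irr F k))`_k.
Proof.
move=> kn; rewrite /sieve_poly (bigID (fun p => size p <= k.+1)%N) /=.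
have -> : \prod_(p <- irr F n | (size p <= k.+1)%N) (1 + v p *: 'X^(deg p)) =
   \prod_(p <- irr F k) (1 + v p *: 'X^(deg p)) :> {poly R}.
  rewrite -big_filter; apply: perm_big; apply: uniq_perm; [exact/filter_uniq/irr_uniq|exact: irr_uniq|].
  move=> p; rewrite mem_filter !mem_irr andbCA; congr (_ && _).
  by apply: andb_idr => /leq_trans; apply; rewrite ltnS.
set P := \prod_(p <- irr F k) _.
have [r ->] : exists r, \prod_(p <- irr F n | ~~ (size p <= k.+1)%N) (1 + v p *: 'X^(deg p)) = 1 + 'X^(k.+1) * r :> {poly R}.
  rewrite big_seq_cond; apply: (big_ind (fun P => exists r, P = 1 + 'X^(k.+1) * r)).
  - by exists 0; rewrite mulr0 addr0.
  - by move=> a b [r ->] [r' ->]; exists (r + r' + 'X^(k.+1) * r * r'); ring.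
  move=> p /andP[]; rewrite mem_irr -ltnNge => /andP[pi _].
  rewrite (size_deg (mirr_monic pi)) ltnS => kp.
  exists (v p *: 'X^(deg p - k.+1)).
  by rewrite -scalerAr -exprD subnKC.
by rewrite mulrDr mulr1 coefD mulrCA coefXnM ltnSn addr0.
Qed.

Lemma epoly_stable n k : (k <= n)%N -> (epoly n)`_k = ecoef k.
Proof. exact: sieve_poly_stable. Qed.

(** Making all signs positive majorizes the coefficients, and the majorant at u = 1/2 is at most the
    exponential of the sum in [sum_irr_half]. The bound is uniform in n. *)
Lemma epoly_abs n : \sum_(k < size (epoly n)) `|(epoly n)`_k| * 2^-1 ^+ k <= expR 1.
Proof.
pose v p : R := 1 / (Q ^+ deg p + 1).
have Qd p : 0 < Q ^+ deg p by rewrite exprn_gt0.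
have v0 p : 0 <= v p by rewrite divr_ge0 // addr_ge0 // ltW.
have dom s k : `|(sieve_poly (fun p => - v p) s)`_k| <= (sieve_poly v s)`_k.
  elim: s k => [|p s IHs] k; first by rewrite /sieve_poly !big_nil coef1; case: eqP; rewrite ?normr1 ?normr0.
  rewrite /sieve_poly !big_cons -/(sieve_poly v s) -/(sieve_poly (fun p => - v p) s).
  rewrite !mulrDl !mul1r -!scalerAl !coefD !coefZ !coefXnM; case: ifP => _.
    by rewrite !mulr0 !addr0.
  apply: le_trans (ler_normD _ _) _; apply: lerD => //.
  by rewrite normrM normrN (ger0_norm (v0 p)) ler_wpM2l.
apply: le_trans (_ : \sum_(k < size (epoly n)) (sieve_poly v (irr F n))`_k * 2^-1 ^+ k <= _).
  by apply: ler_sum => k _; rewrite ler_wpM2r ?exprn_ge0 // dom.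
apply: le_trans (nnpoly_trunc _ (sieve_poly_ge0 (in1W v0)) _) _; first by rewrite invr_ge0.
rewrite sieve_poly_horner; apply: le_trans (prod_le_exp _) _.
  by move=> p _; rewrite mulr_ge0 ?exprn_ge0.
rewrite ler_expR; apply: le_trans (sum_irr_half n); apply: ler_sum => p _.
rewrite ler_wpM2r ?exprn_ge0 // /v exprVn mul1r lef_pV2 ?posrE ?addr_gt0 //.
by rewrite lerDl.
Qed.

Lemma epoly_coef_le n k : `|(epoly n)`_k| <= expR 1 * 2 ^+ k.
Proof.
have [ks|ks] := ltnP k (size (epoly n)); last first.
  by rewrite nth_default // normr0 mulr_ge0 ?expR_ge0 ?exprn_ge0.
have h2 : (0 : R) < 2 ^+ k by rewrite exprn_gt0.
rewrite -ler_pdivrMr // -exprVn; apply: le_trans (epoly_abs n).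
by rewrite (bigD1 (Ordinal ks)) //= lerDl sumr_ge0.
Qed.

Lemma ecoef_le k : `|ecoef k| <= expR 1 * 2 ^+ k.
Proof. exact: epoly_coef_le. Qed.

Lemma epoly_tail n (u : R) : 0 <= u -> 2 * u <= 1 ->
  `|(epoly n).[u] - \sum_(k < n.+1) ecoef k * u ^+ k| <= expR 1 * (2 * u) ^+ n.+1.
Proof.
move=> u0 u1; rewrite (@horner_coef_wide _ (n.+1 + size (epoly n))) ?leq_addl //.
rewrite big_split_ord /= [X in `|X|](_ : _ = \sum_(i < size (epoly n)) (epoly n)`_(n.+1 + i) * u ^+ (n.+1 + i)); last first.
  rewrite [X in X - _]addrC; apply/eqP; rewrite subr_eq; apply/eqP; congr (_ + _).
  by apply: eq_bigr => k _; rewrite epoly_stable // -ltnS.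
apply: le_trans (ler_norm_sum _ _ _) _.
apply: le_trans (_ : (2 * u) ^+ n.+1 * \sum_(i < size (epoly n)) `|(epoly n)`_(n.+1 + i)| * 2^-1 ^+ (n.+1 + i) <= _).
  rewrite mulr_sumr; apply: ler_sum => i _; rewrite normrM (ger0_norm (exprn_ge0 _ u0)).
  rewrite mulrCA ler_wpM2l //.
  have -> : u ^+ (n.+1 + i) = (2 * u) ^+ (n.+1 + i) * 2^-1 ^+ (n.+1 + i).
    by rewrite -exprMn; congr (_ ^+ _); field.
  rewrite ler_wpM2r ?exprn_ge0 // exprD ler_piMr ?exprn_ge0 ?mulr_ge0 //.
  by rewrite exprn_ile1 // mulr_ge0.
rewrite mulrC ler_wpM2r ?exprn_ge0 ?mulr_ge0 //.
apply: le_trans (epoly_abs n).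
have -> : \sum_(i < size (epoly n)) `|(epoly n)`_i| * 2^-1 ^+ i =
  \sum_(i < n.+1 + size (epoly n)) `|(epoly n)`_i| * 2^-1 ^+ i.
  rewrite addnC big_split_ord /= [X in _ + X]big1 ?addr0 // => i _.
  by rewrite nth_default ?leq_addr // normr0 mul0r.
by rewrite big_split_ord /= lerDr sumr_ge0.
Qed.

Lemma sqf_density_sum j : \sum_(l <- mon F j) sqf_density R l = \sum_(k < j.+1) ecoef k * Q ^+ (j - k).
Proof.
transitivity (geom_conv F (epoly j) j).
  rewrite -sieve ?irr_uniq ?irr_mirr // [LHS]big_seq [RHS]big_seq; apply: eq_bigr => f fmm.
  by rewrite /sqf_density /prime_divs (deg_mon fmm) big_filter.
by apply: eq_bigr => k _; rewrite epoly_stable // -ltnS.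
Qed.

Lemma sqf_density_sqr l : l \is monic -> sqf_density R (l ^+ 2) = sqf_density R l.
Proof.
move=> lm; rewrite /sqf_density; apply: perm_big; apply: uniq_perm; rewrite ?prime_divs_uniq //.
by move=> p; rewrite !mem_prime_divs ?monic_exp //; case pi: (mirr p) => //=; rewrite mirr_dvdX.
Qed.

Lemma sum_issq m : \sum_(f <- mon F m | issq f) sqf_density R f =
  if (2 %| m)%N then \sum_(l <- mon F (m %/ 2)) sqf_density R l else 0.
Proof.
case: ifP => [/divnK mE|nm]; last first.
  rewrite big_seq_cond big_pred0 // => f; apply/negP => /andP[fmm].
  move=> /(issqP (mon_monic fmm))[l lm fE]; move/negP: nm; apply.
  by rewrite -(deg_mon fmm) fE degX // dvdn_mulr.
have sqm l : l \in mon F (m %/ 2) -> l ^+ 2 \in mon F m.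
  by move=> lm; rewrite -mE muln2 -addnn expr2 monM.
rewrite -big_filter (perm_big [seq l ^+ 2 | l <- mon F (m %/ 2)]).
  rewrite big_map [LHS]big_seq [RHS]big_seq; apply: eq_bigr => l lm.
  by rewrite sqf_density_sqr // (mon_monic lm).
apply: uniq_perm; first by rewrite filter_uniq // mon_uniq.
  rewrite map_inj_in_uniq ?mon_uniq // => a b am bm /eqP.
  rewrite eqf_sqr => /orP[/eqP//|/eqP ab].
  have := mon_monic am; rewrite ab monicE lead_coefN (eqP (mon_monic bm)) eq_sym.
  by rewrite (negbTE (neq_opp1 (F_odd q4))).
move=> f; rewrite mem_filter; apply/andP/mapP => [[sqf fmm]|[l lm ->]].
  have [l lm fE] := issqP (mon_monic fmm) sqf; exists l => //.
  have := deg_mon fmm; rewrite fE degX // => <-.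
  by rewrite mulKn // monic_in_mon.
by split; [apply/issqP; [rewrite monic_exp // (mon_monic lm)|exists l; rewrite ?(mon_monic lm)] | exact: sqm].
Qed.

End PrimeSums.

(** * The Euler product *)

Section GeometricBounds.

Variable R : realType.
Local Open Scope classical_set_scope.

Lemma cvg_pseries_geo (c : R^nat) (C a K : R) : 0 <= a ->
  (forall k, `|c k| <= C * a ^+ k) -> a * `|K| < 1 -> cvgn (pseries c K).
Proof.
move=> a0 cb aK; apply: normed_cvg => /=.
have aK0 : 0 <= a * `|K| by rewrite mulr_ge0.
have C0 : 0 <= C by have := cb 0%N; rewrite expr0 mulr1; apply: le_trans.
apply: (@series_le_cvg _ _ (geometric C (a * `|K|))).
- by move=> n; exact: normr_ge0.
- by move=> n; rewrite /= mulr_ge0 // exprn_ge0.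
- by move=> n /=; rewrite normrM normrX exprMn mulrA ler_wpM2r ?exprn_ge0.
by apply: is_cvg_geometric_series; rewrite ger0_norm.
Qed.

Lemma bernoulli54 k : k.+1%:R <= 4 * (5 / 4) ^+ k :> R.
Proof.
elim: k => [|k IHk]; first by rewrite expr0 mulr1 (ler_nat _ 1 4).
have h1 : 1 <= (5 / 4 : R) ^+ k by rewrite exprn_ege1 //; lra.
rewrite exprS -natr1; lra.
Qed.

(** The factor k + 1 of a derivative is absorbed into 4 (5/4)^k. Two derivatives of E then have
    growth rate 2 (5/4)^2 = 25/8 < 4, so they still converge at radius 1/4, beyond the point 1/q <=
    1/5. *)
Lemma pdiffs_bound (c : R^nat) (C a : R) : 0 <= a -> 0 <= C ->
  (forall k, `|c k| <= C * a ^+ k) ->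
  forall k, `|pseries_diffs c k| <= (4 * a * C) * (a * (5 / 4)) ^+ k.
Proof.
move=> a0 C0 cb k; rewrite /pseries_diffs normrM normr_nat.
apply: le_trans (_ : (4 * (5 / 4) ^+ k) * (C * a ^+ k.+1) <= _).
  by rewrite ler_pM // bernoulli54.
rewrite [X in _ <= _ * X]exprMn [in X in X <= _]exprS; move: ((5 / 4 : R) ^+ k) (a ^+ k) => x y.
by rewrite le_eqVlt; apply/orP; left; apply/eqP; ring.
Qed.

End GeometricBounds.

(** * The Euler product as a power series in q^(-s) *)

Section EulerProductLimit.

Variables (R : realType) (F : finFieldType).
Hypothesis q4 : #|F| = 1 %[mod 4].
Local Notation q := #|F|.
Local Notation Q := (q%:R : R).
Local Notation ec := (ecoef R F).
Local Open Scope classical_set_scope.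

Let Q5 : 5 <= Q. Proof. exact: Q_ge5. Qed.
Let Q0 : 0 < Q. Proof. exact: Q_gt0. Qed.
Let QV0 : 0 < Q^-1. Proof. by rewrite invr_gt0. Qed.
Let QV5 : Q^-1 <= 1 / 5.
Proof. by rewrite mul1r lef_pV2 ?posrE. Qed.

Definition ephi (u : R) : R := limn (pseries ec u).
Definition ephi1 (u : R) : R := limn (pseries (pseries_diffs ec) u).

Lemma ecoef_diffs_le k : `|pseries_diffs ec k| <= (4 * 2 * expR 1) * (2 * (5 / 4)) ^+ k.
Proof. by apply: pdiffs_bound; rewrite ?expR_ge0 // => j; exact: ecoef_le. Qed.

Lemma cvg_ec (u : R) : 2 * `|u| < 1 -> cvgn (pseries ec u).
Proof. by apply: cvg_pseries_geo => // k; exact: ecoef_le. Qed.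

Lemma cvg_ec1 (u : R) : `|u| <= 1 / 4 -> cvgn (pseries (pseries_diffs ec) u).
Proof. by move=> u1; apply: (cvg_pseries_geo _ ecoef_diffs_le); lra. Qed.

Lemma ephi_derive (u : R) : `|u| < 1 / 4 -> is_derive u 1 ephi (ephi1 u).
Proof.
move=> u1; have n4 : `|1 / 4 : R| = 1 / 4 by rewrite ger0_norm //; lra.
apply: (@pseries_snd_diffs _ _ (1 / 4)); last by rewrite n4.
- by apply: cvg_ec; rewrite n4; lra.
- by apply: cvg_ec1; rewrite n4.
apply: (cvg_pseries_geo _ (pdiffs_bound _ _ ecoef_diffs_le)); rewrite ?n4; try lra.
by rewrite mulr_ge0 ?expR_ge0 //; lra.
Qed.

Lemma epoly_cvg (u : R) : 0 <= u -> 2 * u < 1 -> (fun n => (epoly R F n).[u]) @ \oo --> ephi u.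
Proof.
move=> u0 u1; have cv : pseries ec u @ \oo --> ephi u by apply: cvg_ec; rewrite ger0_norm.
have -> : (fun n => (epoly R F n).[u]) = (fun n => pseries ec u n.+1 + ((epoly R F n).[u] - pseries ec u n.+1)).
  by apply/funext => n; rewrite addrC subrK.
rewrite -[ephi u]addr0; apply: cvgD.
  by have := cv; rewrite -cvg_shiftS.
apply: norm_cvg0; apply: (@squeeze_cvgr _ _ _ _ (fun=> 0) (fun n => expR 1 * (2 * u) ^+ n)).
- apply: nearW => n; rewrite normr_ge0 /=.
  apply: le_trans (_ : expR 1 * (2 * u) ^+ n.+1 <= _).
    by have := epoly_tail q4 n u0 (ltW u1); rewrite /pseries /series /= big_mkord.
  by rewrite ler_wpM2l ?expR_ge0 // exprS ler_piMl ?exprn_ge0 ?mulr_ge0 // ltW.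
- exact: cvg_cst.
by apply: cvg_geometric; rewrite ger0_norm // mulr_ge0.
Qed.

Lemma poly_norm_deg (p : {poly F}) : poly_norm R p = Q ^+ deg p.
Proof. by []. Qed.

Lemma euler_prodE n (s : R) :
  \big[*%R/1]_(p \in @prime_polys F n) (1 - 1 / ((poly_norm R p + 1) * poly_norm R p `^ s)) =
  (epoly R F n).[Q `^ (- s)].
Proof.
have -> : @prime_polys F n = [set` irr F n].
  apply/seteqP; split=> p /=; rewrite mem_irr /mirr.
    by case=> pm pi sp; rewrite pm sp andbT /=; apply/irreducibleP.
  by case/andP=> /andP[pm /irreducibleP pi] sp.
rewrite -fsbig_seq ?irr_uniq // epoly_horner; apply: eq_bigr => p _.
rewrite poly_norm_deg powRN exprVn; congr (1 - _).
have -> : (Q ^+ deg p) `^ s = (Q `^ s) ^+ deg p.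
  by rewrite -!powR_mulrn ?powR_ge0 ?(ltW Q0) // powRAC.
by rewrite invfM mul1r mulrC.
Qed.

Lemma euler_PE (s : R) : Q `^ (- s) < 1 / 2 -> euler_P F s = ephi (Q `^ (- s)).
Proof.
move=> su; rewrite /euler_P; under eq_fun do rewrite euler_prodE.
apply: cvg_lim => //; apply: epoly_cvg; rewrite ?powR_ge0 //; lra.
Qed.

Lemma powQ1 : Q `^ (- 1) = Q^-1.
Proof. by rewrite powRN powRr1 // ltW. Qed.

Lemma euler_P1 : euler_P F 1 = ephi Q^-1.
Proof. by rewrite euler_PE powQ1 //; have := QV5; lra. Qed.

Lemma powQ_exp (s : R) : Q `^ s = expR (s * ln Q).
Proof. by rewrite /powR gt_eqF. Qed.

Lemma lnQ_gt0 : 0 < ln Q.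
Proof. by rewrite ln_gt0 //; have := Q5; lra. Qed.

Lemma euler_P_derive : derive1 (@euler_P R F) 1 = ephi1 Q^-1 * (- ln Q * Q^-1).
Proof.
rewrite derive1E.
have -> : 'D_1 (@euler_P R F) 1 = 'D_1 (ephi \o (fun s : R => expR (- s * ln Q))) 1.
  apply: near_eq_derive; near=> s.
  rewrite /= -powQ_exp; apply: euler_PE.
  (* Near s = 1 one has s > 1/2, so q^(-s) <= q^(-1/2) < 1/2 because q >= 5. There the product and
     the series agree. *)
  have s1 : 1 / 2 < s by near: s; apply: lt_nbhsr; lra.
  apply: le_lt_trans (_ : Q `^ (- (1 / 2)) < _).
    by rewrite ler_powR //; have := Q5; lra.
  rewrite powRN; have t0 := powR_gt0 (1 / 2) Q0.
  have tt : Q `^ (1 / 2) * Q `^ (1 / 2) = Q.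
    by rewrite -powRD ?gt_eqF ?implybT // (_ : 1 / 2 + 1 / 2 = 1) ?powRr1 ?(ltW Q0) //; field.
  move: (Q `^ (1 / 2)) t0 tt => t t0 tt; rewrite mul1r ltf_pV2 ?posrE //; have := Q5; nra.
have dexp : is_derive (1 : R) (1 : R) (fun s : R => expR (- s * ln Q)) (expR (- 1 * ln Q) * (- ln Q)).
  have dlin : is_derive (1 : R) (1 : R) (fun s : R => - s * ln Q) (- ln Q).
    have -> : (fun s : R => - s * ln Q) = (fun s : R => - ln Q * s) by apply/funext => s; ring.
    by apply: is_derive_eq; rewrite ?scaler1 //= mulr1.
  exact: (@is_derive1_comp _ expR).
have e1 : expR (- 1 * ln Q) = Q^-1 by rewrite -powQ_exp powQ1.
have dphi : is_derive (expR (- 1 * ln Q)) 1 ephi (ephi1 Q^-1).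
  by rewrite e1; apply: ephi_derive; rewrite ger0_norm ?(ltW QV0) //; have := QV5; lra.
have dc := @is_derive1_comp _ ephi (fun s : R => expR (- s * ln Q)) 1 _ _ dphi dexp.
by rewrite (derive_val (is_derive := dc)) e1 [_^-1 * _]mulrC.
Unshelve. all: by end_near. Qed.

(** Needed to divide by P(1). By [prod_ge_1sub] every partial product is at least 1 minus a sum over
    primes, and q^(-1) <= 1/4 bounds that sum by half of the one in [sum_irr_half]. *)
Lemma euler_P1_gt0 : 0 < euler_P F 1 :> R.
Proof.
rewrite euler_P1; apply: lt_le_trans (_ : 1 / 2 <= _); first by lra.
have u1 : 2 * Q^-1 < 1 by have := QV5; lra.
have cv := epoly_cvg (ltW QV0) u1.
rewrite -(cvg_lim _ cv) //; apply: limr_ge; first by apply/cvg_ex; exists (ephi Q^-1).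
apply: nearW => n; rewrite epoly_horner.
have QVd d : 0 <= Q^-1 ^+ d <= 1 by apply: powV01; have := Q5; lra.
have xb (p : {poly F}) : 0 <= Q^-1 ^+ deg p / (Q ^+ deg p + 1) <= Q^-1 ^+ deg p * Q^-1 ^+ deg p.
  have /andP[v0 v1] := QVd (deg p); have Qd : 0 < Q ^+ deg p by rewrite exprn_gt0.
  rewrite divr_ge0 ?addr_ge0 ?(ltW Qd) //= ler_wpM2l // exprVn lef_pV2 ?posrE ?addr_gt0 //.
  by rewrite lerDl.
have /andP[h _] : 1 - \sum_(p <- irr F n) Q^-1 ^+ deg p / (Q ^+ deg p + 1) <=
    \prod_(p <- irr F n) (1 - Q^-1 ^+ deg p / (Q ^+ deg p + 1)) <= 1.
  apply: prod_ge_1sub => p _; have /andP[x0 x1] := xb p; rewrite x0 /=.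
  have /andP[v0 v1] := QVd (deg p); apply: le_trans x1 _; nra.
apply: le_trans h; suff : \sum_(p <- irr F n) Q^-1 ^+ deg p / (Q ^+ deg p + 1) <= 1 / 2 by lra.
apply: le_trans (_ : 1 / 2 * \sum_(p <- irr F n) Q^-1 ^+ deg p * 2^-1 ^+ deg p <= _); last first.
  by have := sum_irr_half R q4 n; lra.
rewrite mulr_sumr big_seq [X in _ <= X]big_seq; apply: ler_sum => p; rewrite mem_irr => /andP[pi _].
have /andP[_ x1] := xb p; apply: le_trans x1 _; rewrite mulrCA.
have /andP[v0 v1] := QVd (deg p); rewrite ler_wpM2l //.
have d0 := deg_gt0 pi; rewrite -(prednK d0) !exprS.
have h2 : Q^-1 ^+ (deg p).-1 <= 2^-1 ^+ (deg p).-1.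
  by apply: lerXn2r; rewrite ?nnegrE ?(ltW QV0) //; have := QV5; lra.
have h3 : 0 <= Q^-1 ^+ (deg p).-1 by have /andP[] := QVd (deg p).-1.
apply: le_trans (_ : Q^-1 * 2^-1 ^+ (deg p).-1 <= _); first by rewrite ler_wpM2l // ltW.
by rewrite mulrA ler_wpM2r ?exprn_ge0 //; have := QV5; lra.
Qed.

Definition msum y : R := \sum_(j < y.+1) Q^-1 ^+ j * \sum_(l <- mon F j) sqf_density R l.

(** By [sqf_density_sum] the term e_k q^(-k) occurs once for each j with k <= j <= y. *)
Lemma msumE y : msum y = \sum_(k < y.+1) (y.+1%:R - k%:R) * (ec k * Q^-1 ^+ k).
Proof.
have -> : msum y = \sum_(j < y.+1) \sum_(k < j.+1) ec k * Q^-1 ^+ k.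
  apply: eq_bigr => j _; rewrite sqf_density_sum // mulr_sumr; apply: eq_bigr => k _.
  rewrite mulrCA; congr (_ * _); have kj : (k <= j)%N by rewrite -ltnS.
  by rewrite -{1}(subnKC kj) exprD -mulrA -exprMn mulVf ?gt_eqF // expr1n mulr1.
elim: y => [|y IHy]; first by rewrite !big_ord1 subr0 mul1r.
rewrite big_ord_recr /= IHy [RHS]big_ord_recr /= [X in _ + X = _]big_ord_recr /= addrA -big_split /=.
congr (_ + _); last by rewrite -[y.+2%:R]natr1 addrAC subrr add0r mul1r.
by apply: eq_bigr => k _; rewrite -[y.+2%:R]natr1; ring.
Qed.

(** The sum of [msumE] with y kept in the weights but the range freed. As n grows it tends to (y +
    1) E(1/q) - E'(1/q)/q. *)
Definition mtail y n : R := \sum_(k < n) (y.+1%:R - k%:R) * (ec k * Q^-1 ^+ k).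

Lemma mtail_cvg y : (fun n => mtail y n.+1) @ \oo --> y.+1%:R * ephi Q^-1 - Q^-1 * ephi1 Q^-1.
Proof.
have nQ : `|Q^-1| = Q^-1 by rewrite ger0_norm // ltW.
have -> : (fun n => mtail y n.+1) = (fun n => y.+1%:R * pseries ec Q^-1 n.+1 - Q^-1 * pseries (pseries_diffs ec) Q^-1 n).
  apply/funext => n; rewrite /mtail /pseries /series /= !big_mkord.
  under eq_bigr do rewrite mulrBl.
  rewrite sumrB -mulr_sumr; congr (_ - _).
  rewrite big_ord_recl mul0r add0r mulr_sumr; apply: eq_bigr => k _.
  by rewrite /pseries_diffs /= /bump /= add1n exprS; ring.
apply: cvgB; apply: cvgMr.
  have : pseries ec Q^-1 @ \oo --> ephi Q^-1 by apply: cvg_ec; rewrite nQ; have := QV5; lra.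
  by rewrite -cvg_shiftS.
by apply: cvg_ec1; rewrite nQ; have := QV5; lra.
Qed.

Lemma geom_le5 (x : R) n : 0 <= x -> x <= 4 / 5 -> \sum_(i < n) x ^+ i <= 5.
Proof.
move=> x0 x1; have xn : 0 <= x ^+ n by rewrite exprn_ge0.
have s0 : 0 <= \sum_(i < n) x ^+ i by rewrite sumr_ge0 // => i _; rewrite exprn_ge0.
have := subrX1 x n; move: (\sum_(i < n) _) s0 (x ^+ n) xn => S s0 z z0 E; nra.
Qed.

(** At k = y + 1 + i the weight has absolute value i <= 2^i, so the tail is geometric of ratio 4/q
    <= 4/5. This is the source of the factor 5. *)
Lemma mtail_bound y t : `|mtail y (y.+1 + t) - msum y| <= 5 * expR 1 * (2 * Q^-1) ^+ y.+1.
Proof.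
rewrite msumE /mtail big_split_ord /= addrAC subrr add0r.
apply: le_trans (ler_norm_sum _ _ _) _.
set r := 2 * Q^-1; have r0 : 0 <= r by rewrite mulr_ge0 // ltW.
apply: le_trans (_ : expR 1 * r ^+ y.+1 * \sum_(i < t) (2 * r) ^+ i <= _); last first.
  rewrite -[5 * _ * _]mulrA [5 * _]mulrC ler_wpM2l ?mulr_ge0 ?expR_ge0 ?exprn_ge0 //.
  by apply: geom_le5; rewrite ?mulr_ge0 // /r; have := QV5; lra.
rewrite mulr_sumr; apply: ler_sum => i _.
rewrite natrD opprD addrA subrr add0r normrM normrN normr_nat normrM.
rewrite (ger0_norm (exprn_ge0 _ (ltW QV0))).
apply: le_trans (_ : 2 ^+ i * (expR 1 * 2 ^+ (y.+1 + i) * Q^-1 ^+ (y.+1 + i)) <= _).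
  apply: ler_pM; rewrite ?mulr_ge0 ?exprn_ge0 ?(ltW QV0) //.
    by rewrite -natrX ler_nat ltnW // ltn_expl.
  by rewrite ler_wpM2r ?exprn_ge0 ?(ltW QV0) // ecoef_le.
rewrite le_eqVlt; apply/orP; left; apply/eqP.
by rewrite /r !exprMn !exprD; ring.
Qed.

Lemma msum_estimate y :
  `|msum y - (y.+1%:R * ephi Q^-1 - Q^-1 * ephi1 Q^-1)| <= 5 * expR 1 * (2 * Q^-1) ^+ y.+1.
Proof.
rewrite distrC; set L := y.+1%:R * ephi Q^-1 - Q^-1 * ephi1 Q^-1.
have cv : (fun n => `|mtail y (n + y).+1 - msum y|) @ \oo --> `|L - msum y|.
  apply: cvg_norm; apply: cvgB; last exact: cvg_cst.
  by have := @mtail_cvg y; rewrite -(cvg_shiftn y).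
rewrite -(cvg_lim _ cv) //; apply: limr_le; first by apply/cvg_ex; exists `|L - msum y|.
by apply: nearW => n; rewrite addnC -addSn; exact: mtail_bound.
Qed.

End EulerProductLimit.

(** * The asymptotic formula *)

Section Assembly.

Variables (R : realType) (F : finFieldType).
Hypothesis q4 : #|F| = 1 %[mod 4].
Local Notation q := #|F|.
Local Notation Q := (q%:R : R).
Local Open Scope classical_set_scope.

Let Q5 : 5 <= Q. Proof. exact: Q_ge5. Qed.
Let Q0 : 0 < Q. Proof. exact: Q_gt0. Qed.
Let t : R := Q `^ (1 / 2).
Let t0 : 0 < t. Proof. exact: powR_gt0. Qed.
Let tt : t ^+ 2 = Q.
Proof.
rewrite expr2 /t -powRD ?gt_eqF ?implybT //.
by rewrite (_ : 1 / 2 + 1 / 2 = 1) ?powRr1 ?(ltW Q0) //; field.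
Qed.
Let t2 : 2 <= t.
Proof. by have := Q5; rewrite -tt; move: t t0 => x x0; nra. Qed.
Let u : R := Q `^ (- (1 / 2)).
Let uE : u = t^-1. Proof. by rewrite /u powRN. Qed.
Let uu : u ^+ 2 = Q^-1. Proof. by rewrite uE exprVn tt. Qed.

Lemma sum_hyper (g : nat) (G : {poly F} -> R) :
  \sum_(D \in hyper_ensemble F g) G D = \sum_(D <- mon F (2 * g).+1 | sqf D) G D.
Proof.
have -> : hyper_ensemble F g = [set` [seq D <- mon F (2 * g).+1 | sqf D]].
  apply/seteqP; split=> D /=; rewrite mem_filter mem_mon -addn1.
    by case=> Dm sD /(square_freeP Dm) ->; rewrite Dm sD eqxx.
  by case/and3P=> Ds Dm /eqP sD; split=> //; apply/square_freeP.
by rewrite -fsbig_seq ?big_filter // filter_uniq // mon_uniq.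
Qed.

Lemma Lcoef_functional (D : {poly F}) g n : D \in mon F (2 * g).+1 -> sqf D -> (n <= 2 * g)%N ->
  (q ^ g)%:R * Lcoef D n = (q ^ n)%:R * Lcoef D (2 * g - n) :> int.
Proof.
move=> Dn Ds ng; have Dm := mon_monic Dn; have dD := deg_mon Dn.
have recip k : Lcoef D k = \sum_(f <- mon F k) chi f D.
  rewrite /Lcoef [LHS]big_seq [RHS]big_seq; apply: eq_bigr => f /mon_monic fm.
  exact: (chi_recip (F_odd q4) q4 (@exists_ext F)).
rewrite !recip; apply: (functional_equation (F_odd q4) Dm dD) => // p pi.
by rewrite (dvd_vP _ pi (monic_neq0 Dm)) -ltnNge ltnS; exact: (sqfP Dm Ds).
Qed.

(** At u^2 = 1/q the functional equation says that the terms of index n and 2 g - n are equal. The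
    terms of index above g therefore repeat those of index below g. *)
Lemma Lpoly_central (D : {poly F}) g : D \in mon F (2 * g).+1 -> sqf D ->
  (map_poly intr (curve_poly D)).[u] =
  \sum_(n < g.+1) (Lcoef D n)%:~R * u ^+ n + \sum_(n < g) (Lcoef D n)%:~R * u ^+ n.
Proof.
move=> Dn Ds; rewrite (curve_polyE q4 (mon_monic Dn) (deg_mon Dn)).
have sL : (size (map_poly intr (Lpoly D g) : {poly R}) <= (2 * g).+1)%N.
  by apply: leq_trans (size_poly _ _) _; exact: size_poly.
rewrite (horner_coef_wide _ sL).
under eq_bigr => n _ do rewrite coef_map /= coef_poly ltn_ord.
rewrite (_ : (2 * g).+1 = g.+1 + g)%N; last by lia.
rewrite big_split_ord /=; congr (_ + _).
rewrite [LHS](reindex_inj rev_ord_inj) /=; apply: eq_bigr => n _.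
move: (nat_of_ord n) (ltn_ord n) => {}n ng.
have -> : (g.+1 + (g - n.+1) = 2 * g - n)%N by lia.
have ng2 : (n <= 2 * g)%N by lia.
have := congr1 (intr : int -> R) (Lcoef_functional Dn Ds ng2).
rewrite !rmorphM /= !rmorph_nat !natrX => E.
apply: (mulfI (_ : Q ^+ n != 0)); first by rewrite expf_neq0 // gt_eqF.
rewrite mulrA -E -!mulrA mulrCA [RHS]mulrCA; congr (_ * _).
have -> : (2 * g - n = n + 2 * (g - n))%N by lia.
rewrite exprD exprM uu mulrCA -{1}(subnKC (ltnW ng)) [Q ^+ (_ + _)]exprD.
rewrite -mulrA -exprMn mulfV ?gt_eqF // expr1n mulr1 mulrC //.
Qed.

Definition hsum g n : R := \sum_(f <- mon F n) sqf_charsum R f (2 * g).+1.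

Lemma total_sum g :
  \sum_(D \in hyper_ensemble F g) (map_poly intr (curve_poly D)).[u] =
  \sum_(n < g.+1) u ^+ n * hsum g n + \sum_(n < g) u ^+ n * hsum g n.
Proof.
rewrite sum_hyper.
have swap (m : nat) : \sum_(D <- mon F (2 * g).+1 | sqf D) \sum_(n < m) (Lcoef D n)%:~R * u ^+ n =
    \sum_(n < m) u ^+ n * hsum g n.
  rewrite exchange_big /=; apply: eq_bigr => n _.
  rewrite -mulr_suml mulrC; congr (_ * _); rewrite /hsum /sqf_charsum exchange_big /=.
  by apply: eq_bigr => D _; rewrite rmorph_sum.
transitivity (\sum_(D <- mon F (2 * g).+1 | sqf D)
   (\sum_(n < g.+1) (Lcoef D n)%:~R * u ^+ n + \sum_(n < g) (Lcoef D n)%:~R * u ^+ n)).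
  rewrite big_seq_cond [RHS]big_seq_cond; apply: eq_bigr => D /andP[Dn Ds].
  exact: Lpoly_central.
by rewrite big_split /= !swap.
Qed.

Definition hmain g n : R := (1 - Q^-1) * Q ^+ (2 * g).+1 *
  (if (2 %| n)%N then \sum_(l <- mon F (n %/ 2)) sqf_density R l else 0).

Lemma hsum_estimate g n : (n <= g)%N ->
  `|hsum g n - hmain g n| <= 4 * expR 2 * Q * 2 ^+ g * (Q ^+ 2) ^+ n.
Proof.
move=> ng.
have -> : hmain g n = \sum_(f <- mon F n) (if issq f then sqf_density R f * (1 - Q^-1) * Q ^+ (2 * g).+1 else 0).
  rewrite /hmain -(sum_issq R q4) mulr_sumr [LHS]big_mkcond; apply: eq_bigr => f _.
  by case: ifP => // _; ring.
rewrite /hsum -sumrB; apply: le_trans (ler_norm_sum _ _ _) _.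
apply: le_trans (_ : \sum_(f <- mon F n) 4 * (Q * 2 ^+ g * Q ^+ n * rankin_weight R f) <= _).
  rewrite big_seq [X in _ <= X]big_seq; apply: ler_sum => f fn.
  by have := sqf_charsum_estimate R q4 (mon_monic fn) (g := g); rewrite (deg_mon fn); apply.
have -> : 4 * expR 2 * Q * 2 ^+ g * (Q ^+ 2) ^+ n = 4 * (Q * 2 ^+ g * Q ^+ n) * (expR 2 * Q ^+ n).
  by rewrite -exprM mulnC mulnS muln1 exprD; ring.
under eq_bigr do rewrite mulrA.
by rewrite -mulr_sumr ler_wpM2l ?rankin_weight_avg.
Qed.

Lemma geom_ge2 (x : R) g : 2 <= x -> \sum_(n < g.+1) x ^+ n <= 2 * x ^+ g.
Proof.
move=> x2; elim: g => [|g IHg]; first by rewrite big_ord1 expr0; lra.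
rewrite big_ord_recr /= exprS; have : 0 <= x ^+ g by rewrite exprn_ge0 //; lra.
by move: IHg; move: (\sum_(n < _) _) (x ^+ g) => S y; nra.
Qed.

Let K := 4 * expR 2 * Q.

(** With t = q^(1/2), the weight u^n turns the error q^(2 n) of [hsum_estimate] into t^(3 n). The
    geometric sum over n <= g is dominated by its last term. *)
Lemma weighted_estimate g m : (m <= g.+1)%N ->
  `|\sum_(n < m) u ^+ n * hsum g n - \sum_(n < m) u ^+ n * hmain g n| <= 2 * K * (2 ^+ g * t ^+ (3 * g)).
Proof.
move=> mg; rewrite -sumrB; apply: le_trans (ler_norm_sum _ _ _) _.
have K0 : 0 <= K by rewrite !mulr_ge0 ?expR_ge0 ?(ltW Q0).
have g2 : (0 : R) <= 2 ^+ g by rewrite exprn_ge0.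
have t3 : 0 <= t ^+ 3 by rewrite exprn_ge0 // ltW.
apply: le_trans (_ : \sum_(n < m) K * 2 ^+ g * (t ^+ 3) ^+ n <= _).
  apply: ler_sum => n _; rewrite -mulrBr normrM.
  have un : 0 <= u ^+ n by rewrite exprn_ge0 // powR_ge0.
  rewrite (ger0_norm un).
  have ng : (n <= g)%N by rewrite -ltnS; exact: leq_trans (ltn_ord n) mg.
  apply: le_trans (ler_wpM2l un (hsum_estimate ng)) _.
  rewrite mulrCA ler_wpM2l ?mulr_ge0 // -exprMn le_eqVlt; apply/orP; left; apply/eqP.
  congr (_ ^+ _); rewrite uE -tt; move: t t0 => x x0; field; lra.
rewrite -mulr_sumr.
apply: le_trans (_ : K * 2 ^+ g * \sum_(n < g.+1) (t ^+ 3) ^+ n <= _).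
  rewrite ler_wpM2l ?mulr_ge0 // -(subnKC mg) big_split_ord /= lerDl sumr_ge0 // => n _.
  by rewrite exprn_ge0.
have -> : 2 * K * (2 ^+ g * t ^+ (3 * g)) = K * 2 ^+ g * (2 * (t ^+ 3) ^+ g).
  by rewrite -exprM; ring.
rewrite ler_wpM2l ?mulr_ge0 // geom_ge2 //.
by move: t2; rewrite !exprS expr0; move: t => x x2; nra.
Qed.

(** Only even n = 2 j contribute, and u^(2 j) = q^(-j). *)
Lemma main_msum g m : \sum_(n < m.+1) u ^+ n * hmain g n = (1 - Q^-1) * Q ^+ (2 * g).+1 * msum R F m./2.
Proof.
rewrite /msum -(sum_even _ (fun j => Q^-1 ^+ j * \sum_(l <- mon F j) sqf_density R l)) mulr_sumr.
apply: eq_bigr => n _; rewrite /hmain; case: ifP => [/divnK nE|_]; last by rewrite !mulr0.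
rewrite -{1}nE mulnC exprM uu; ring.
Qed.

(** From 2/q <= (2/t)^2 with t = q^(1/2) and 2 (y + 1) >= g follows (2/q)^(y + 1) <= (2/t)^g, and
    q^(2 g) t^(-g) = t^(3 g). *)
Lemma msum_tail g y : (g <= 2 * y.+1)%N ->
  Q ^+ (2 * g).+1 * (5 * expR 1 * (2 * Q^-1) ^+ y.+1) <= 5 * expR 1 * Q * (2 ^+ g * t ^+ (3 * g)).
Proof.
move=> gy; have tV : 0 < t^-1 by rewrite invr_gt0.
have h1 : (2 * Q^-1) ^+ y.+1 <= (2 * t^-1) ^+ g.
  apply: le_trans (_ : (2 * t^-1) ^+ (2 * y.+1) <= _).
    rewrite exprM; apply: lerXn2r; rewrite ?nnegrE ?exprn_ge0 ?mulr_ge0 ?invr_ge0 ?(ltW Q0) ?(ltW t0) //.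
    by rewrite exprMn exprVn tt ler_wpM2r ?invr_ge0 ?(ltW Q0) // expr2; lra.
  apply: ler_wiXn2l => //; first by rewrite mulr_ge0 // ltW.
  by rewrite ler_pdivrMr // mul1r.
rewrite mulrCA -!mulrA ler_wpM2l // ler_wpM2l ?expR_ge0 //.
rewrite exprS -mulrA ler_wpM2l ?(ltW Q0) //.
apply: le_trans (ler_wpM2l _ h1) _; first by rewrite exprn_ge0 // ltW.
rewrite exprMn mulrCA ler_wpM2l ?exprn_ge0 //.
have -> : Q ^+ (2 * g) = t ^+ (3 * g) * t ^+ g by rewrite -tt -exprM -exprD; congr (_ ^+ _); lia.
by rewrite -mulrA -exprMn mulfV ?gt_eqF // expr1n mulr1.
Qed.

Let L1 := ephi F Q^-1.
Let D1 := Q^-1 * ephi1 F Q^-1.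
Let C := 2 * K + 2 * K + 2 * (5 * expR 1 * Q).

Lemma total_estimate g : (0 < g)%N ->
  `|\sum_(D \in hyper_ensemble F g) (map_poly intr (curve_poly D)).[u]
    - (1 - Q^-1) * Q ^+ (2 * g).+1 * (g.+1%:R * L1 - 2 * D1)| <= C * (2 ^+ g * t ^+ (3 * g)).
Proof.
case: g => // g' _; set g := g'.+1; rewrite total_sum.
have e1 := weighted_estimate (leqnn g.+1).
have e2 := weighted_estimate (leqnSn g).
rewrite main_msum in e1; rewrite {1 2}/g main_msum -/g in e2.
set N := (2 * g).+1 in e1 e2 *; set Z := 2 ^+ g * _ in e1 e2 *.
set S1 := \sum_(n < g.+1) _ in e1 *; set S2 := \sum_(n < g) _ in e2 *.
have m1 := msum_estimate R q4 g./2; have m2 := msum_estimate R q4 g'./2.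
have b1 : Q ^+ N * (5 * expR 1 * (2 * Q^-1) ^+ (g./2).+1) <= 5 * expR 1 * Q * Z.
  by apply: msum_tail; rewrite /g; clear; lia.
have b2 : Q ^+ N * (5 * expR 1 * (2 * Q^-1) ^+ (g'./2).+1) <= 5 * expR 1 * Q * Z.
  by apply: msum_tail; rewrite /g; clear; lia.
(* The ranges n <= g and n <= g - 1 end at l of degree floor(g/2) and floor((g-1)/2). The numbers of
   admissible degrees add up to g + 1. *)
have hN : g.+1%:R = (g./2).+1%:R + (g'./2).+1%:R :> R.
  by rewrite -natrD; congr (_%:R); rewrite /g; clear; lia.
have W0 : 0 <= (1 - Q^-1) * Q ^+ N.
  by rewrite mulr_ge0 ?exprn_ge0 ?(ltW Q0) // subr_ge0 invf_le1 //; have := Q5; lra.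
have W1 : (1 - Q^-1) * Q ^+ N <= Q ^+ N.
  by rewrite ler_piMl ?exprn_ge0 ?(ltW Q0) // gerBl invr_ge0 ltW.
move: m1 m2; rewrite -/L1 -/D1; set M1 := msum _ _ _ in e1 *; set M2 := msum _ _ _ in e2 *.
set y1 := (g./2).+1%:R in hN *; set y2 := (g'./2).+1%:R in hN *.
move=> m1 m2; set W := (1 - Q^-1) * Q ^+ N in e1 e2 W0 W1 *.
have c1 : `|W * (M1 - (y1 * L1 - D1))| <= 5 * expR 1 * Q * Z.
  apply: le_trans b1; rewrite normrM (ger0_norm W0); apply: ler_pM => //.
have c2 : `|W * (M2 - (y2 * L1 - D1))| <= 5 * expR 1 * Q * Z.
  apply: le_trans b2; rewrite normrM (ger0_norm W0); apply: ler_pM => //.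
have -> : S1 + S2 - W * (g.+1%:R * L1 - 2 * D1) =
   (S1 - W * M1) + (S2 - W * M2) + (W * (M1 - (y1 * L1 - D1)) + W * (M2 - (y2 * L1 - D1))).
  by rewrite hN; ring.
apply: le_trans (ler_normD _ _) _.
have d1 := ler_normD (S1 - W * M1) (S2 - W * M2).
have d2 := ler_normD (W * (M1 - (y1 * L1 - D1))) (W * (M2 - (y2 * L1 - D1))).
have -> : C * Z = 2 * K * Z + 2 * K * Z + 2 * (5 * expR 1 * Q * Z) by rewrite /C; ring.
move: (2 * K * Z) (5 * expR 1 * Q * Z) e1 e2 c1 c2 d1 d2 => a b e1 e2 c1 c2 d1 d2; lra.
Qed.

Lemma error_exponent g :
  2 ^+ g * t ^+ (3 * g) <= (Q ^+ (2 * g + 1)) `^ (3 / 4 + logq F 2 / 2).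
Proof.
have lQ := lnQ_gt0 R q4.
have l2 : 0 <= ln (2 : R) by rewrite ln_ge0 // (ler_nat _ 1 2).
have -> : (Q ^+ (2 * g + 1)) `^ (3 / 4 + logq F 2 / 2) =
    expR ((2 * g + 1)%:R * (3 / 4 * ln Q + ln 2 / 2)).
  rewrite /powR gt_eqF ?exprn_gt0 // lnXn // /logq -mulr_natl; congr expR.
  by field; rewrite gt_eqF.
have -> : 2 ^+ g = expR (g%:R * ln 2) :> R by rewrite expRM_natl lnK // posrE.
have -> : t ^+ (3 * g) = expR ((3 * g)%:R * (1 / 2 * ln Q)).
  by rewrite expRM_natl /t (powQ_exp q4).
rewrite -expRD ler_expR (natrD _ (2 * g) 1) (natrM _ 2 g) (natrM _ 3 g); have : 0 <= g%:R :> R by [].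
move: (g%:R : R) (ln 2) (ln Q) l2 lQ => x a b a0 b0 x0; nra.
Qed.

(** Here 1/(2 zeta_A(2)) = (1 - 1/q)/2 and log_q |D| + 1 = 2 (g + 1). Moreover P'(1) = -(ln q)
    E'(1/q)/q, so the last term of the braces becomes -4 [D1] / [L1]. *)
Lemma main_termE g :
  euler_P F 1 / (2 * zeta_A F 2) * Q ^+ (2 * g + 1) *
   (logq F (Q ^+ (2 * g + 1)) + 1 + 4 / ln Q * (derive1 (@euler_P R F) 1 / euler_P F 1)) =
  (1 - Q^-1) * Q ^+ (2 * g).+1 * (g.+1%:R * L1 - 2 * D1).
Proof.
have lQ := lnQ_gt0 R q4; have P0 := euler_P1_gt0 R q4.
rewrite (euler_P_derive R q4); move: P0; rewrite (euler_P1 R q4) -/L1 => P0.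
have z2 : zeta_A F 2 = 1 / (1 - Q^-1) :> R.
  have h : 1 - 2 = - 1 :> R by ring.
  by rewrite /zeta_A h (powQ1 R F).
have v1 : 0 < 1 - Q^-1 by rewrite subr_gt0 invf_lt1 //; have := Q5; lra.
have -> : logq F (Q ^+ (2 * g + 1)) = (2 * g + 1)%:R :> R.
  by rewrite /logq lnXn // -[ln Q *+ _]mulr_natl mulfK // gt_eqF.
rewrite z2 /D1 addn1 -natr1 -[(2 * g).+1%:R]natr1 natrM.
move: (ephi1 F Q^-1) (Q ^+ (2 * g).+1) => d y; move: (Q^-1) v1 => v v1.
by field; rewrite !gt_eqF.
Qed.

Lemma total_bigO_bound : exists c : R, forall g, (0 < g)%N ->
  `|\sum_(D \in hyper_ensemble F g) (map_poly intr (curve_poly D)).[Q `^ (- (1 / 2))]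
    - euler_P F 1 / (2 * zeta_A F 2) * Q ^+ (2 * g + 1) *
      (logq F (Q ^+ (2 * g + 1)) + 1 + 4 / ln Q * (derive1 (@euler_P R F) 1 / euler_P F 1))|
  <= c * (Q ^+ (2 * g + 1)) `^ (3 / 4 + logq F 2 / 2).
Proof.
exists C => g g0; rewrite main_termE; apply: le_trans (total_estimate g0) _.
apply: ler_wpM2l (error_exponent g).
by rewrite !addr_ge0 // !mulr_ge0 ?expR_ge0 ?(ltW Q0).
Qed.

End Assembly.

Local Open Scope classical_set_scope.

Theorem theorem1 (R : realType) (F : finFieldType) (hq : #|F| = 1 %[mod 4]) :
  let q : R := #|F|%:R in
  let normD (g : nat) : R := q ^+ (2 * g + 1) in
  (fun g : nat => \sum_(D \in hyper_ensemble F g)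
                    (map_poly intr (curve_poly D)).[q `^ (- (1 / 2))])
  = (fun g : nat =>
       euler_P F 1 / (2 * zeta_A F 2) * normD g *
       (logq F (normD g) + 1 +
        4 / ln q * (derive1 (@euler_P R F) 1 / euler_P F 1)))
  +O_\oo (fun g : nat => normD g `^ (3 / 4 + logq F 2 / 2)).
Proof.
move=> q normD; have [c bound] := total_bigO_bound R hq.
apply/eqaddOP; near=> k; near=> g.
have kc : c <= k by near: k; apply: nbhs_pinfty_ge; exact: num_real.
have g0 : (0 < g)%N by near: g; exact: nbhs_infty_gt.
apply: le_trans (bound g g0) _.
rewrite ger0_norm ?powR_ge0 // ler_wpM2r // powR_ge0.
Unshelve. all: by end_near. Qed.
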